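(* Suppose that $F\in C_p^\infty(\mathbb{R}^m)$ and that there exist constants $C_1,C_2,C_3>0$, $\epsilon>0$ and integers $l_1,\dots,l_m\ge 1$ such that for all $y\in\mathbb{R}^m$ $$-C_3+C_1\sum_{i=1}^m|y_i|^{2l_i}\le F(y)\le C_2\sum_{i=1}^m|y_i|^{2l_i}+C_3,\qquad \|\nabla^2F(y)\|\le C_2\sum_{i=1}^m|y_i|^{2l_i-\epsilon}+C_3 .$$ Suppose also that at least $m$ of the vectors $\sigma_1,\dots,\sigma_d$ are linearly independent. Then, for all sufficiently small stepsizes $h>0$, the law of $X_{N^h}$ admits a smooth (infinitely differentiable) density function with respect to Lebesgue measure on $\mathbb{R}^{2m}$.
   Context: Setting. Let $m,d\ge1$, $T>0$, $v>0$, $\sigma=[\sigma_1,\dots,\sigma_d]$ with constant vectors $\sigma_k\in\mathbb{R}^m$, and let $W=(W^1,\dots,W^d)^\top$ be a $d$-dimensional standard Wiener process on a filtered complete probability space $(\Omega,\mathscr F,\{\mathscr F_t\}_{t\ge0},\mathbb P)$ (taken to be the Wiener space). The initial value $X(0)=(P(0)^\top,Q(0)^\top)^\top\in\mathbb{R}^{2m}$ is deterministic. Standing assumptions on $F$: $F\in C^2(\mathbb{R}^m)$; there is a constant $C_0$ with $F(y)+C_0>0$ for all $y$; $\limsup_{r\downarrow0}\sup_{y\in\mathbb{R}^m}\frac{\|y\|^r}{C_0+F(y)}<\infty$; and there is $K\ge0$ with $\lambda_{\min}(\nabla^2F(y))\ge-K$ for all $y\in\mathbb{R}^m$. When the polynomial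 bounds in the claim are assumed, it is also supposed that for every multi-index $a$ with $|a|\ge1$ one has $|\partial^aF(y)|\le C(1+\|y\|^{2\max_i l_i})$ for all $y$, with $C$ possibly depending on $a$. $C_p^\infty(\mathbb{R}^m)$ denotes smooth functions which, with all their partial derivatives, have at most polynomial growth. Scheme (splitting AVF scheme for the Langevin equation $dP=-\nabla F(Q)\,dt-vP\,dt+\sigma\,dW_t$, $dQ=P\,dt$). Let $h=T/N^h$ with $N^h\in\mathbb{N}$, $t_n=nh$, $h<2/\sqrt K$ (no restriction if $K=0$), so that the scheme is solvable. $X_n=(P_n^\top,Q_n^\top)^\top$ is defined by $X_0=X(0)$ and, for $n=0,\dots,N^h-1$, $$\bar P_{n+1}=P_n-h\int_0^1\nabla F(Q_n+\tau(\bar Q_{n+1}-Q_n))\,d\tau,\qquad \bar Q_{n+1}=Q_n+\tfrac h2(\bar P_{n+1}+P_n),$$ $$P_{n+1}=e^{-vh}\bar P_{n+1}+\sum_{k=1}^d\int_{t_n}^{t_{n+1}}e^{-v(t_{n+1}-t)}\sigma_k\,dW^k_t,\qquad Q_{n+1}=\bar Q_{n+1}.$$ *)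

(* Defs.v *)
From HB Require Import structures.
From mathcomp Require Import all_boot all_order all_algebra.
From mathcomp Require Import all_classical all_reals all_analysis.

Set Implicit Arguments.
Unset Strict Implicit.
Unset Printing Implicit Defensive.

Import Order.TTheory GRing.Theory Num.Theory.
Import numFieldNormedType.Exports.

Local Open Scope classical_set_scope.
Local Open Scope ring_scope.

(** Vectors of R^n are row vectors ['rV[R]_n].  As the library does for
    [n.-tuple R], they carry the sigma-algebra generated by the coordinates,
    which on R^n is the Borel sigma-algebra. *)

Definition rV_coord (R : realType) n (i : 'I_n) (x : 'rV[R]_n) : R := x ord0 i.

Definition rV_display : measure_display -> measure_display.
Proof. exact. Qed.

Section rV_measurable.
Variables (R : realType) (n : nat).
Let coords : 'I_n -> 'rV[R]_n -> measurableTypeR R := @rV_coord R n.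

Let rV_set0 : g_sigma_preimage coords set0.
Proof. exact: sigma_algebra0. Qed.

Let rV_setC A : g_sigma_preimage coords A -> g_sigma_preimage coords (~` A).
Proof. exact: sigma_algebraC. Qed.

Let rV_bigcup (A : (set 'rV[R]_n)^nat) :
  (forall i, g_sigma_preimage coords (A i)) ->
  g_sigma_preimage coords (\bigcup_i (A i)).
Proof. exact: sigma_algebra_bigcup. Qed.

HB.instance Definition _ :=
  @isMeasurable.Build (rV_display (measure_tuple_display default_measure_display))
    'rV[R]_n (g_sigma_preimage coords) rV_set0 rV_setC rV_bigcup.

End rV_measurable.

Lemma measurable_rV_coord (R : realType) n (i : 'I_n) :
  measurable_fun [set: 'rV[R]_n] (@rV_coord R n i).
Proof.
move=> _ Y mY; rewrite setTI; apply: sub_sigma_algebra => /=.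
rewrite -bigcup_seq/=; exists i => /=; first by rewrite mem_index_enum.
by exists Y => //; rewrite setTI.
Qed.

Lemma measurable_fun_rV d (T : measurableType d) (R : realType) n
    (f : T -> 'rV[R]_n) :
  (forall i, measurable_fun [set: T] (@rV_coord R n i \o f)) ->
  measurable_fun [set: T] f.
Proof.
move=> mf.
suff prefS : g_sigma_preimage
    (fun i => (@rV_coord R n i : 'rV[R]_n -> measurableTypeR R) \o f)
    `<=` measurable.
  move=> _ A mA; rewrite setTI; apply: prefS; rewrite g_sigma_preimage_comp.
  by exists A => //; rewrite setTI.
apply: smallest_sub; first exact: sigma_algebra_measurable.
case: n => [|n] in f mf *; first by rewrite big_ord0.
rewrite -bigcup_mkord_ord; apply: bigcup_sub => i Ii.
by move=> A [B mB <-]; exact: mf.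
Qed.

Definition rV_cons (R : realType) n (z : measurableTypeR R * 'rV[R]_n) :
  'rV[R]_n.+1 := \row_j oapp (fun i => z.2 ord0 i) z.1 (unlift ord0 j).

Definition rV_uncons (R : realType) n (x : 'rV[R]_n.+1) :
  measurableTypeR R * 'rV[R]_n := (x ord0 ord0, \row_j x ord0 (lift ord0 j)).

Lemma rV_consK (R : realType) n : cancel (@rV_cons R n) (@rV_uncons R n).
Proof.
move=> [a x]; rewrite /rV_uncons mxE unlift_none /=; congr (_, _).
by apply/rowP => j; rewrite !mxE liftK.
Qed.

Lemma measurable_rV_cons (R : realType) n :
  measurable_fun setT (@rV_cons R n).
Proof.
apply: measurable_fun_rV => j; case: (unliftP ord0 j) => [i|] ->.
  rewrite (_ : _ \o _ = @rV_coord R n i \o snd); last first.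
    by apply/funext => z /=; rewrite /rV_coord mxE liftK.
  by apply: measurableT_comp; first exact: measurable_rV_coord.
rewrite (_ : _ \o _ = fst)//.
by apply/funext => z /=; rewrite /rV_coord mxE unlift_none.
Qed.

Lemma measurable_rV_uncons (R : realType) n :
  measurable_fun setT (@rV_uncons R n).
Proof.
apply: measurable_fun_pair; first exact: measurable_rV_coord.
apply: measurable_fun_rV => j.
rewrite (_ : _ \o _ = @rV_coord R n.+1 (lift ord0 j)).
  exact: measurable_rV_coord.
by apply/funext => x /=; rewrite /rV_coord mxE.
Qed.

Section lebesgue_rV_cons.
Local Open Scope ereal_scope.
Variables (R : realType) (n : nat).
Variable mu : {sigma_finite_measure set 'rV[R]_n -> \bar R}.

Definition lebesgue_rV_cons : set 'rV[R]_n.+1 -> \bar R :=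
  pushforward (@lebesgue_measure R \x mu) (@rV_cons R n).

Let preimage_measurable A : measurable A -> measurable (@rV_cons R n @^-1` A).
Proof. by move=> mA; rewrite -[X in measurable X]setTI; exact: measurable_rV_cons. Qed.

Let cons0 : lebesgue_rV_cons set0 = 0.
Proof. by rewrite /lebesgue_rV_cons /pushforward preimage_set0 measure0. Qed.

Let cons_ge0 A : 0 <= lebesgue_rV_cons A.
Proof. rewrite /lebesgue_rV_cons /pushforward; exact: measure_ge0. Qed.

Let cons_sigma_additive : semi_sigma_additive lebesgue_rV_cons.
Proof.
move=> A mA tA mUA; rewrite /lebesgue_rV_cons /pushforward preimage_bigcup.
apply: measure_semi_sigma_additive.
- by move=> i; exact: preimage_measurable.
- apply/trivIsetP => /= i j _ _ ij; rewrite -preimage_setI.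
  by move/trivIsetP : tA => /(_ _ _ _ _ ij) ->//; rewrite preimage_set0.
- by rewrite -preimage_bigcup; exact: preimage_measurable.
Qed.

HB.instance Definition _ := isMeasure.Build _ _ _ lebesgue_rV_cons
  cons0 cons_ge0 cons_sigma_additive.

Let cons_sigma_finite : sigma_finite setT lebesgue_rV_cons.
Proof.
have /sigma_finiteP[A [TA ndA Aoo]] := sigma_finiteT (@lebesgue_measure R).
have /sigma_finiteP[B [TB ndB Boo]] := sigma_finiteT mu.
exists (fun i => @rV_uncons R n @^-1` (A i `*` B i)).
  rewrite -preimage_bigcup (_ : \bigcup_i _ = setT) ?preimage_setT//.
  apply/seteqP; split => // -[x y] _.
  have [i _ Ax] : (\bigcup_i A i) x by rewrite -TA.
  have [j _ By] : (\bigcup_i B i) y by rewrite -TB.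
  exists (maxn i j) => //; split.
    by move: x Ax; exact/subsetPset/ndA/leq_maxl.
  by move: y By; exact/subsetPset/ndB/leq_maxr.
move=> i; have [mA ltA] := Aoo i; have [mB ltB] := Boo i.
have mAB : measurable (A i `*` B i) by exact: measurableX.
split.
  by rewrite -[X in measurable X]setTI; exact: measurable_rV_uncons.
rewrite /lebesgue_rV_cons /pushforward -comp_preimage.
rewrite (_ : _ \o _ = id); last by apply/funext => z /=; rewrite rV_consK.
by rewrite preimage_id product_measure1E// lte_mul_pinfty// ge0_fin_numE.
Qed.

HB.instance Definition _ :=
  Measure_isSigmaFinite.Build _ _ _ lebesgue_rV_cons cons_sigma_finite.

End lebesgue_rV_cons.

(** Lebesgue measure on R^n as an n-fold product; see [lebesgue_rV_box]. *)
Fixpoint lebesgue_rV (R : realType) (n : nat) :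
    {sigma_finite_measure set 'rV[R]_n -> \bar R} :=
  if n is k.+1 then lebesgue_rV_cons (lebesgue_rV R k)
  else \d_(0 : 'rV[R]_0).

Lemma lebesgue_rV_box (R : realType) n (B : 'I_n -> set R) :
  (forall i, measurable (B i)) ->
  lebesgue_rV R n [set x | forall i, B i (x ord0 i)] =
  (\prod_(i < n) lebesgue_measure (B i))%E.
Proof.
elim: n B => [|n IH] B mB.
  rewrite big_ord0 /= diracE mem_set//=; by case.
rewrite big_ord_recl /= /lebesgue_rV_cons /pushforward.
rewrite -IH//.
have mbox : measurable [set x : 'rV[R]_n | forall i, B (lift ord0 i) (x ord0 i)].
  rewrite (_ : mkset _ =
      \bigcap_(i in [set: 'I_n]) (@rV_coord R n i @^-1` B (lift ord0 i))).
    apply: fin_bigcap_measurable => // i _; rewrite -[X in measurable X]setTI.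
    exact: measurable_rV_coord.
  by apply/seteqP; split => x /= Bx i; [move=> _; exact: Bx|exact: Bx].
transitivity ((@lebesgue_measure R \x lebesgue_rV R n)%E (B ord0 `*`
  [set x : 'rV[R]_n | forall i, B (lift ord0 i) (x ord0 i)])).
  congr (_ _); apply/seteqP; split => z /=.
    move=> Bz; split; first by have := Bz ord0; rewrite mxE unlift_none.
    by move=> i; have := Bz (lift ord0 i); rewrite mxE liftK.
  by case=> B0 BS j; rewrite mxE; case: unliftP => [i|] ->.
by rewrite product_measure1E//; exact: mB.
Qed.

(** Euclidean norm of a vector, Frobenius norm of a matrix. *)
Definition enorm (R : realType) m n (A : 'M[R]_(m, n)) : R :=
  Num.sqrt (\sum_i \sum_j A i j ^+ 2).

(** [pderiv a f] differentiates successively along the coordinates listed in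
    [a]; every partial derivative of order k is some [pderiv a f] with
    [size a = k]. *)
Fixpoint pderiv (R : realType) n (a : seq 'I_n) (f : 'rV[R]_n -> R) :
    'rV[R]_n -> R :=
  if a is i :: a' then fun y => 'D_(delta_mx ord0 i) (pderiv a' f) y else f.

(** Partial derivatives exist up to order k and are continuous ('D_v takes a
    junk value where it does not exist, hence the explicit [derivable]). *)
Definition Ck (R : realType) n (k : nat) (f : 'rV[R]_n -> R) : Prop :=
  forall a : seq 'I_n, (size a <= k)%N ->
    continuous (pderiv a f) /\
    ((size a < k)%N ->
      forall i y, derivable (pderiv a f) y (delta_mx ord0 i)).

Definition smooth (R : realType) n (f : 'rV[R]_n -> R) : Prop :=
  forall k, Ck k f.

Definition Cp_infty (R : realType) n (f : 'rV[R]_n -> R) : Prop :=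
  smooth f /\
  forall a : seq 'I_n, exists (C : R) (p : nat),
    forall y, `|pderiv a f y| <= C * (1 + enorm y ^+ p).

Definition gradient (R : realType) n (f : 'rV[R]_n -> R) (y : 'rV[R]_n) :
  'rV[R]_n := \row_i pderiv [:: i] f y.

Definition hessian (R : realType) n (f : 'rV[R]_n -> R) (y : 'rV[R]_n) :
  'M[R]_n := \matrix_(i, j) pderiv [:: i; j] f y.

(** Meant for symmetric matrices of positive size, whose spectrum is real,
    finite and nonempty, so that the infimum is the smallest eigenvalue. *)
Definition lambda_min (R : realType) n (A : 'M[R]_n) : R :=
  inf [set a | eigenvalue A a].

Definition potential_assumption (R : realType) m (F : 'rV[R]_m -> R)
    (C0 K : R) : Prop :=
  [/\ Ck 2 F,
      forall y, 0 < F y + C0,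
      (limf_esup (fun r : R =>
         ereal_sup [set ((enorm y `^ r) / (C0 + F y))%:E | y in [set: 'rV[R]_m]])
         (0:R)^'+ < +oo)%E,
      0 <= K &
      forall y, - K <= lambda_min (hessian F y)].

(** The exponents 2 l_i - eps may be negative.  In that case |y_i|^(2 l_i - eps)
    is +oo at y_i = 0 and the Hessian bound is void there, whereas the library
    sets 0 `^ r = 0 for r < 0; hence the guard in the Hessian bound. *)
Definition polynomial_bounds (R : realType) m (F : 'rV[R]_m -> R)
    (l : 'I_m -> nat) (C1 C2 C3 eps : R) : Prop :=
  (forall y : 'rV[R]_m,
    - C3 + C1 * (\sum_i `|y ord0 i| ^+ (2 * l i)%N) <= F y /\
    F y <= C2 * (\sum_i `|y ord0 i| ^+ (2 * l i)%N) + C3) /\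
  (forall y : 'rV[R]_m,
    (forall i, y ord0 i = 0 -> 0 <= (2 * l i)%N%:R - eps) ->
    enorm (hessian F y) <=
      C2 * (\sum_i `|y ord0 i| `^ ((2 * l i)%N%:R - eps)) + C3).

Definition derivative_growth (R : realType) m (F : 'rV[R]_m -> R)
    (l : 'I_m -> nat) : Prop :=
  forall a : seq 'I_m, (1 <= size a)%N -> exists C : R,
    forall y, `|pderiv a F y| <= C * (1 + enorm y ^+ (2 * \max_i l i)%N).

Section wiener.
Variables (R : realType) (disp : measure_display).
Variables (Omega : measurableType disp) (Pr : probability Omega R).

Definition filtration (Ft : R -> set (set Omega)) : Prop :=
  (forall t, 0 <= t -> sigma_algebra setT (Ft t) /\ Ft t `<=` measurable) /\
  (forall s t, 0 <= s -> s <= t -> Ft s `<=` Ft t).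

(** [normal_prob m s] has standard deviation [s].  The last clause is the
    mutual independence of [Ft s] and of the d coordinate increments. *)
Definition wiener_process d (Ft : R -> set (set Omega))
    (W : 'I_d -> R -> Omega -> R) : Prop :=
  [/\ forall k t, 0 <= t -> forall B : set R, measurable B ->
        Ft t (W k t @^-1` B),
      {ae Pr, forall w, forall k, W k 0 w = 0},
      {ae Pr, forall w, forall k, {within `[0, +oo[, continuous (W k ^~ w)}},
      forall k s t, 0 <= s -> s < t -> forall B : set R, measurable B ->
        Pr ((fun w => W k t w - W k s w) @^-1` B) =
        normal_prob 0 (Num.sqrt (t - s)) B &
      forall s t, 0 <= s -> s < t ->
        forall (A : set Omega) (B : 'I_d -> set R),
        Ft s A -> (forall k, measurable (B k)) ->
        Pr (A `&` [set w | forall k, B k (W k t w - W k s w)%R]) =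
        (Pr A * \prod_(k < d) Pr ((fun w => (W k t w - W k s w)%R) @^-1` B k))%E].

(** The deterministic step function equal to [sf_val i] on
    ]sf_knot i, sf_knot i.+1], i < sf_size. *)
Record step_fun := StepFun {
  sf_size : nat;
  sf_knot : nat -> R;
  sf_val : nat -> R }.

Definition sf_subdivision (a b : R) (phi : step_fun) : Prop :=
  [/\ sf_knot phi 0%N = a, sf_knot phi (sf_size phi) = b &
      forall i, (i < sf_size phi)%N -> sf_knot phi i <= sf_knot phi i.+1].

Definition sf_fun (phi : step_fun) (t : R) : R :=
  \sum_(i < sf_size phi)
    sf_val phi i * \1_(`]sf_knot phi i, sf_knot phi i.+1]) t.

Definition sf_wiener_integral (W : R -> Omega -> R) (phi : step_fun)
    (w : Omega) : R :=
  \sum_(i < sf_size phi)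
    sf_val phi i * (W (sf_knot phi i.+1) w - W (sf_knot phi i) w).

(** [I] is a version of the stochastic integral of the deterministic
    integrand [f] over [a, b]: the L^2(Pr)-limit of the integrals of step
    functions that converge to [f] in L^2([a, b]). *)
Definition is_wiener_integral (W : R -> Omega -> R) (a b : R) (f : R -> R)
    (I : Omega -> R) : Prop :=
  measurable_fun setT I /\
  exists phi : nat -> step_fun,
    [/\ forall n, sf_subdivision a b (phi n),
        (fun n => \int[lebesgue_measure]_(t in `[a, b])
                   ((f t - sf_fun (phi n) t) ^+ 2)%:E)%E @ \oo --> 0%E &
        (fun n => \int[Pr]_w
                   ((I w - sf_wiener_integral W (phi n) w) ^+ 2)%:E)%E
          @ \oo --> 0%E].

(** [(P n, Q n)], n <= N, is the sequence produced by the splitting AVF scheme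
    with stepsize [h] from [(p0, q0)]; [J n k] is the vector
    int_{t_n}^{t_{n+1}} e^{-v (t_{n+1} - t)} sigma_k dW^k_t, with t_n = n h. *)
Definition splitting_avf m d (F : 'rV[R]_m -> R) (v : R)
    (sigma : 'I_d -> 'rV[R]_m) (W : 'I_d -> R -> Omega -> R)
    (p0 q0 : 'rV[R]_m) (h : R) (N : nat) (P Q : nat -> Omega -> 'rV[R]_m) :
    Prop :=
  (forall n, (n <= N)%N ->
    measurable_fun setT (P n) /\ measurable_fun setT (Q n)) /\
  exists (Pbar Qbar : nat -> Omega -> 'rV[R]_m)
         (J : nat -> 'I_d -> Omega -> 'rV[R]_m),
    (forall n k i, (n < N)%N ->
      is_wiener_integral (W k) (n%:R * h) (n.+1%:R * h)
        (fun t => expR (- v * (n.+1%:R * h - t)) * sigma k ord0 i)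
        (fun w => J n k w ord0 i)) /\
    {ae Pr, forall w,
      [/\ P 0%N w = p0, Q 0%N w = q0 &
        forall n, (n < N)%N ->
        [/\ Pbar n.+1 w = P n w - h *: (\row_i
               \int[lebesgue_measure]_(tau in `[0, 1])
                 gradient F (Q n w + tau *: (Qbar n.+1 w - Q n w)) ord0 i),
            Qbar n.+1 w = Q n w + (h / 2) *: (Pbar n.+1 w + P n w),
            P n.+1 w = expR (- v * h) *: Pbar n.+1 w + \sum_(k < d) J n k w &
            Q n.+1 w = Qbar n.+1 w]]}.

Definition has_smooth_density n (X : Omega -> 'rV[R]_n) : Prop :=
  exists p : 'rV[R]_n -> R,
    [/\ smooth p, forall x, 0 <= p x &
      forall A : set 'rV[R]_n, measurable A ->
        pushforward Pr X A = (\int[lebesgue_rV R n]_(x in A) (p x)%:E)%E].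

End wiener.

(* Main.v *)
Require Import Defs.
From HB Require Import structures.
From mathcomp Require Import all_boot all_order all_algebra.
From mathcomp Require Import all_classical all_reals all_analysis.
From mathcomp Require Import ring lra measurable_realfun perm.

Set Implicit Arguments.
Unset Strict Implicit.
Unset Printing Implicit Defensive.

Import Order.TTheory GRing.Theory Num.Theory.
Import numFieldNormedType.Exports.

Local Open Scope classical_set_scope.
Local Open Scope ring_scope.

(** A step of the scheme from position [q] to position [y] is determined by the
    momentum [p] before it, through [stepG F h q y = p], and leaves the momentum
    [stepH F h q y], which is then damped and perturbed by the noise of the step.
    For [h < 2 / sqrt K] the map [stepG F h q] is strongly monotone, because
    the Hessian of [F] is bounded below by [- K]; hence it is a bijection of
    R^m with a positive Jacobian and a continuous inverse.

    The noise of a step is Gaussian and, since m of the vectors [sigma k] are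
    independent, nondegenerate. One step smooths the momentum only, but the
    position after the next step is a diffeomorphic image of this momentum.
    Take the last two steps, therefore: given the position [q] and the damped
    momentum [a] that are known when the noise of the last but one step arrives,
    substitute [p = stepG F h q y] in the Gaussian law of the momentum. This
    gives the density of the final position [y], and the noise of the last step
    then supplies that of the final momentum [x]. The product, [step_pdf], is an
    explicit function of [x] and [y], and the density of the solution is its
    expectation over [q], [a] and d-dimensional Gaussian vectors, of which only
    m coordinates are used for smoothing and the others are frozen
    ([ge0_integral_gauss_image], [transition_integral], [two_step_integral]).

    The density is smooth because one may differentiate under the expectation
    ([expect_smooth]): [step_pdf] is built from averages of derivatives of [F]
    along segments, a determinant and Gaussian exponentials, so its derivatives
    grow at most polynomially in [x], [y] and the random parameters
    ([cpf_step_pdf]), and these have moments of all orders, since solving a step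
    is a map of polynomial growth ([scheme_vmoments]).

    The change of variables [ge0_integral_secant] is proved by induction on the
    dimension for maps with coercive secant matrices, where the determinant is
    handled by Cramer's rule and the substitution is performed one coordinate at
    a time.

    The probabilistic input is [exponential_noise]: the noise of a step is
    independent of the past and distributed as a multiple of the combination of
    the vectors [sigma k] with independent standard Gaussian coefficients. It is
    the limit of the stochastic integrals of step functions with the same
    variance as the kernel, whose laws follow from the stability of Gaussian
    vectors, and the limit is controlled by an isometry ([wiener_isometry]),
    obtained by polarization from the variance of the increments of the Wiener
    process. *)

(** * The Borel structure and Lebesgue measure of R^n *)

Definition pushm d1 d2 (T1 : measurableType d1) (T2 : measurableType d2)
  (R : realType) (mu : {measure set T1 -> \bar R}) (f : T1 -> T2)
  (mf : measurable_fun setT f) : {measure set T2 -> \bar R} :=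
  measure_function_pushforward__canonical__measure_function_Measure mu mf.

Section rV.
Variables (R : realType).

Definition box n (B : 'I_n -> set R) : set 'rV[R]_n :=
  [set x | forall i, B i (x ord0 i)].

Definition cube n (k : nat) : set 'rV[R]_n :=
  box (fun=> `[- k%:R, k%:R]%classic).

Lemma ler_coord_norm n (x : 'rV[R]_n) i : `|x ord0 i| <= `|x|.
Proof.
rewrite [leRHS]/Num.norm /= mx_normrE.
by apply/bigmax_geP; right => /=; exists (ord0, i).
Qed.

Lemma norm_rV_le n (x : 'rV[R]_n) e :
  0 <= e -> (forall i, `|x ord0 i| <= e) -> `|x| <= e.
Proof.
move=> e0 xe; rewrite [leLHS]/Num.norm /= mx_normrE.
by apply/bigmax_leP; split => // -[i j] _ /=; rewrite ord1.
Qed.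

Lemma norm_rV_lt n (x : 'rV[R]_n) e :
  0 < e -> (forall i, `|x ord0 i| < e) -> `|x| < e.
Proof.
move=> e0 xe; rewrite [ltLHS]/Num.norm /= mx_normrE.
by apply/bigmax_ltP; split => // -[i j] _ /=; rewrite ord1.
Qed.

Lemma continuous_rV_coord n (i : 'I_n) : continuous (@rV_coord R n i).
Proof. by move=> x; exact: coord_continuous. Qed.

Lemma measurable_coord d (T : measurableType d) n (f : T -> 'rV[R]_n) i :
  measurable_fun setT f -> measurable_fun setT (fun t => f t ord0 i).
Proof. by move=> mf; apply: (measurableT_comp (measurable_rV_coord i)). Qed.

Lemma measurable_box n (B : 'I_n -> set R) :
  (forall i, measurable (B i)) -> measurable (box B).
Proof.
move=> mB; rewrite (_ : box B =
    \bigcap_(i in [set: 'I_n]) (@rV_coord R n i @^-1` B i)).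
  apply: fin_bigcap_measurable => // i _; rewrite -[X in measurable X]setTI.
  by apply: measurable_rV_coord => //; exact: mB.
by apply/seteqP; split => x /= Bx i; [move=> _; exact: Bx|exact: Bx].
Qed.

Lemma measurable_rVE n (G : set (set R)) (b : nat -> set R) :
  (forall k, G (b k)) -> (forall j k, (j <= k)%N -> b j `<=` b k) ->
  \bigcup_k b k = setT ->
  (measurable : set (set (measurableTypeR R))) `<=` <<s G >> ->
  (measurable : set (set 'rV[R]_n)) `<=`
    <<s [set box B | B in [set B : 'I_n -> set R | forall i, G (B i)]] >>.
Proof.
move=> Gb ndb ub mG.
set H := [set box B | B in _].
apply: smallest_sub; first exact: smallest_sigma_algebra.
rewrite -bigcup_seq /= => A [i _ [B mB <-]]; rewrite setTI.
suff : <<s G >> `<=` [set B | <<s H >> (@rV_coord R n i @^-1` B)].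
  by apply; exact: mG.
apply: smallest_sub.
  have [S0 SC SU] := smallest_sigma_algebra setT H.
  split => /=.
  - by rewrite preimage_set0.
  - by move=> C; rewrite setTD preimage_setC => HC; rewrite -setTD; exact: SC.
  - by move=> C HC; rewrite preimage_bigcup; exact: SU.
move=> C GC /=.
pose D k (j : 'I_n) := if j == i then C else b k.
have -> : @rV_coord R n i @^-1` C = \bigcup_k box (D k).
  apply/seteqP; split => x /=; last first.
    by move=> [k _] /(_ i); rewrite /D eqxx.
  move=> Cx.
  have : forall j, exists k, b k (x ord0 j).
    by move=> j; have : setT (x ord0 j) by []; rewrite -ub => -[k _ ?]; exists k.
  move=> /choice[k bk]; exists (\max_j k j)%N => // j; rewrite /D.
  case: eqVneq => [->//|_]; apply: ndb (bk j); exact: leq_bigmax.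
have [_ _ SU] := smallest_sigma_algebra setT H.
apply: SU => k; apply: sub_sigma_algebra; exists (D k) => // j; rewrite /D.
by case: ifP.
Qed.

Lemma box_setI_closed n (G : set (set R)) : setI_closed G ->
  setI_closed [set box B | B in [set B : 'I_n -> set R | forall i, G (B i)]].
Proof.
move=> GI _ _ [B GB <-] [C GC <-]; exists (fun i => B i `&` C i).
  by move=> i; exact: GI.
apply/seteqP; split => x /=.
  by move=> BC; split => i; have [] := BC i.
by move=> [Bx Cx] i; split.
Qed.

(** Boxes with sides in a pi-system [G] that generates the Borel sets of the
    line form a pi-system that generates the sigma-algebra of R^n; the sets
    [b k] exhaust the line, which localizes the finiteness requirement. *)
Lemma rV_measure_unique n (G : set (set R)) (b : nat -> set R)
    (m1 m2 : {measure set 'rV[R]_n -> \bar R}) :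
  (forall k, G (b k)) -> (forall j k, (j <= k)%N -> b j `<=` b k) ->
  \bigcup_k b k = setT -> setI_closed G ->
  G `<=` (measurable : set (set (measurableTypeR R))) ->
  (measurable : set (set (measurableTypeR R))) `<=` <<s G >> ->
  (forall k, m1 (box (fun=> b k)) < +oo)%E ->
  (forall B, (forall i, G (B i)) -> m1 (box B) = m2 (box B)) ->
  forall A, measurable A -> m1 A = m2 A.
Proof.
move=> Gb ndb ub GI Gm mG m1oo m12 A mA.
have := @g_sigma_algebra_measure_unique _ _ _
  [set box B | B in [set B : 'I_n -> set R | forall i, G (B i)]] _
  (fun k => box (fun=> b k)) _ _ m1 m2; apply => //.
- by move=> _ [B GB <-]; apply: measurable_box => i; exact: (Gm _ (GB i)).
- by move=> k; exists (fun=> b k).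
- apply/seteqP; split => // x _.
  have : forall j, exists k, b k (x ord0 j).
    by move=> j; have : setT (x ord0 j) by []; rewrite -ub => -[k _ ?]; exists k.
  move=> /choice[k bk]; exists (\max_j k j)%N => // j.
  by apply: ndb (bk j); exact: leq_bigmax.
- exact: box_setI_closed.
- by move=> _ [B GB <-]; exact: m12.
- exact: (measurable_rVE Gb ndb ub mG).
Qed.

Lemma itvNn_nd (j k : nat) : (j <= k)%N ->
  `[- j%:R, j%:R] `<=` `[- k%:R, k%:R : R]%classic.
Proof.
move=> jk x /=; rewrite !in_itv/= => /andP[xj jx].
have kj : j%:R <= k%:R :> R by rewrite ler_nat.
by rewrite (le_trans _ xj) ?lerN2// (le_trans jx).
Qed.

Lemma itvNn_cover : \bigcup_k `[- k%:R, k%:R : R]%classic = setT.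
Proof.
apply/seteqP; split => // x _; exists (Num.truncn `|x|).+1 => //=.
rewrite in_itv/= -ler_norml ltW//; exact: truncnS_gt.
Qed.

Lemma rV_measure_unique_box n (m1 m2 : {measure set 'rV[R]_n -> \bar R}) :
  (forall k : nat, m1 (@cube n k) < +oo)%E ->
  (forall B, (forall i, measurable (B i)) -> m1 (box B) = m2 (box B)) ->
  forall A, measurable A -> m1 A = m2 A.
Proof.
move=> m1oo m12.
apply: (@rV_measure_unique n measurable (fun k => `[- k%:R, k%:R]%classic)) => //.
- exact: itvNn_nd.
- exact: itvNn_cover.
- by move=> A B; exact: measurableI.
Qed.

(** Open orthants serve as test sets because their indicators are limits of
    products of continuous ramps, see [rV_measure_unique_continuous]. *)
Lemma rV_measure_unique_ray n (m1 m2 : {measure set 'rV[R]_n -> \bar R}) :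
  (m1 setT < +oo)%E ->
  (forall c : 'I_n -> R, m1 (box (fun i => `]c i, +oo[%classic)) =
                         m2 (box (fun i => `]c i, +oo[%classic))) ->
  forall A, measurable A -> m1 A = m2 A.
Proof.
move=> m1oo m12.
apply: (@rV_measure_unique n [set A | exists x : R, A = `]x, +oo[%classic]
   (fun k => `]- k%:R, +oo[%classic)) => //.
- by move=> k; exists (- k%:R).
- move=> j k jk x /=; rewrite !in_itv/= !andbT; apply: le_lt_trans.
  by rewrite lerN2 ler_nat.
- apply/seteqP; split => // x _; exists (Num.truncn `|x|).+1 => //=.
  rewrite in_itv/= andbT ltrNl (le_lt_trans (ler_norm _))// normrN.
  exact: truncnS_gt.
- move=> _ _ [x ->] [y ->]; exists (Num.max x y).
  apply/seteqP; split => z /=; rewrite !in_itv/= !andbT gt_max.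
    by move=> [-> ->].
  by move=> /andP[].
- by move=> _ [x ->]; exact: measurable_itv.
- by move=> A; rewrite measurable_realfun.RGenOInfty.measurableE.
- move=> k; rewrite (le_lt_trans _ m1oo)// le_measure ?inE//.
  by apply: measurable_box => i; exact: measurable_itv.
- move=> B /choice[c Bc]; rewrite (_ : B = (fun i => `]c i, +oo[%classic))//.
  exact/funext.
Qed.

(** An open set of R^n is a countable union of rational boxes. *)
Lemma open_measurable_rV n (U : set 'rV[R]_n) : open U -> measurable U.
Proof.
move=> oU.
pose C (p : 'rV[rat]_n * nat) : set 'rV[R]_n :=
  box (fun i => `]ratr (p.1 ord0 i) - p.2.+1%:R^-1,
                  ratr (p.1 ord0 i) + p.2.+1%:R^-1[%classic).
have -> : U = \bigcup_(p in [set p | C p `<=` U]) C p.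
  apply/seteqP; split => x; last by move=> [p pU] /pU.
  move=> Ux.
  have /nbhs_ballP[e /= e0 xeU] : nbhs x U by exact: open_nbhs_nbhs.
  have [k ke] : exists k : nat, k.+1%:R^-1 + k.+1%:R^-1 <= e.
    exists (Num.truncn (2 / e)).
    have := truncnS_gt (2 / e); set k := (Num.truncn _).+1 => ek.
    have k0 : 0 < k%:R :> R by rewrite ltr0n.
    by rewrite -mulr2n -[leLHS]mulr_natl ler_pdivrMr// mulrC -ler_pdivrMr// ltW.
  have k0 : 0 < k.+1%:R^-1 :> R by rewrite invr_gt0.
  have : forall i, exists q : rat, ratr q \in `](x ord0 i - k.+1%:R^-1),
      (x ord0 i + k.+1%:R^-1)[.
    by move=> i; apply: rat_in_itvoo; rewrite ltrD2l gtrN.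
  move=> /choice[q xq].
  exists (\row_i q i, k) => /=.
    move=> y Cy; apply: xeU; rewrite -ball_normE /=.
    rewrite (lt_le_trans _ ke)//; apply: norm_rV_lt; first exact: addr_gt0.
    move=> i; have := Cy i; have := xq i; rewrite /= !in_itv/= !mxE.
    rewrite ltr_norml; move: (k.+1%:R^-1) => r.
    by move=> /andP[? ?] /andP[? ?]; apply/andP; split; lra.
  move=> i; have := xq i; rewrite /= !in_itv/= !mxE.
  move: (k.+1%:R^-1) => r /andP[? ?]; apply/andP; split; lra.
rewrite bigcup_mkcond; apply: countable_bigcupT_measurable => // p.
by case: ifP => // _; apply: measurable_box => i; exact: measurable_itv.
Qed.

Lemma continuous_measurable_rV n (f : 'rV[R]_n -> R) :
  continuous f -> measurable_fun setT f.
Proof.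
move=> /continuousP cf; apply: (measurability _ (measurable_realfun.RGenOpens.measurableE R)).
move=> _ [_ [a [b ->] <-]]; rewrite setTI; apply: open_measurable_rV.
exact/cf/interval_open.
Qed.

Lemma continuous_measurable_rV2 m n (f : 'rV[R]_m -> 'rV[R]_n) :
  continuous f -> measurable_fun setT f.
Proof.
move=> cf; apply: measurable_fun_rV => i; apply: continuous_measurable_rV => x.
by apply: continuous_comp; [exact: cf|exact: continuous_rV_coord].
Qed.

Lemma measurable_row_mx m n d (T : measurableType d) (f : T -> 'rV[R]_m)
    (g : T -> 'rV[R]_n) : measurable_fun setT f -> measurable_fun setT g ->
  measurable_fun setT (fun t => row_mx (f t) (g t)).
Proof.
move=> mf mg; apply: measurable_fun_rV => k.
have [i ->|i ->] := split_ordP k.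
  rewrite (_ : _ \o _ = fun t => f t ord0 i); first exact: measurable_coord.
  by apply/funext => t /=; rewrite /rV_coord row_mxEl.
rewrite (_ : _ \o _ = fun t => g t ord0 i); first exact: measurable_coord.
by apply/funext => t /=; rewrite /rV_coord row_mxEr.
Qed.

Lemma measurable_addrV n d (T : measurableType d) (f g : T -> 'rV[R]_n) :
  measurable_fun setT f -> measurable_fun setT g ->
  measurable_fun setT (fun t => f t + g t).
Proof.
move=> mf mg; apply: measurable_fun_rV => i.
rewrite (_ : _ \o _ = fun t => f t ord0 i + g t ord0 i).
  by apply: measurable_funD; exact: measurable_coord.
by apply/funext => t /=; rewrite /rV_coord !mxE.
Qed.

Lemma measurable_mulmxrV m n d (T : measurableType d) (f : T -> 'rV[R]_m)
    (B : 'M[R]_(m, n)) :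
  measurable_fun setT f -> measurable_fun setT (fun t => f t *m B).
Proof.
move=> mf; apply: measurable_fun_rV => i.
rewrite (_ : _ \o _ = fun t => \sum_j f t ord0 j * B j i).
  apply: measurable_sum => j; apply: measurable_funM => //.
  exact: measurable_coord.
by apply/funext => t /=; rewrite /rV_coord !mxE.
Qed.

Lemma measurable_scalerV n d (T : measurableType d) (c : T -> R)
    (f : T -> 'rV[R]_n) :
  measurable_fun setT c -> measurable_fun setT f ->
  measurable_fun setT (fun t => c t *: f t).
Proof.
move=> mc mf; apply: measurable_fun_rV => i.
rewrite (_ : _ \o _ = fun t => c t * f t ord0 i).
  by apply: measurable_funM => //; exact: measurable_coord.
by apply/funext => t /=; rewrite /rV_coord !mxE.
Qed.

Lemma measurable_opprV n d (T : measurableType d) (f : T -> 'rV[R]_n) :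
  measurable_fun setT f -> measurable_fun setT (fun t => - f t).
Proof.
move=> mf; rewrite (_ : (fun _ => _) = fun t => (-1) *: f t).
  exact: measurable_scalerV.
by apply/funext => t; rewrite scaleN1r.
Qed.

End rV.

Section lebesgue.
Variable R : realType.
Local Open Scope ereal_scope.

Lemma ge0_integral_preserving d (T : measurableType d)
    (mu : {measure set T -> \bar R}) (f : T -> T) (g : T -> \bar R) :
  measurable_fun setT f ->
  (forall A, measurable A -> mu (f @^-1` A) = mu A) ->
  measurable_fun setT g -> (forall x, 0 <= g x) ->
  \int[mu]_x g (f x) = \int[mu]_x g x.
Proof.
move=> mf muf mg g0.
have := @ge0_integral_pushforward _ _ _ _ R f mf mu setT g measurableT mg
  (fun y _ => g0 y).
rewrite preimage_setT => <-.
by apply: (@eq_measure_integral _ _ _ _ mu (pushm mu mf)) => A mA _; exact: muf.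
Qed.

Lemma lebesgue_measureD (a : R) (A : set R) : measurable A ->
  lebesgue_measure ((fun x => x + a)%R @^-1` A) = lebesgue_measure A.
Proof.
move=> mA.
have md : measurable_fun [set: measurableTypeR R]
  (fun x => x + a : measurableTypeR R)%R by exact: measurable_funD.
apply/esym/(@lebesgue_measure_unique R (pushm lebesgue_measure md)) => //.
move=> _ [[b c]] _ <-; rewrite /pushm /= /pushforward.
rewrite (_ : _ @^-1` _ = `]b - a, c - a]%classic)%R.
  by rewrite !lebesgue_measure_itv/= !lte_fin ltrD2r -!EFinD opprB addrA subrK.
by apply/seteqP; split => x /=; rewrite !in_itv/= ltrBlDr lerBrDr.
Qed.

Lemma ge0_integral_lebesgueD (a : R) (g : R -> \bar R) :
  measurable_fun setT g -> (forall x, 0 <= g x) ->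
  \int[lebesgue_measure]_x g (x + a)%R = \int[lebesgue_measure]_x g x.
Proof.
move=> mg g0.
apply: (@ge0_integral_preserving _ _ (@lebesgue_measure R) (fun x => x + a)%R g)
  => //; first exact: measurable_funD.
exact: lebesgue_measureD.
Qed.

Lemma ge0_integral_lebesgue_cons n (g : 'rV[R]_n.+1 -> \bar R) :
  measurable_fun setT g -> (forall x, 0 <= g x) ->
  \int[lebesgue_rV R n.+1]_x g x =
  \int[lebesgue_measure]_x \int[lebesgue_rV R n]_z g (rV_cons (x, z)).
Proof.
move=> mg g0.
have := @ge0_integral_pushforward _ _ _ _ R (@rV_cons R n)
  (@measurable_rV_cons R n) (lebesgue_measure \x lebesgue_rV R n)
  setT g measurableT mg (fun y _ => g0 y).
rewrite preimage_setT => ->; rewrite fubini_tonelli1//=.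
by apply: measurableT_comp => //; exact: measurable_rV_cons.
Qed.

Lemma ge0_integral_lebesgue_rV0 (g : 'rV[R]_0 -> \bar R) :
  measurable_fun setT g -> \int[lebesgue_rV R 0]_x g x = g 0%R.
Proof. by move=> mg; rewrite /= integral_dirac// diracT mul1e. Qed.

Lemma rV_consD n (x y : R) (u v : 'rV[R]_n) :
  (rV_cons (x, u) + rV_cons (y, v) = rV_cons (x + y, u + v))%R.
Proof.
by apply/rowP => j; rewrite !mxE; case: unliftP => [i|] _ //=; rewrite mxE.
Qed.

Lemma rV_uncons_consK n (v : 'rV[R]_n.+1) :
  rV_cons (v ord0 ord0, \row_j v ord0 (lift ord0 j))%R = v.
Proof.
by apply/rowP => j; rewrite !mxE; case: unliftP => [i|] -> //=; rewrite mxE.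
Qed.

Lemma measurable_consr n (x : R) :
  measurable_fun setT (fun z : 'rV[R]_n => rV_cons (x, z)).
Proof. by apply: measurableT_comp; [exact: measurable_rV_cons|]. Qed.

Lemma measurable_consl n (z : 'rV[R]_n) :
  measurable_fun setT (fun x : measurableTypeR R => rV_cons (x, z)).
Proof. by apply: measurableT_comp; [exact: measurable_rV_cons|]. Qed.

(** Fubini reduces translation invariance to the line. *)
Lemma ge0_integral_lebesgue_rVD n (v : 'rV[R]_n) (g : 'rV[R]_n -> \bar R) :
  measurable_fun setT g -> (forall x, 0 <= g x) ->
  \int[lebesgue_rV R n]_x g (x + v)%R = \int[lebesgue_rV R n]_x g x.
Proof.
elim: n v g => [|n IH] v g mg g0.
  by apply: eq_integral => x _; congr g; apply/rowP => -[].
have mDv : measurable_fun setT (fun x : 'rV[R]_n.+1 => g (x + v)%R).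
  by apply: measurableT_comp => //; exact: measurable_addrV.
rewrite !ge0_integral_lebesgue_cons//.
rewrite -(rV_uncons_consK v); set v0 := v _ _; set v' := (\row_j _)%R.
transitivity (\int[lebesgue_measure]_x
    (fun x : R => \int[lebesgue_rV R n]_z g (rV_cons (x, z))) (x + v0)%R).
  apply: eq_integral => x _; rewrite -[RHS](IH v')//.
    by apply: eq_integral => z _; rewrite rV_consD.
  by apply: measurableT_comp => //; exact: measurable_consr.
apply: (@ge0_integral_lebesgueD v0
  (fun x : R => \int[lebesgue_rV R n]_z g (rV_cons (x, z)))); last first.
  by move=> x; exact: integral_ge0.
apply: (@measurable_fun_fubini_tonelli_F _ _ _ _ _ (lebesgue_rV R n)
  (fun z => g (rV_cons z))) => //.
by apply: measurableT_comp => //; exact: measurable_rV_cons.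
Qed.

Lemma row_mx_cons m n (x : R) (u : 'rV[R]_m) (v : 'rV[R]_n) :
  row_mx (rV_cons (x, u)) v = rV_cons (x, row_mx u v) :> 'rV[R]_(m + n).+1.
Proof.
apply/rowP => j; rewrite [RHS]mxE; case: unliftP => [k|] ->{j} /=.
  have [i ->|i ->] := split_ordP k.
    rewrite row_mxEl (_ : lift _ _ = lshift n (lift ord0 i)); last exact/val_inj.
    apply: etrans (@row_mxEl R 1 m.+1 n (rV_cons (x, u)) v ord0 (lift ord0 i)) _.
    by rewrite mxE liftK.
  rewrite row_mxEr (_ : lift _ _ = rshift m.+1 i); last exact/val_inj.
  exact: (@row_mxEr R 1 m.+1 n (rV_cons (x, u)) v ord0 i).
rewrite (_ : ord0 = lshift n (ord0 : 'I_m.+1)); last exact/val_inj.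
apply: etrans (@row_mxEl R 1 m.+1 n (rV_cons (x, u)) v ord0 ord0) _.
by rewrite mxE unlift_none.
Qed.

Lemma ge0_integral_lebesgue_row_mx m n (g : 'rV[R]_(m + n) -> \bar R) :
  measurable_fun setT g -> (forall x, 0 <= g x) ->
  \int[lebesgue_rV R (m + n)]_x g x =
  \int[lebesgue_rV R m]_x \int[lebesgue_rV R n]_y g (row_mx x y).
Proof.
elim: m g => [|m IH] g mg g0.
  rewrite ge0_integral_lebesgue_rV0.
    by apply: eq_integral => x _; congr g; apply/esym/row_thin_mx.
  apply: (@measurable_fun_fubini_tonelli_F _ _ _ _ _ (lebesgue_rV R n)
    (fun z => g (row_mx z.1 z.2))) => //.
  by apply: measurableT_comp => //; exact: measurable_row_mx.
rewrite (ge0_integral_lebesgue_cons (n := m + n) mg g0).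
rewrite (@ge0_integral_lebesgue_cons m
  (fun x => \int[lebesgue_rV R n]_y g (row_mx x y))); first last.
- by move=> x; exact: integral_ge0.
- apply: (@measurable_fun_fubini_tonelli_F _ _ _ _ _ (lebesgue_rV R n)
    (fun z => g (row_mx z.1 z.2))) => //.
  by apply: measurableT_comp => //; exact: measurable_row_mx.
apply: eq_integral => x _.
rewrite (IH (fun z => g (rV_cons (x, z))))//; last first.
  by apply: measurableT_comp => //; exact: measurable_consr.
apply: eq_integral => u _; apply: eq_integral => y _.
by rewrite row_mx_cons.
Qed.

Lemma lebesgue_cube_lty n k : lebesgue_rV R n (@cube R n k) < +oo.
Proof.
rewrite (lebesgue_rV_box (B := fun=> `[(- k%:R)%R, k%:R]%classic))//.
have -> : \prod_(i < n) lebesgue_measure `[(- k%:R)%R, k%:R : R]%classic =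
    \prod_(i < n) (k%:R + k%:R)%:E.
  apply: eq_bigr => i _; rewrite lebesgue_measure_itv/= lte_fin.
  case: k => [|k]; first by rewrite oppr0 ltxx addr0.
  by rewrite gtrN ?ltr0n// -EFinD opprK.
by rewrite prodEFin ltry.
Qed.

Lemma lebesgue_unit_box n :
  lebesgue_rV R n (box (fun=> `[0%R, 1%R]%classic)) = 1.
Proof.
rewrite (lebesgue_rV_box (B := fun=> `[0%R, 1%R]%classic))//.
rewrite big1// => i _; by rewrite lebesgue_measure_itv/= lte01 oppr0 adde0.
Qed.

Lemma cube_bounded n (A : set 'rV[R]_n) (M : R) :
  (forall x, A x -> `|x| <= M)%R -> exists k, A `<=` @cube R n k.
Proof.
move=> AM; exists (Num.truncn M).+1 => x Ax i /=.
rewrite in_itv/= -ler_norml (le_trans (ler_coord_norm x i))//.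
by rewrite (le_trans (AM _ Ax))// ltW// truncnS_gt.
Qed.

Lemma norm_mulmx_le m n (B : 'M[R]_(m, n)) :
  exists2 M, (0 <= M)%R & forall x : 'rV[R]_m, (`|x *m B| <= M * `|x|)%R.
Proof.
exists (\sum_i \sum_j `|B i j|)%R.
  by apply: sumr_ge0 => i _; exact: sumr_ge0.
move=> x; apply: norm_rV_le.
  by rewrite mulr_ge0// sumr_ge0// => i _; exact: sumr_ge0.
move=> j; rewrite mxE (le_trans (ler_norm_sum _ _ _))// mulr_suml.
apply: ler_sum => i _; rewrite normrM mulrC ler_pM ?ler_coord_norm//.
by rewrite (bigD1 j)//= lerDl sumr_ge0.
Qed.

(** A translation invariant functional is a multiple of Lebesgue measure: with
    [C] of measure 1, evaluate the double integral of [g (x B) 1_C y] after the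
    substitutions [y -> y - x B] and [x -> x + y B^-1]. *)
Lemma ge0_integral_lebesgue_mulmx n (B : 'M[R]_n) : B \in unitmx ->
  exists2 c, (0 < c)%R & forall g : 'rV[R]_n -> \bar R,
    measurable_fun setT g -> (forall x, 0 <= g x) ->
    \int[lebesgue_rV R n]_x g (x *m B) = c%:E * \int[lebesgue_rV R n]_x g x.
Proof.
move=> uB; set C : set 'rV[R]_n := box (fun=> `[0%R, 1%R]%classic).
have mC : measurable C by apply: measurable_box => i; exact: measurable_itv.
pose D : set 'rV[R]_n := [set x | C (- (x *m B))%R].
have mNB : measurable_fun setT (fun x : 'rV[R]_n => - (x *m B))%R.
  by apply: measurable_opprV; exact: measurable_mulmxrV.
have mD : measurable D by rewrite -[D]setTI; exact: mNB.
pose f (x : 'rV[R]_n) : \bar R := (\1_C x)%:E.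
have mf : measurable_fun setT f by exact/measurable_EFinP/measurable_indic.
have f0 x : 0 <= f x by rewrite lee_fin.
have Df x : (\1_D x)%:E = f (- (x *m B))%R.
  by rewrite /f !indicE; congr (_ %:R%:E); apply/idP/idP; rewrite !inE.
have Dlty : lebesgue_rV R n D < +oo.
  have [M M0 BM] := norm_mulmx_le (invmx B).
  have [k Dk] : exists k, D `<=` @cube R n k.
    apply: (@cube_bounded _ _ M) => x Dx.
    rewrite -(mulmxK uB x) (le_trans (BM _))// ler_piMr//.
    apply: norm_rV_le => // i; have := Dx i.
    rewrite mxE /= in_itv/= => /andP[x0 x1].
    by rewrite -normrN ger0_norm.
  by rewrite (le_lt_trans _ (lebesgue_cube_lty n k))// le_measure ?inE//;
    apply: measurable_box => i; exact: measurable_itv.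
pose c := fine (lebesgue_rV R n D).
have cE : lebesgue_rV R n D = c%:E by rewrite fineK// ge0_fin_numE.
have key g : measurable_fun setT g -> (forall x, 0 <= g x) ->
    \int[lebesgue_rV R n]_x g (x *m B) = c%:E * \int[lebesgue_rV R n]_x g x.
  move=> mg g0.
  have int_f : \int[lebesgue_rV R n]_x f x = 1.
    by rewrite integral_indic// setIT; exact: lebesgue_unit_box.
  have int_fD : \int[lebesgue_rV R n]_x f (- (x *m B))%R = c%:E.
    rewrite -cE -[RHS](_ : \int[lebesgue_rV R n]_x (\1_D x)%:E = _).
      by apply: eq_integral => x _; rewrite Df.
    by rewrite integral_indic// setIT.
  transitivity (\int[lebesgue_rV R n]_x \int[lebesgue_rV R n]_y
      (g (x *m B) * f (y - x *m B)%R)).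
    apply: eq_integral => x _; rewrite ge0_integralZl//; last first.
      by apply: measurableT_comp => //; exact: measurable_addrV.
    by rewrite (ge0_integral_lebesgue_rVD (- (x *m B))%R mf f0) int_f mule1.
  have m2 : measurable_fun setT (fun z : 'rV[R]_n * 'rV[R]_n =>
      g (z.1 *m B) * f (z.2 - z.1 *m B)%R).
    apply: emeasurable_funM; apply: measurableT_comp => //.
      exact: measurable_mulmxrV.
    apply: measurable_addrV => //; apply: measurable_opprV.
    exact: measurable_mulmxrV.
  rewrite (fubini_tonelli
    (fun z : 'rV[R]_n * 'rV[R]_n => g (z.1 *m B) * f (z.2 - z.1 *m B)%R))//=;
    last by move=> z; exact: mule_ge0.
  transitivity (\int[lebesgue_rV R n]_y \int[lebesgue_rV R n]_x
      (g (x *m B + y)%R * f (- (x *m B))%R)).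
    apply: eq_integral => y _.
    rewrite -[LHS](@ge0_integral_lebesgue_rVD n (y *m invmx B)
      (fun x => g (x *m B) * f (y - x *m B)%R)); first last.
    - by move=> x; exact: mule_ge0.
    - exact: (measurableT_comp m2 (measurable_pair2 y)).
    apply: eq_integral => x _; rewrite mulmxDl mulmxKV//.
    by rewrite opprD addrCA subrr addr0.
  have m3 : measurable_fun setT (fun z : 'rV[R]_n * 'rV[R]_n =>
      g (z.1 *m B + z.2)%R * f (- (z.1 *m B))%R).
    apply: emeasurable_funM; apply: measurableT_comp => //.
      by apply: measurable_addrV => //; exact: measurable_mulmxrV.
    by apply: measurable_opprV; exact: measurable_mulmxrV.
  rewrite -(fubini_tonelli (fun z => g (z.1 *m B + z.2)%R * f (- (z.1 *m B))%R))//=;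
    last by move=> z; exact: mule_ge0.
  transitivity (\int[lebesgue_rV R n]_x
      (f (- (x *m B))%R * \int[lebesgue_rV R n]_y g y)).
    apply: eq_integral => x _; rewrite ge0_integralZr//; last first.
      by apply: measurableT_comp => //; exact: measurable_addrV.
    rewrite muleC; congr (_ * _).
    rewrite -(ge0_integral_lebesgue_rVD (x *m B) mg g0).
    by apply: eq_integral => y _; rewrite addrC.
  rewrite ge0_integralZr ?int_fD//.
  - exact: (measurableT_comp mf).
  - exact: integral_ge0.
exists c => //; rewrite lt_neqAle fine_ge0// andbT; apply/eqP => c0.
have := key (cst 1); rewrite -c0 mul0e !integral_cst//= !mul1e => /(_ _ _).
have : 1 <= lebesgue_rV R n setT.
  by rewrite -(lebesgue_unit_box n) le_measure ?inE.
by move=> + T0; rewrite T0//; rewrite leNgt lte01.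
Qed.

End lebesgue.

(** * Measures with a density and substitution on the line *)

Section mdensity.
Local Open Scope ereal_scope.
Context d (T : measurableType d) (R : realType).
Variable mu : {measure set T -> \bar R}.
Variables (h : T -> \bar R) (mh : measurable_fun setT h).
Hypothesis h0 : forall x, 0 <= h x.

Definition mdensity (A : set T) : \bar R := \int[mu]_(x in A) h x.

Let mdensity0 : mdensity set0 = 0.
Proof. by rewrite /mdensity integral_set0. Qed.

Let mdensity_ge0 A : 0 <= mdensity A.
Proof. by apply: integral_ge0 => x _; exact: h0. Qed.

Let mdensity_sigma_additive : semi_sigma_additive mdensity.
Proof.
move=> F mF tF mUF; rewrite /mdensity; apply: cvg_toP.
  apply: ereal_nondecreasing_is_cvgn => m n mn.
  by apply: lee_sum_nneg_natr => // k _ _; exact: integral_ge0.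
by rewrite ge0_integral_bigcup//=; exact: measurable_funTS.
Qed.

Definition density_measure : {measure set T -> \bar R} :=
  HB.pack mdensity (isMeasure.Build _ _ _ mdensity
    mdensity0 mdensity_ge0 mdensity_sigma_additive).

Import HBNNSimple.

Let integral_density_nnsfun (f : {nnsfun T >-> R}) :
  \int[density_measure]_x (f x)%:E = \int[mu]_x ((f x)%:E * h x).
Proof.
transitivity (\sum_(k \in range f) \int[density_measure]_x
    (k * \1_(f @^-1` [set k]) x)%:E).
  under eq_integral do rewrite fimfunE -fsumEFin//.
  rewrite ge0_integral_fsum//.
  - by move=> y; exact/measurable_EFinP/measurable_funM.
  - by move=> y x _; rewrite nnfun_muleindic_ge0.
transitivity (\sum_(k \in range f) \int[mu]_x
    ((k * \1_(f @^-1` [set k]) x)%:E * h x)).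
  apply: eq_fsbigr => r /[!inE] -[t _ <-].
  have mft : measurable (f @^-1` [set f t]) by exact: measurable_funPTI.
  under eq_integral do rewrite EFinM.
  under [RHS]eq_integral do rewrite EFinM -muleA.
  have ft0 : 0 <= (f t)%:E by rewrite lee_fin.
  have m1 : measurable_fun setT (fun x => (\1_(f @^-1` [set f t]) x : R)%:E).
    exact/measurable_EFinP.
  have i0 x : 0 <= (\1_(f @^-1` [set f t]) x : R)%:E by rewrite lee_fin.
  have m2 : measurable_fun setT
      (fun x => (\1_(f @^-1` [set f t]) x : R)%:E * h x).
    exact: emeasurable_funM.
  have i2 x : 0 <= (\1_(f @^-1` [set f t]) x : R)%:E * h x by rewrite mule_ge0.
  rewrite ge0_integralZl// [in RHS]ge0_integralZl//.
  congr (_ * _); rewrite integral_indic//= setIT /mdensity.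
  rewrite integral_mkcond; apply: eq_integral => x _.
  by rewrite patchE indicE; case: ifP => _; rewrite ?mul1e ?mul0e.
rewrite -ge0_integral_fsum//.
- apply: eq_integral => x _; rewrite [in RHS]fimfunE -fsumEFin//.
  rewrite ge0_mule_fsuml// => r.
  by rewrite EFinM nnfun_muleindic_ge0.
- move=> y; apply: emeasurable_funM => //.
  by apply/measurable_EFinP/measurable_funM.
- by move=> r x _; rewrite mule_ge0// EFinM nnfun_muleindic_ge0.
Qed.

Lemma ge0_integral_density (f : T -> \bar R) : measurable_fun setT f ->
  (forall x, 0 <= f x) -> (forall x, h x \is a fin_num) ->
  \int[density_measure]_x f x = \int[mu]_x (f x * h x).
Proof.
move=> mf f0 hfin; pose f_ := nnsfun_approx measurableT mf.
transitivity (lim (\int[density_measure]_x (f_ n x)%:E @[n --> \oo])).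
  rewrite -monotone_convergence//.
  - apply: eq_integral => ? /[!inE] xD; apply/esym/cvg_lim => //=.
    exact: cvg_nnsfun_approx.
  - by move=> n; exact/measurable_EFinP/measurable_funTS.
  - by move=> n ? _; rewrite lee_fin.
  - by move=> ? _ ? ? mn; rewrite lee_fin; exact/lefP/nd_nnsfun_approx.
under eq_fun do rewrite integral_density_nnsfun.
rewrite -monotone_convergence//=.
- apply: eq_integral => x _; apply/cvg_lim => //=.
  under eq_fun do rewrite muleC.
  rewrite muleC; apply: cvgeZl => //.
  exact: cvg_nnsfun_approx.
- move=> n; apply: emeasurable_funM => //.
  exact/measurable_EFinP/measurable_funTS.
- by move=> n x _; rewrite mule_ge0// lee_fin.
- move=> x _ a b ab; rewrite lee_wpmul2r// lee_fin.
  exact/lefP/nd_nnsfun_approx.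
Qed.

End mdensity.

Section cov1.
Local Open Scope ereal_scope.
Variable R : realType.

(** By the fundamental theorem of calculus, the image under [k] of the measure
    of density [k'] gives an interval its length. *)
Lemma ge0_integral_substitution (k k' : R -> R) (f : R -> \bar R) :
  (forall x, is_derive x (1%R : R) k (k' x)) -> continuous k' ->
  (forall x, 0 < k' x)%R -> (forall y, exists x, k x = y) ->
  measurable_fun setT f -> (forall x, 0 <= f x) ->
  \int[lebesgue_measure]_x (f (k x) * (k' x)%:E) =
  \int[lebesgue_measure]_x f x.
Proof.
move=> dk ck' k'0 sk mf f0.
have ck : continuous k.
  move=> x; apply: differentiable_continuous; apply/derivable1_diffP.
  exact: ex_derive.
have ik x y : (x < y)%R -> (k x < k y)%R.
  move=> xy; rewrite -subr_gt0.
  have [z _ ->] : exists2 z, z \in `]x, y[%R & (k y - k x = k' z * (y - x))%R.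
    by apply: MVT => //; exact: continuous_subspaceT.
  by rewrite mulr_gt0// subr_gt0.
have lek x y : (k x <= k y)%R = (x <= y)%R.
  by apply/idP/idP; [apply: contraTT; rewrite -!ltNge; exact: ik|
    rewrite le_eqVlt => /predU1P[->//|/ik/ltW]].
have ltk x y : (k x < k y)%R = (x < y)%R by rewrite !ltNge lek.
have mk : measurable_fun [set: measurableTypeR R] (k : _ -> measurableTypeR R).
  exact: continuous_measurable_fun.
have mk' : measurable_fun [set: measurableTypeR R] (EFin \o k').
  by apply/measurable_EFinP; exact: continuous_measurable_fun ck'.
have k'E0 x : 0 <= (EFin \o k') x by rewrite lee_fin ltW.
pose nu := density_measure (@lebesgue_measure R) mk' k'E0.
have nuE A : measurable A -> lebesgue_measure A = nu (k @^-1` A).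
  apply: (@lebesgue_measure_unique R (pushm nu mk)) => _ [[b c]] _ <-.
  rewrite /pushm /= /pushforward /= /mdensity.
  have [be bE] := sk b; have [ga cE] := sk c.
  rewrite (_ : k @^-1` _ = `]be, ga]%classic); last first.
    by apply/seteqP; split => x /=; rewrite !in_itv/= -bE -cE lek ltk.
  have [bega|gabe] := ltP be ga; last first.
    rewrite !set_itv_ge ?integral_set0 ?measure0// bnd_simp -leNgt//.
    by rewrite -bE -cE lek.
  rewrite integral_itv_obnd_cbnd; last exact: measurable_funTS.
  rewrite (@continuous_FTC2 _ k' k)//; last 3 first.
  - exact: continuous_subspaceT.
  - split.
    + by move=> x _; exact: ex_derive.
    + exact: cvg_at_right_filter (ck be).
    + exact: cvg_at_left_filter (ck ga).
  - by move=> x _; rewrite derive1E; exact: derive_val.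
  by rewrite lebesgue_measure_itv/= lte_fin -bE -cE ltk bega.
have mfk : measurable_fun [set: measurableTypeR R] (f \o k).
  exact: measurableT_comp.
rewrite -[LHS](@ge0_integral_density _ _ _ (@lebesgue_measure R) _ mk' k'E0
  (f \o k))//; last by move=> x; exact: f0.
have := @ge0_integral_pushforward _ _ (measurableTypeR R) (measurableTypeR R) R k
  mk nu setT f measurableT mf
  (fun y _ => f0 y).
rewrite preimage_setT => <-.
by apply: (@eq_measure_integral _ _ _ _ _ (pushm nu mk)) => A mA _; exact/esym/nuE.
Qed.

End cov1.

(** * Inner product and coercive matrices *)

Section vdot.
Variables (R : realType).

Definition vdot n (u v : 'rV[R]_n) : R := \sum_i u ord0 i * v ord0 i.

Lemma vdotC n (u v : 'rV[R]_n) : vdot u v = vdot v u.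
Proof. by apply: eq_bigr => i _; rewrite mulrC. Qed.

Lemma vdotDl n (u v w : 'rV[R]_n) : vdot (u + v) w = vdot u w + vdot v w.
Proof. by rewrite -big_split; apply: eq_bigr => i _; rewrite mxE mulrDl. Qed.

Lemma vdotZl n a (u v : 'rV[R]_n) : vdot (a *: u) v = a * vdot u v.
Proof. by rewrite mulr_sumr; apply: eq_bigr => i _; rewrite mxE mulrA. Qed.

Lemma vdotNl n (u v : 'rV[R]_n) : vdot (- u) v = - vdot u v.
Proof. by rewrite -scaleN1r vdotZl mulN1r. Qed.

Lemma vdotBl n (u v w : 'rV[R]_n) : vdot (u - v) w = vdot u w - vdot v w.
Proof. by rewrite vdotDl vdotNl. Qed.

Lemma vdotDr n (u v w : 'rV[R]_n) : vdot w (u + v) = vdot w u + vdot w v.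
Proof. by rewrite vdotC vdotDl !(vdotC _ w). Qed.

Lemma vdotZr n a (u v : 'rV[R]_n) : vdot v (a *: u) = a * vdot v u.
Proof. by rewrite vdotC vdotZl vdotC. Qed.

Lemma vdotNr n (u v : 'rV[R]_n) : vdot u (- v) = - vdot u v.
Proof. by rewrite vdotC vdotNl vdotC. Qed.

Lemma vdotBr n (u v w : 'rV[R]_n) : vdot w (u - v) = vdot w u - vdot w v.
Proof. by rewrite vdotDr vdotNr. Qed.

Lemma vdot_ge0 n (u : 'rV[R]_n) : 0 <= vdot u u.
Proof. by apply: sumr_ge0 => i _; rewrite -expr2 sqr_ge0. Qed.

(** The norm of a matrix is the sup norm; this inequality and the next compare
    it with the Euclidean one. *)
Lemma sqr_norm_le_vdot n (u : 'rV[R]_n) : `|u| ^+ 2 <= vdot u u.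
Proof.
rewrite -[leRHS]sqr_sqrtr ?vdot_ge0// ler_sqr ?nnegrE ?sqrtr_ge0//.
apply: norm_rV_le; first exact: sqrtr_ge0.
move=> i; rewrite -ler_sqr ?nnegrE ?sqrtr_ge0// sqr_sqrtr ?vdot_ge0//.
rewrite /vdot (bigD1 i)//= real_normK ?num_real// expr2 lerDl.
by apply: sumr_ge0 => j _; rewrite -expr2 sqr_ge0.
Qed.

Lemma vdot_le_sqr_norm n (u : 'rV[R]_n) : vdot u u <= n%:R * `|u| ^+ 2.
Proof.
rewrite (_ : _ * _ = \sum_(i < n) `|u| ^+ 2); last first.
  by rewrite sumr_const card_ord mulr_natl.
apply: ler_sum => i _.
rewrite -expr2 -(real_normK (num_real (u ord0 i))).
by rewrite lerXn2r ?nnegrE ?ler_coord_norm.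
Qed.

Lemma vdot_eq0 n (u : 'rV[R]_n) : vdot u u <= 0 -> u = 0.
Proof.
move=> u0; apply/eqP; rewrite -normr_eq0 -sqrf_eq0 eq_le sqr_ge0 andbT.
exact: le_trans (sqr_norm_le_vdot u) u0.
Qed.

Lemma continuous_rV (T : topologicalType) n (f : T -> 'rV[R]_n) :
  (forall i, continuous (fun t => f t ord0 i)) -> continuous f.
Proof.
move=> cf t; apply/cvgrPdist_lt => e e0.
have : \forall s \near t, forall i, `|f t ord0 i - f s ord0 i| < e.
  by apply: filter_forall => i; have /cvgrPdist_lt := cf i t; apply.
apply: filterS => s fs; apply: norm_rV_lt => // i.
by rewrite !mxE.
Qed.

Lemma continuous_coord (T : topologicalType) n (f : T -> 'rV[R]_n) i :
  continuous f -> continuous (fun t => f t ord0 i).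
Proof.
move=> cf t; apply: (@continuous_comp _ _ _ f (@rV_coord R n i)).
  exact: cf.
exact: continuous_rV_coord.
Qed.

Lemma continuous_sum (T : topologicalType) (I : finType) (f : I -> T -> R) :
  (forall i, continuous (f i)) -> continuous (fun t => \sum_i f i t).
Proof.
move=> cf; elim: (index_enum I) => [|i s IH] t.
  by under eq_fun do rewrite big_nil; exact: cvg_cst.
under eq_fun do rewrite big_cons.
by apply: cvgD; [exact: cf|exact: IH].
Qed.

Lemma continuous_prod (T : topologicalType) (I : finType) (f : I -> T -> R) :
  (forall i, continuous (f i)) -> continuous (fun t => \prod_i f i t).
Proof.
move=> cf; elim: (index_enum I) => [|i s IH] t.
  by under eq_fun do rewrite big_nil; exact: cvg_cst.
under eq_fun do rewrite big_cons.
by apply: cvgM; [exact: cf|exact: IH].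
Qed.

Lemma continuous_det (T : topologicalType) n (f : T -> 'M[R]_n) :
  (forall i j, continuous (fun t => f t i j)) -> continuous (fun t => \det (f t)).
Proof.
move=> cf; rewrite (_ : (fun t => _) = fun t =>
    \sum_(s : 'S_n) (-1) ^+ s * \prod_i f t i (s i)) ?funeqE//.
apply: continuous_sum => s t; apply: cvgM; first exact: cvg_cst.
exact: continuous_prod.
Qed.

Lemma continuous_vdot (T : topologicalType) n (f g : T -> 'rV[R]_n) :
  continuous f -> continuous g -> continuous (fun t => vdot (f t) (g t)).
Proof.
move=> cf cg; apply: continuous_sum => i t.
by apply: cvgM; exact: continuous_coord.
Qed.

Lemma continuous_mulmx (T : topologicalType) m n (f : T -> 'rV[R]_m)
    (g : T -> 'M[R]_(m, n)) :
  continuous f -> (forall i j, continuous (fun t => g t i j)) ->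
  continuous (fun t => f t *m g t).
Proof.
move=> cf cg; apply: continuous_rV => j.
rewrite (_ : (fun t => _) = fun t => \sum_i f t ord0 i * g t i j).
  by apply: continuous_sum => i t; apply: cvgM; [exact: continuous_coord|exact: cg].
by apply/funext => t; rewrite mxE.
Qed.

Definition coercive_mx n (c : R) (M : 'M[R]_n) :=
  forall u : 'rV[R]_n, c * vdot u u <= vdot (u *m M) u.

Lemma rV_cons_head n (z : measurableTypeR R * 'rV[R]_n) :
  rV_cons z ord0 ord0 = z.1.
Proof. by rewrite mxE unlift_none. Qed.

Lemma rV_cons_tail n (z : measurableTypeR R * 'rV[R]_n) i :
  rV_cons z ord0 (lift ord0 i) = z.2 ord0 i.
Proof. by rewrite mxE liftK. Qed.

Lemma vdot_cons n (a b : R) (u v : 'rV[R]_n) :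
  vdot (rV_cons (a, u)) (rV_cons (b, v)) = a * b + vdot u v.
Proof.
rewrite /vdot big_ord_recl !rV_cons_head; congr (_ + _).
by apply: eq_bigr => i _; rewrite !rV_cons_tail.
Qed.

Definition minor00 n (M : 'M[R]_n.+1) : 'M[R]_n := row' ord0 (col' ord0 M).

Lemma cons_mulmx_tail n (u : 'rV[R]_n) (M : 'M[R]_n.+1) i :
  (rV_cons (0, u) *m M) ord0 (lift ord0 i) = (u *m minor00 M) ord0 i.
Proof.
rewrite !mxE big_ord_recl rV_cons_head mul0r add0r.
by apply: eq_bigr => j _; rewrite rV_cons_tail !mxE.
Qed.

(** Test the form on the vectors whose first coordinate vanishes. *)
Lemma coercive_minor n c (M : 'M[R]_n.+1) :
  coercive_mx c M -> coercive_mx c (minor00 M).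
Proof.
move=> cM u; have := cM (rV_cons (0, u)); rewrite vdot_cons mulr0 add0r.
move=> /le_trans; apply; rewrite /vdot big_ord_recl rV_cons_head mulr0 add0r.
by apply: ler_sum => i _; rewrite -cons_mulmx_tail rV_cons_tail.
Qed.

(** Multiply by the adjugate of [M] and read off the first coordinate. *)
Lemma cramer_first n (M : 'M[R]_n.+1) (u : 'rV[R]_n.+1) (r : R) :
  u *m M = rV_cons (r, 0) -> u ord0 ord0 * \det M = r * \det (minor00 M).
Proof.
move=> uM; have := congr1 (fun v => (v *m \adj M) ord0 ord0) uM.
rewrite /= -mulmxA mul_mx_adj mul_mx_scalar [LHS]mxE mulrC => ->.
rewrite mxE big_ord_recl rV_cons_head big1 ?addr0.
  by rewrite mxE /cofactor /minor00 addn0 expr0 mul1r.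
by move=> i _; rewrite rV_cons_tail mxE mul0r.
Qed.

(** By induction on the dimension: a vector with first coordinate 1 is chosen so
    that [M] sends it to a multiple [r] of the first basis vector. Coercivity
    gives [0 < r], and [cramer_first] says that [r] is the quotient of the
    determinant of [M] by that of its minor. *)
Lemma coercive_det_gt0 n c (M : 'M[R]_n) : 0 < c -> coercive_mx c M ->
  0 < \det M.
Proof.
move=> c0; elim: n M => [|n IH] M cM; first by rewrite det_mx00.
have dm := IH _ (coercive_minor cM).
have um : minor00 M \in unitmx by rewrite unitmxE unitfE gt_eqF.
pose w : 'rV[R]_n := - ((\row_i M ord0 (lift ord0 i)) *m invmx (minor00 M)).
pose u := rV_cons (1, w).
pose r := (u *m M) ord0 ord0.
have uM : u *m M = rV_cons (r, 0).
  apply/rowP => j; case: (unliftP ord0 j) => [i|] ->; last by rewrite rV_cons_head.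
  rewrite rV_cons_tail (_ : u = rV_cons (1, 0) + rV_cons (0, w)); last first.
    by rewrite rV_consD addr0 add0r.
  rewrite mulmxDl [LHS]mxE cons_mulmx_tail /w mulNmx mulmxKV// !mxE.
  rewrite big_ord_recl rV_cons_head mul1r big1 ?addr0 ?subrr//.
  by move=> k _; rewrite rV_cons_tail mxE mul0r.
have := cramer_first uM; rewrite {1}/u rV_cons_head mul1r => ->.
rewrite mulr_gt0//.
have := cM u; rewrite uM /u !vdot_cons mulr1 mulr1.
rewrite [X in r + X](_ : _ = 0) ?addr0; last first.
  by rewrite /vdot big1// => i _; rewrite mxE mul0r.
by apply: lt_le_trans; rewrite mulr_gt0// ltr_pwDl// vdot_ge0.
Qed.

End vdot.

(** * Change of variables for strongly monotone maps *)

Section continuity.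
Variables (R : realType) (T : topologicalType) (V : normedModType R).
Implicit Types (f g : T -> V) (k l : T -> R).

Lemma cont_cst (v : V) : continuous (fun _ : T => v).
Proof. by move=> t; exact: cvg_cst. Qed.

Lemma cont_add f g : continuous f -> continuous g ->
  continuous (fun t => f t + g t).
Proof. by move=> cf cg t; apply: cvgD; [exact: cf|exact: cg]. Qed.

Lemma cont_opp f : continuous f -> continuous (fun t => - f t).
Proof. by move=> cf t; apply: cvgN; exact: cf. Qed.

Lemma cont_sub f g : continuous f -> continuous g ->
  continuous (fun t => f t - g t).
Proof. by move=> cf cg; apply: cont_add => //; exact: cont_opp. Qed.

Lemma cont_scale k f : continuous k -> continuous f ->
  continuous (fun t => k t *: f t).
Proof. by move=> ck cf t; apply: cvgZ; [exact: ck|exact: cf]. Qed.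

Lemma cont_mul k l : continuous k -> continuous l ->
  continuous (fun t => k t * l t).
Proof. by move=> ck cl t; apply: cvgM; [exact: ck|exact: cl]. Qed.

Lemma cont_inv k : (forall t, k t != 0) -> continuous k ->
  continuous (fun t => (k t)^-1).
Proof. by move=> k0 ck t; apply: cvgV => //; exact: ck. Qed.

End continuity.

Section continuity_topological.
Variables (T : topologicalType).

Lemma cont_comp (U V : topologicalType) (h : T -> U) (f : U -> V) :
  continuous h -> continuous f -> continuous (fun t => f (h t)).
Proof.
by move=> ch cf t; apply: (@continuous_comp _ _ _ h f); [exact: ch|exact: cf].
Qed.

Lemma cont_id : continuous (@id T).
Proof. by move=> t; exact: cvg_id. Qed.

Lemma cont_pair (U U' : topologicalType) (h : T -> U) (h' : T -> U') :
  continuous h -> continuous h' -> continuous (fun t => (h t, h' t)).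
Proof. by move=> ch ch' t; apply: cvg_pair; [exact: ch|exact: ch']. Qed.

Lemma cont_fst (U : topologicalType) : continuous (@fst T U).
Proof. by move=> t; exact: cvg_fst. Qed.

Lemma cont_snd (U : topologicalType) : continuous (@snd T U).
Proof. by move=> t; exact: cvg_snd. Qed.

End continuity_topological.

Section secant.
Variables (R : realType).

(** The matrix [A y y'] stands for the derivative of [G] averaged over the
    segment from [y] to [y'], so that the increment identity is exact and no
    differential of a map between vector spaces is needed; coercivity of [A]
    is strong monotonicity of [G]. *)
Record secant n (c : R) (G : 'rV[R]_n -> 'rV[R]_n)
    (A : 'rV[R]_n -> 'rV[R]_n -> 'M[R]_n) : Prop := Secant {
  secantE : forall y y', G y' - G y = (y' - y) *m A y y';
  secant_cont : forall i j,
    continuous (fun z : 'rV[R]_n * 'rV[R]_n => A z.1 z.2 i j);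
  secant_coercive : forall y y', coercive_mx c (A y y') }.

Definition expansive n (c : R) (G : 'rV[R]_n -> 'rV[R]_n) :=
  forall y y', c ^+ 2 * vdot (y' - y) (y' - y) <= vdot (G y' - G y) (G y' - G y).

(** Expand [|g - c d|^2 >= 0] with [g] the increment of [G] and [d] that of the
    argument, and use [c |d|^2 <= (g, d)]. *)
Lemma secant_expansive n c (G : 'rV[R]_n -> 'rV[R]_n) A : 0 < c ->
  secant c G A -> expansive c G.
Proof.
move=> c0 [GA _ cA] y y'; rewrite GA.
move: (y' - y) (cA y y' (y' - y)) => d; move: (d *m _) => g.
have := vdot_ge0 (g - c *: d).
rewrite vdotBl !vdotBr !vdotZl !vdotZr (vdotC d g).
move: (vdot d d) (vdot g g) (vdot g d) => D E H h2 h1.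
have : c * (c * D) <= c * H by rewrite ler_pM2l.
by rewrite expr2; nra.
Qed.

Lemma expansive_norm n c (G : 'rV[R]_n -> 'rV[R]_n) y y' : expansive c G ->
  c ^+ 2 * `|y' - y| ^+ 2 <= vdot (G y' - G y) (G y' - G y).
Proof.
move=> /(_ y y'); apply: le_trans.
by rewrite ler_wpM2l ?sqr_ge0// sqr_norm_le_vdot.
Qed.

Lemma expansive_inj n c (G : 'rV[R]_n -> 'rV[R]_n) : 0 < c -> expansive c G ->
  injective G.
Proof.
move=> c0 eG y y' Gy; apply/esym/eqP; rewrite -subr_eq0; apply/eqP.
apply: vdot_eq0; have := eG y y'.
have -> : vdot (G y' - G y) (G y' - G y) = 0.
  by rewrite Gy subrr /vdot big1// => i _; rewrite mxE mul0r.
by rewrite pmulr_rle0// exprn_gt0.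
Qed.

Lemma secant_continuous n c (G : 'rV[R]_n -> 'rV[R]_n) A :
  secant c G A -> continuous G.
Proof.
move=> [GA cA _].
rewrite (_ : G = fun y => G 0 + (y - 0) *m A 0 y); last first.
  by apply/funext => y; rewrite -GA addrC subrK.
apply: cont_add; first exact: cont_cst.
apply: continuous_mulmx; first by apply: cont_sub; [exact: cont_id|exact: cont_cst].
move=> i j.
refine (@cont_comp _ _ _ (fun y : 'rV[R]_n => (0 : 'rV[R]_n, y))
  (fun z => A z.1 z.2 i j) _ _) => //.
by apply: cont_pair; [exact: cont_cst|exact: cont_id].
Qed.

(** Minimize [|G y - p|^2]: at a minimum, moving along minus the residue shows
    that the residue vanishes, by coercivity. *)
Lemma secant_surjective n c (G : 'rV[R]_n -> 'rV[R]_n) A : 0 < c ->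
  secant c G A -> forall p, exists y, G y = p.
Proof.
move=> c0 GA p.
have cG := secant_continuous GA; have eG := secant_expansive c0 GA.
pose phi y := vdot (G y - p) (G y - p).
have cphi : continuous phi.
  by apply: continuous_vdot; (apply: cont_sub => //; exact: cont_cst).
pose K : set 'rV[R]_n := phi @^-1` [set x | x <= phi 0].
have K0 : K !=set0 by exists 0; rewrite /K/=.
have cK : compact K.
  apply: bounded_closed_compact; last first.
    by apply: closed_comp; [by move=> y _; exact: cphi|exact: closed_le].
  exists (4 * phi 0 / c ^+ 2 + 1); split; first exact: num_real.
  move=> M ltM y; rewrite /K/= => Ky; rewrite (le_trans _ (ltW ltM))//.
  have c2 : 0 < c ^+ 2 by rewrite exprn_gt0.
  have h1 : c ^+ 2 * `|y| ^+ 2 <= 4 * phi 0.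
    have := expansive_norm 0 y eG; rewrite subr0 => /le_trans; apply.
    have -> : G y - G 0 = (G y - p) - (G 0 - p) by rewrite opprB addrA subrK.
    have := vdot_ge0 ((G y - p) + (G 0 - p)); move: Ky; rewrite /phi.
    rewrite !(vdotBl, vdotBr, vdotDl, vdotDr, vdotNl, vdotNr).
    rewrite !(vdotC p) !(vdotC (G 0) (G y)).
    move=> h2 h3; lra.
  have : `|y| ^+ 2 <= 4 * phi 0 / c ^+ 2 by rewrite ler_pdivlMr// mulrC.
  have := sqr_ge0 (`|y| - 1); have := normr_ge0 y; rewrite expr2 => h2 h3 h4.
  nra.
have [y yK ymin] := EVT_min_rV K0 cK (continuous_subspaceT cphi).
have {}ymin z : phi y <= phi z.
  have [zK|zK] := leP (phi z) (phi 0).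
    by apply: ymin; rewrite inE.
  by move: yK; rewrite inE /K/= => /le_trans; apply; exact: ltW.
exists y; apply/eqP; rewrite -subr_eq0; apply/eqP; set r := G y - p.
apply: vdot_eq0; rewrite leNgt; apply/negP => r0.
pose w (t : R) := r *m A y (y - t *: r).
have cw : continuous w.
  apply: continuous_mulmx => [|i j]; first exact: cont_cst.
  refine (@cont_comp _ _ _ (fun t : R => (y, y - t *: r))
    (fun z => A z.1 z.2 i j) _ _); last exact: (secant_cont GA).
  apply: cont_pair; first exact: cont_cst.
  apply: cont_sub; first exact: cont_cst.
  by apply: cont_scale; [exact: cont_id|exact: cont_cst].
have ct : (t * vdot (w t) (w t)) @[t --> (0:R)] --> 0 * vdot (w 0) (w 0).
  by apply: cvgM; [exact: cvg_id|exact: (continuous_vdot cw cw)].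
have : \forall t \near 0^'+, t * vdot (w t) (w t) < 2 * c * vdot r r.
  have := cvg_at_right_filter ct; rewrite mul0r => /cvgr_lt; apply.
  by rewrite !mulr_gt0.
move=> tlt; near (0 : R)^'+ => t.
have t0 : 0 < t by near: t; exact: nbhs_right_gt.
have : t * vdot (w t) (w t) < 2 * c * vdot r r by near: t.
apply/negP; rewrite -leNgt.
have := ymin (y - t *: r); rewrite /phi -/r.
have -> : G (y - t *: r) - p = r - t *: w t.
  have E : G (y - t *: r) - G y = - (t *: w t).
    by rewrite (secantE GA) addrAC subrr add0r mulNmx -scalemxAl.
  by rewrite -[G (y - t *: r)](subrK (G y)) E -addrA addrC.
have := secant_coercive GA y (y - t *: r) r; rewrite -/(w t).
move: (w t) (r) => wt q; rewrite !(vdotBl, vdotBr, vdotZl, vdotZr) (vdotC q wt).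
move: (vdot q q) (vdot wt q) (vdot wt wt) => a b e h1 h2.
rewrite -(ler_pM2l t0); nra.
Unshelve. all: end_near. Qed.

Lemma secant_inverse (T : Type) n c (G : T -> 'rV[R]_n -> 'rV[R]_n)
    (A : T -> 'rV[R]_n -> 'rV[R]_n -> 'M[R]_n) : 0 < c ->
  (forall t, secant c (G t) (A t)) ->
  exists Y : T -> 'rV[R]_n -> 'rV[R]_n,
    (forall t, cancel (Y t) (G t)) /\ (forall t, cancel (G t) (Y t)).
Proof.
move=> c0 GA.
have /choice[Y GY] : forall z : T * 'rV[R]_n, exists y, G z.1 y = z.2.
  by move=> z; exact: (secant_surjective c0 (GA z.1)).
exists (fun t p => Y (t, p)); split => t p; first exact: (GY (t, p)).
apply: (expansive_inj c0 (secant_expansive c0 (GA t))).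
exact: (GY (t, G t p)).
Qed.

(** The residue of the old solution at the new parameters is small, and
    expansivity turns a small residue into a small error. *)
Lemma expansive_inverse_continuous (T : topologicalType) n c
    (G : T -> 'rV[R]_n -> 'rV[R]_n) (Y : T -> 'rV[R]_n -> 'rV[R]_n) : 0 < c ->
  (forall t, expansive c (G t)) -> (forall t, cancel (Y t) (G t)) ->
  (forall y, continuous (fun t => G t y)) ->
  continuous (fun z : T * 'rV[R]_n => Y z.1 z.2).
Proof.
move=> c0 eG GY cG [t p]; apply/cvgrPdist_lt => e e0 /=; set y := Y t p.
pose psi (z : T * 'rV[R]_n) := vdot (z.2 - G z.1 y) (z.2 - G z.1 y).
have cpsi : continuous psi.
  suff : continuous (fun z : T * 'rV[R]_n => z.2 - G z.1 y).
    by move=> cz; exact: continuous_vdot.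
  apply: cont_sub; first exact: cont_snd.
  by refine (@cont_comp _ _ _ fst (G^~ y) _ _) => //; exact: cont_fst.
have psi0 : psi (t, p) = 0.
  rewrite /psi/= /y GY subrr /vdot big1// => i _; by rewrite mxE mul0r.
have /cvgr_lt : psi z @[z --> (t, p)] --> 0 by rewrite -psi0; exact: cpsi.
have ce : 0 < c ^+ 2 * e ^+ 2 by rewrite mulr_gt0// exprn_gt0.
move=> /(_ _ ce); apply: filterS => -[s q] /= lt.
have := expansive_norm y (Y s q) (eG s); rewrite GY => le.
have {le lt} := le_lt_trans le lt.
rewrite ltr_pM2l ?exprn_gt0// ltr_sqr ?nnegrE//; last exact: ltW.
by rewrite distrC.
Qed.

Lemma continuous_rV_uncons n : continuous (@rV_uncons R n).
Proof.
refine (@cont_pair _ _ _ (@rV_coord R n.+1 ord0)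
  (fun x => \row_j x ord0 (lift ord0 j)) _ _).
  exact: continuous_rV_coord.
apply: continuous_rV => i y.
under eq_fun do rewrite mxE.
exact: (@continuous_rV_coord R n.+1 (lift ord0 i)).
Qed.

Lemma continuous_measurable_cons n (f : R * 'rV[R]_n -> R) : continuous f ->
  measurable_fun setT (f : measurableTypeR R * 'rV[R]_n -> measurableTypeR R).
Proof.
move=> cf; rewrite (_ : f = (f \o @rV_uncons R n) \o @rV_cons R n); last first.
  by apply/funext => z /=; rewrite rV_consK.
apply: measurableT_comp; last exact: measurable_rV_cons.
apply: continuous_measurable_rV => x; apply: continuous_comp.
  exact: continuous_rV_uncons.
exact: cf.
Qed.

Lemma continuous_rV_cons (T : topologicalType) n (f : T -> R) (g : T -> 'rV[R]_n) :
  continuous f -> continuous g -> continuous (fun t => rV_cons (f t, g t)).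
Proof.
move=> cf cg; apply: continuous_rV => j t.
case: (unliftP ord0 j) => [i|] ->.
  under eq_fun do rewrite rV_cons_tail.
  exact: (continuous_coord (i := i) cg).
by under eq_fun do rewrite rV_cons_head; exact: cf.
Qed.

Lemma is_derive_secant (k q : R -> R) (x : R) :
  (forall t, k (t + x) - k x = t * q t) -> continuous q ->
  is_derive x (1 : R) k (q 0).
Proof.
move=> kq cq.
have dk : t^-1 *: (k (t *: (1 : R) + x) - k x) @[t --> 0^'] --> q 0.
  have : q t @[t --> 0^'] --> q 0.
    by apply: (@cvg_within_filter _ _ _ (nbhs (0 : R))); exact: cq.
  apply: cvg_trans; apply: near_eq_cvg; near=> t.
  have t0 : t != 0 by near: t; exact: nbhs_dnbhs_neq.
  by rewrite [t *: 1]mulr1 kq [RHS]mulrA mulVf// mul1r.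
split; first by apply/cvg_ex; exists (q 0).
exact/cvg_lim.
Unshelve. all: end_near. Qed.

Lemma rV_subE n (u v : 'rV[R]_n) i : (u - v) ord0 i = u ord0 i - v ord0 i.
Proof. by rewrite !mxE. Qed.

(** Fixing the first coordinate and discarding the first output keeps the
    structure; the minor inherits coercivity from the matrix. *)
Lemma secant_minor n c (G : 'rV[R]_n.+1 -> 'rV[R]_n.+1) A (x : R) :
  secant c G A ->
  secant c (fun z : 'rV[R]_n => \row_j G (rV_cons (x, z)) ord0 (lift ord0 j))
    (fun z z' => minor00 (A (rV_cons (x, z)) (rV_cons (x, z')))).
Proof.
move=> [GA cA coA]; split.
- move=> z z'; apply/rowP => j; rewrite -cons_mulmx_tail.
  have -> : rV_cons (0, z' - z) = rV_cons (x, z') - rV_cons (x, z).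
    apply/rowP => k; case: (unliftP ord0 k) => [i|] ->.
      by rewrite rV_subE !rV_cons_tail rV_subE.
    by rewrite rV_subE !rV_cons_head subrr.
  by rewrite -GA !mxE.
- move=> i j; under eq_fun do rewrite /minor00 !mxE.
  refine (@cont_comp _ _ _
    (fun z : 'rV[R]_n * 'rV[R]_n => (rV_cons (x, z.1), rV_cons (x, z.2)))
    (fun z => A z.1 z.2 (lift ord0 i) (lift ord0 j)) _ _) => //.
  by apply: cont_pair; apply: continuous_rV_cons; try exact: cont_cst;
    [exact: cont_fst|exact: cont_snd].
- by move=> z z'; exact: coercive_minor.
Qed.

Local Open Scope ereal_scope.

(** Change of variables, by induction on the dimension. For a fixed first
    coordinate [x] the map [z -> tail (G (x, z))] is of the same kind, with
    inverse [Y x]; substituting it leaves, for each value [p] of the tail, the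
    scalar map [x -> head (G (x, Y x p))], whose derivative is the quotient of
    the two determinants by Cramer's rule. *)
Theorem ge0_integral_secant n c (G : 'rV[R]_n -> 'rV[R]_n) A
    (f : 'rV[R]_n -> \bar R) : (0 < c)%R -> secant c G A ->
  measurable_fun setT f -> (forall y, 0 <= f y) ->
  \int[lebesgue_rV R n]_y (f (G y) * (\det (A y y))%:E) =
  \int[lebesgue_rV R n]_y f y.
Proof.
move=> c0; elim: n G A f => [|n IH] G A f GA mf f0.
  have mg : measurable_fun setT (fun y => f (G y) * (\det (A y y))%:E).
    rewrite (_ : (fun _ => _) = fun=> f 0%R); first exact: measurable_cst.
    apply/funext => y; rewrite det_mx00 mule1; congr f.
    by apply/rowP => -[].
  rewrite !ge0_integral_lebesgue_rV0// det_mx00 mule1; congr f.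
  by apply/rowP => -[].
pose Gt (x : R) (z : 'rV[R]_n) : 'rV[R]_n :=
  (\row_j G (rV_cons (x, z)) ord0 (lift ord0 j))%R.
pose At (x : R) (z z' : 'rV[R]_n) :=
  minor00 (A (rV_cons (x, z)) (rV_cons (x, z'))).
have GtA x : secant c (Gt x) (At x) by exact: secant_minor.
have [Y [GY YG]] := secant_inverse c0 GtA.
have cG := secant_continuous GA.
have cY : continuous (fun z : R * 'rV[R]_n => Y z.1 z.2).
  apply: (expansive_inverse_continuous c0 (G := Gt)) => //.
    by move=> t; exact: secant_expansive (GtA t).
  move=> z; apply: continuous_rV => j; under eq_fun do rewrite mxE.
  apply: continuous_coord.
  refine (@cont_comp _ _ _ (fun t => rV_cons (t, z)) G _ _) => //.
  by apply: continuous_rV_cons; [exact: cont_id|exact: cont_cst].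
pose y_ (z : R * 'rV[R]_n) := rV_cons (z.1, Y z.1 z.2).
have cy : continuous y_ by apply: continuous_rV_cons => //; exact: cont_fst.
pose D x p x' p' := (\det (A (y_ (x, p)) (y_ (x', p'))) /
  \det (minor00 (A (y_ (x, p)) (y_ (x', p')))))%R.
have dA y y' : (0 < \det (A y y'))%R.
  exact: coercive_det_gt0 c0 (secant_coercive GA y y').
have dm y y' : (0 < \det (minor00 (A y y')))%R.
  exact: coercive_det_gt0 c0 (coercive_minor (secant_coercive GA y y')).
have cAyy i j : continuous
    (fun z : (R * 'rV[R]_n) * (R * 'rV[R]_n) => A (y_ z.1) (y_ z.2) i j).
  refine (@cont_comp _ _ _ (fun z : (R * 'rV[R]_n) * (R * 'rV[R]_n) =>
    (y_ z.1, y_ z.2)) (fun z => A z.1 z.2 i j) _ (secant_cont (i:=i) (j:=j) GA)).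
  apply: cont_pair.
    by refine (@cont_comp _ _ _ fst y_ _ _) => //; exact: cont_fst.
  by refine (@cont_comp _ _ _ snd y_ _ _) => //; exact: cont_snd.
have cD : continuous (fun z : (R * 'rV[R]_n) * (R * 'rV[R]_n) =>
    D z.1.1 z.1.2 z.2.1 z.2.2).
  rewrite (_ : (fun _ => _) = fun z => (\det (A (y_ z.1) (y_ z.2)) *
    (\det (minor00 (A (y_ z.1) (y_ z.2))))^-1)%R); last first.
    by apply/funext => -[[? ?] [? ?]].
  apply: cont_mul; first exact: continuous_det.
  apply: cont_inv => [t|]; first by rewrite gt_eqF.
  apply: continuous_det => i j; under eq_fun do rewrite /minor00 !mxE.
  exact: cAyy.
pose k x p := G (y_ (x, p)) ord0 ord0.
pose r x p := D x p x p.
have Gcons x p : G (y_ (x, p)) = rV_cons (k x p, p).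
  apply/rowP => j; case: (unliftP ord0 j) => [i|] ->; last by rewrite rV_cons_head.
  by rewrite rV_cons_tail -[in RHS](GY x p) mxE.
have kD x x' p : (k x' p - k x p = (x' - x) * D x p x' p)%R.
  have uM : ((y_ (x', p) - y_ (x, p)) *m A (y_ (x, p)) (y_ (x', p)) =
      rV_cons (k x' p - k x p, 0))%R.
    rewrite -(secantE GA) !Gcons; apply/rowP => j; rewrite rV_subE.
    by case: (unliftP ord0 j) => [i|] ->; rewrite ?rV_cons_tail ?rV_cons_head
      ?subrr ?mxE.
  have := cramer_first uM; rewrite rV_subE !rV_cons_head /=.
  by rewrite /D mulrA => ->; rewrite mulfK// gt_eqF.
have ck : continuous (fun z : R * 'rV[R]_n => k z.1 z.2).
  apply: continuous_coord.
  rewrite (_ : (fun _ => _) = G \o y_); last by apply/funext => -[].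
  exact: cont_comp.
have cr : continuous (fun z : R * 'rV[R]_n => r z.1 z.2).
  refine (@cont_comp _ _ _ (fun z : R * 'rV[R]_n => (z, z)) _ _ cD).
  by apply: cont_pair; exact: cont_id.
pose F (z : measurableTypeR R * 'rV[R]_n) :=
  f (rV_cons (k z.1 z.2, z.2)) * (r z.1 z.2)%:E.
have F0 z : 0 <= F z.
  by rewrite mule_ge0// lee_fin divr_ge0// ltW.
have mF : measurable_fun setT F.
  apply: emeasurable_funM.
    apply: measurableT_comp => //; apply: (measurableT_comp (@measurable_rV_cons R n)).
    by apply: measurable_fun_pair => //; exact: continuous_measurable_cons ck.
  by apply/measurable_EFinP; exact: continuous_measurable_cons cr.
have cAd : continuous (fun y => \det (A y y)).
  apply: continuous_det => i j.
  refine (@cont_comp _ _ _ (fun y => (y, y)) (fun z => A z.1 z.2 i j)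
    _ (secant_cont (i:=i) (j:=j) GA)).
  by apply: cont_pair; exact: cont_id.
have mG : measurable_fun setT G by exact: continuous_measurable_rV2.
rewrite ge0_integral_lebesgue_cons; last 2 first.
- apply: emeasurable_funM; first exact: measurableT_comp.
  by apply/measurable_EFinP; exact: continuous_measurable_rV.
- by move=> y; rewrite mule_ge0// lee_fin ltW.
transitivity (\int[lebesgue_measure]_x \int[lebesgue_rV R n]_p F (x, p)).
  apply: eq_integral => x _.
  rewrite -(IH (Gt x) (At x) (fun p => F (x, p)))//; last first.
    exact: measurableT_comp.
  apply: eq_integral => z _; rewrite /F/= -muleA -EFinM /r /D /y_/= YG.
  rewrite divfK ?gt_eqF//; congr (f _ * _).
  by rewrite -Gcons /y_/= YG.
rewrite (fubini_tonelli F)//= [RHS]ge0_integral_lebesgue_cons//.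
rewrite [RHS](fubini_tonelli (fun z : measurableTypeR R * 'rV[R]_n =>
  f (rV_cons z)))//=; last first.
  by apply: measurableT_comp => //; exact: measurable_rV_cons.
apply: eq_integral => p _; rewrite /F/=.
apply: (@ge0_integral_substitution R (k ^~ p) (r ^~ p)
  (fun x => f (rV_cons (x, p)))) => //.
- move=> x.
  have cDx : continuous (fun t => D x p (t + x)%R p).
    refine (@cont_comp _ _ _ (fun t : R => ((x, p), ((t + x)%R, p))) _ _ cD).
    apply: cont_pair; first exact: cont_cst.
    apply: cont_pair; last exact: cont_cst.
    by apply: cont_add; [exact: cont_id|exact: cont_cst].
  have kt t : (k (t + x) p - k x p = t * D x p (t + x) p)%R by rewrite kD addrK.
  by have := is_derive_secant (k := k ^~ p) kt cDx; rewrite /= add0r.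
- refine (@cont_comp _ _ _ (fun x : R => (x, p)) _ _ cr).
  by apply: cont_pair; [exact: cont_id|exact: cont_cst].
- by move=> x; rewrite divr_gt0.
- move=> p0; have [y Gy] := secant_surjective c0 GA (rV_cons (p0, p)).
  exists (y ord0 ord0); set z : 'rV[R]_n := (\row_j y ord0 (lift ord0 j))%R.
  have yE := rV_uncons_consK y.
  have -> : k (y ord0 ord0) p = G y ord0 ord0; last by rewrite Gy rV_cons_head.
  rewrite /k /y_/= -[in RHS]yE; congr (G (rV_cons (_, _)) _ _).
  apply: (can_inj (YG (y ord0 ord0))); rewrite GY.
  apply/rowP => j; rewrite mxE yE Gy rV_cons_tail//.
- by apply: measurableT_comp => //; exact: measurable_consl.
Qed.

End secant.

(** * Moments and the standard Gaussian measure *)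

Definition mfun_of d1 d2 (T1 : measurableType d1) (T2 : measurableType d2)
  (f : T1 -> T2) (mf : measurable_fun setT f) : {mfun T1 >-> T2} :=
  HB.pack f (isMeasurableFun.Build _ _ _ _ f mf).

Section moments.
Local Open Scope ereal_scope.
Context d (T : measurableType d) (R : realType).
Variable mu : probability T R.
Implicit Types X Y : T -> R.

(** All absolute moments are finite; the class is closed under products, hence
    under polynomials. *)
Definition moments X := measurable_fun setT X /\
  forall p : nat, \int[mu]_t (`|X t| ^+ p)%:E < +oo.

Lemma measurable_normX p X : measurable_fun setT X ->
  measurable_fun setT (fun t => (`|X t| ^+ p)%:E).
Proof.
by move=> mX; apply/measurable_EFinP/measurable_funX; exact: measurableT_comp.
Qed.

Lemma moments_le X Y : measurable_fun setT X -> (forall t, `|X t| <= `|Y t|)%R ->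
  moments Y -> moments X.
Proof.
move=> mX XY [mY Yp]; split=> // p; apply: le_lt_trans (Yp p).
apply: ge0_le_integral => //; try exact: measurable_normX.
- by move=> t _; rewrite lee_fin lerXn2r ?nnegrE.
Qed.

Lemma moments_cst (c : R) : moments (fun=> c).
Proof.
split=> // p; rewrite integral_cst//= ?probability_setT ?mule1 ?ltry//.
Qed.

Lemma exprD_le (a b : R) p : (0 <= a -> 0 <= b ->
  (a + b) ^+ p <= 2 ^+ p * (a ^+ p + b ^+ p))%R.
Proof.
move=> a0 b0; have [ab|ba] := leP a b.
  apply: (@le_trans _ _ ((2 * b) ^+ p)%R).
    by rewrite lerXn2r ?nnegrE ?addr_ge0 ?mulr_ge0//; lra.
  by rewrite exprMn ler_wpM2l ?exprn_ge0// lerDr exprn_ge0.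
apply: (@le_trans _ _ ((2 * a) ^+ p)%R).
  by rewrite lerXn2r ?nnegrE ?addr_ge0 ?mulr_ge0//; lra.
by rewrite exprMn ler_wpM2l ?exprn_ge0// lerDl exprn_ge0.
Qed.

Lemma momentsD X Y : moments X -> moments Y -> moments (fun t => X t + Y t)%R.
Proof.
move=> [mX Xp] [mY Yp]; have mXY := measurable_funD mX mY; split=> // p.
apply: (@le_lt_trans _ _ (\int[mu]_t
    ((2 ^+ p)%:E * ((`|X t| ^+ p)%:E + (`|Y t| ^+ p)%:E)))).
  apply: ge0_le_integral => //.
  - exact: measurable_normX.
  - apply: measurable_funeM; apply: emeasurable_funD; exact: measurable_normX.
  - move=> t _; rewrite -EFinD -EFinM lee_fin.
    apply: le_trans (exprD_le _ _ _) => //.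
    by rewrite lerXn2r ?nnegrE ?addr_ge0// ler_normD.
have mXp := measurable_normX p mX; have mYp := measurable_normX p mY.
have mS := emeasurable_funD mXp mYp.
rewrite ge0_integralZl//; last by move=> t _; exact: adde_ge0.
rewrite ge0_integralD//.
by rewrite lte_mul_pinfty ?lee_fin ?exprn_ge0// lte_add_pinfty.
Qed.

Lemma momentsM X Y : moments X -> moments Y -> moments (fun t => X t * Y t)%R.
Proof.
move=> [mX Xp] [mY Yp]; have mXY := measurable_funM mX mY; split=> // p.
apply: (@le_lt_trans _ _ (\int[mu]_t
    ((`|X t| ^+ (2 * p))%:E + (`|Y t| ^+ (2 * p))%:E))).
  apply: ge0_le_integral => //.
  - exact: measurable_normX.
  - by apply: emeasurable_funD; exact: measurable_normX.
  - move=> t _; rewrite -EFinD lee_fin normrM exprMn mulnC !exprM.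
    have := exprn_ge0 p (normr_ge0 (X t)); have := exprn_ge0 p (normr_ge0 (Y t)).
    move: (`|X t| ^+ p)%R (`|Y t| ^+ p)%R => a b b0 a0.
    have := sqr_ge0 (a - b); have := mulr_ge0 a0 b0; rewrite !expr2; nra.
rewrite ge0_integralD//; try exact: measurable_normX.
exact: lte_add_pinfty.
Qed.

Lemma momentsX X p : moments X -> moments (fun t => X t ^+ p)%R.
Proof.
move=> mX; elim: p => [|p IH].
  by under eq_fun do rewrite expr0; exact: moments_cst.
by under eq_fun do rewrite exprS; exact: momentsM.
Qed.

Lemma moments_sum (I : finType) (X : I -> T -> R) :
  (forall i, moments (X i)) -> moments (fun t => \sum_i X i t)%R.
Proof.
move=> mX; elim: (index_enum I) => [|i s IH].
  by under eq_fun do rewrite big_nil; exact: moments_cst.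
by under eq_fun do rewrite big_cons; exact: momentsD.
Qed.

Lemma moments_integrable X : moments X -> mu.-integrable setT (EFin \o X).
Proof.
move=> [mX /(_ 1%N) X1]; apply/integrableP; split; first exact/measurable_EFinP.
by under eq_integral do rewrite /= -[X in X%:E]expr1.
Qed.

Lemma measurable_norm_rV n (V : T -> 'rV[R]_n) : measurable_fun setT V ->
  measurable_fun setT (fun t => `|V t|%R).
Proof.
move=> mV; apply: (measurableT_comp (f := fun x : 'rV[R]_n => `|x|%R)) => //.
by apply: continuous_measurable_rV => x; exact: norm_continuous.
Qed.

Lemma moments_norm_rV n (V : T -> 'rV[R]_n) :
  (forall i, moments (fun t => V t ord0 i)) -> measurable_fun setT V ->
  moments (fun t => `|V t|%R).
Proof.
move=> Vi mV; apply: (@moments_le _ (fun t => \sum_i V t ord0 i ^+ 2 + 1)%R).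
- exact: measurable_norm_rV.
- move=> t; rewrite normr_id ger0_norm; last first.
    by rewrite addr_ge0// sumr_ge0// => i _; rewrite sqr_ge0.
  apply: norm_rV_le.
    by rewrite addr_ge0// sumr_ge0// => i _; rewrite sqr_ge0.
  move=> i; rewrite (bigD1 i)//=.
  have : (0 <= \sum_(j < n | j != i) V t ord0 j ^+ 2)%R.
    by apply: sumr_ge0 => j _; rewrite sqr_ge0.
  move: (\sum_(_ | _) _)%R => S S0.
  rewrite -(real_normK (num_real (V t ord0 i))).
  by have := sqr_ge0 (`|V t ord0 i| - 1); rewrite !expr2; nra.
- by apply: momentsD; [apply: moments_sum => i; exact: momentsX|exact: moments_cst].
Qed.

End moments.

Section moments_product.
Local Open Scope ereal_scope.
Context d1 d2 (T1 : measurableType d1) (T2 : measurableType d2) (R : realType).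
Variables (mu1 : probability T1 R) (mu2 : probability T2 R).

Lemma moments_fst X : moments mu1 X -> moments (mu1 \x mu2) (X \o fst).
Proof.
move=> [mX Xp]; split; first exact: measurableT_comp.
move=> p; rewrite fubini_tonelli1//=; last first.
- by apply: (@measurable_normX _ _ _ p (X \o fst)); exact: measurableT_comp.
apply: le_lt_trans (Xp p); rewrite le_eqVlt; apply/orP; left; apply/eqP/eq_integral => t _.
by rewrite /fubini_F/= integral_cst//= [X in _ * X]probability_setT mule1.
Qed.

Lemma moments_snd X : moments mu2 X -> moments (mu1 \x mu2) (X \o snd).
Proof.
move=> [mX Xp]; split; first exact: measurableT_comp.
move=> p; rewrite fubini_tonelli1//=; last first.
- by apply: (@measurable_normX _ _ _ p (X \o snd)); exact: measurableT_comp.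
rewrite (_ : (fun _ => _) = cst (\int[mu2]_t (`|X t| ^+ p)%:E))//.
by rewrite integral_cst//= [X in _ * X]probability_setT mule1; exact: Xp.
Qed.

End moments_product.

Section gauss.
Local Open Scope ereal_scope.
Variable R : realType.

(** The same recursion on the first coordinate as for [lebesgue_rV]. *)
Fixpoint gauss_rV (n : nat) : probability 'rV[R]_n R :=
  if n is k.+1 then
    distribution (normal_prob (0:R) 1 \x gauss_rV k)%E (mfun_of (@measurable_rV_cons R k))
  else \d_(0%R : 'rV[R]_0).

Lemma ge0_integral_gauss_cons n (g : 'rV[R]_n.+1 -> \bar R) :
  measurable_fun setT g -> (forall x, 0 <= g x) ->
  \int[gauss_rV n.+1]_x g x =
  \int[normal_prob (0:R) 1]_x \int[gauss_rV n]_z g (rV_cons (x, z)).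
Proof.
move=> mg g0; rewrite /= ge0_integral_pushforward//=; last first.
  exact: measurable_rV_cons.
rewrite preimage_setT fubini_tonelli1//=.
by apply: measurableT_comp => //; exact: measurable_rV_cons.
Qed.

Lemma ge0_integral_gauss0 (g : 'rV[R]_0 -> \bar R) :
  measurable_fun setT g -> \int[gauss_rV 0]_x g x = g 0%R.
Proof. by move=> mg; rewrite /= integral_dirac// diracT mul1e. Qed.

Lemma gauss_box n (B : 'I_n -> set R) : (forall i, measurable (B i)) ->
  gauss_rV n (box B) = \prod_(i < n) normal_prob 0%R 1%R (B i).
Proof.
elim: n B => [|n IH] B mB.
  by rewrite big_ord0 /= diracE mem_set//=; case.
rewrite big_ord_recl -IH//= /distribution /pushforward.
transitivity ((normal_prob (0:R) 1 \x gauss_rV n)%E (B ord0 `*`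
  box (fun i => B (lift ord0 i)))).
  congr (_ _); apply/seteqP; split => z /=.
    move=> Bz; split; first by have := Bz ord0; rewrite rV_cons_head.
    by move=> i; have := Bz (lift ord0 i); rewrite rV_cons_tail.
  case=> B0 BS j; case: (unliftP ord0 j) => [i|] ->.
    by rewrite rV_cons_tail; exact: BS.
  by rewrite rV_cons_head.
rewrite product_measure1E//; first exact: mB.
by apply: measurable_box => i; exact: mB.
Qed.

Lemma ge0_integral_normal_prob (m s : R) (g : R -> \bar R) :
  measurable_fun setT g -> (forall x, 0 <= g x) ->
  \int[normal_prob m s]_x g x =
  \int[lebesgue_measure]_x (g x * (normal_pdf m s x)%:E).
Proof.
move=> mg g0.
have mp : measurable_fun [set: measurableTypeR R] (EFin \o normal_pdf m s).
  by apply/measurable_EFinP; exact: measurable_normal_pdf.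
have p0 (x : measurableTypeR R) : 0 <= (EFin \o normal_pdf m s) x.
  by rewrite lee_fin normal_pdf_ge0.
rewrite -(@ge0_integral_density _ _ _ (@lebesgue_measure R) _ mp p0)//.
Qed.

Definition gauss_pdf n (x : 'rV[R]_n) : R := (\prod_i normal_pdf 0 1 (x ord0 i))%R.

Lemma gauss_pdf_ge0 n (x : 'rV[R]_n) : (0 <= gauss_pdf x)%R.
Proof. by apply: prodr_ge0 => i _; exact: normal_pdf_ge0. Qed.

Lemma continuous_gauss_pdf n : continuous (@gauss_pdf n).
Proof.
apply: continuous_prod => i.
refine (@cont_comp _ _ _ (@rV_coord R n i) _ _ _).
  exact: continuous_rV_coord.
exact: continuous_normal_pdf.
Qed.

Lemma ge0_integral_gauss n (g : 'rV[R]_n -> \bar R) :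
  measurable_fun setT g -> (forall x, 0 <= g x) ->
  \int[gauss_rV n]_x g x =
  \int[lebesgue_rV R n]_x (g x * (gauss_pdf x)%:E).
Proof.
have mp k : measurable_fun setT (fun x : 'rV[R]_k => (gauss_pdf x)%:E).
  apply/measurable_EFinP; apply: continuous_measurable_rV.
  exact: continuous_gauss_pdf.
elim: n g => [|n IH] g mg g0.
  rewrite ge0_integral_gauss0// ge0_integral_lebesgue_rV0; last exact: (emeasurable_funM mg (mp 0%N)).
  by rewrite /gauss_pdf big_ord0 mule1.
rewrite ge0_integral_gauss_cons// ge0_integral_lebesgue_cons; last 2 first.
- exact: (emeasurable_funM mg (mp n.+1)).
- by move=> x; rewrite mule_ge0// lee_fin gauss_pdf_ge0.
have mgc : measurable_fun setT (g \o @rV_cons R n).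
  by apply: measurableT_comp => //; exact: measurable_rV_cons.
rewrite ge0_integral_normal_prob; last 2 first.
- by apply: (measurable_fun_fubini_tonelli_F (m2 := gauss_rV n)
    (g \o @rV_cons R n)) => // z; exact: g0.
- by move=> x; exact: integral_ge0.
apply: eq_integral => x _.
have mgx : measurable_fun setT (fun z => g (rV_cons (x, z))).
  exact: measurableT_comp mg (measurable_consr _).
rewrite IH//.
rewrite -ge0_integralZr//; last 3 first.
- exact: (emeasurable_funM mgx (mp n)).
- by move=> z _; rewrite mule_ge0// lee_fin gauss_pdf_ge0.
- by rewrite lee_fin normal_pdf_ge0.
apply: eq_integral => z _; rewrite -muleA; congr (_ * _).
rewrite -EFinM; congr (_%:E).
rewrite /gauss_pdf big_ord_recl rV_cons_head mulrC; congr (_ * _)%R.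
by apply: eq_bigr => i _; rewrite rV_cons_tail.
Qed.

End gauss.

(** * Stability and resampling of the Gaussian measure *)

Section gauss_scale.
Variable R : realType.

Lemma normal_peak_scale (s : R) : 0 < s -> normal_peak s = normal_peak 1 / s.
Proof.
move=> s0; rewrite /normal_peak expr1n mul1r -invfM; congr (_^-1).
rewrite -mulrnAr sqrtrM ?sqr_ge0// sqrtr_sqr gtr0_norm// mulrC.
by congr (_ * _).
Qed.

Lemma normal_pdf_scale (s x : R) : 0 < s ->
  normal_pdf 0 s (s * x) * s = normal_pdf 0 1 x.
Proof.
move=> s0; rewrite !normal_pdfE ?gt_eqF// (normal_peak_scale s0).
rewrite /normal_fun !subr0 expr1n mulrAC divfK ?gt_eqF//; congr (_ * expR _).
have s0' : s != 0 by rewrite gt_eqF.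
by field.
Qed.

(** Completing the square: the joint density of [x] and [u = a x + b y] is the
    density of [u] times that of [x] given [u]. *)
Lemma normal_pdf_conv (a b x u : R) : 0 < a -> 0 < b ->
  let c := Num.sqrt (a ^+ 2 + b ^+ 2) in
  normal_pdf 0 1 x * (normal_pdf 0 1 ((u - a * x) / b) / b) =
  normal_pdf 0 c u * normal_pdf (a * u / c ^+ 2) (b / c) x.
Proof.
move=> a0 b0 c.
have c2 : c ^+ 2 = a ^+ 2 + b ^+ 2.
  by rewrite sqr_sqrtr// addr_ge0// sqr_ge0.
have c0 : 0 < c by rewrite sqrtr_gt0 ltr_pwDl ?exprn_gt0// sqr_ge0.
have bc0 : 0 < b / c by rewrite divr_gt0.
rewrite !normal_pdfE ?gt_eqF// (normal_peak_scale c0) (normal_peak_scale bc0).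
rewrite /normal_fun !subr0 expr1n.
set K := normal_peak 1.
have b0' : b != 0 by rewrite gt_eqF.
have c0' : c != 0 by rewrite gt_eqF.
have E : expR (- x ^+ 2 / (1 *+ 2)) * expR (- ((u - a * x) / b) ^+ 2 / (1 *+ 2)) =
  expR (- u ^+ 2 / (c ^+ 2 *+ 2)) *
  expR (- (x - a * u / c ^+ 2) ^+ 2 / ((b / c) ^+ 2 *+ 2)).
  rewrite -!expRD; congr expR.
  have a2 : a ^+ 2 = c ^+ 2 - b ^+ 2 by rewrite c2 addrK.
  have e1 : (u - a * x) ^+ 2 =
      u ^+ 2 - 2 * (a * u) * x + (c ^+ 2 - b ^+ 2) * x ^+ 2 by rewrite -a2; ring.
  have e2 : (x - a * u / c ^+ 2) ^+ 2 =
      x ^+ 2 - 2 * (a * u) * x / c ^+ 2 + (c ^+ 2 - b ^+ 2) * u ^+ 2 / c ^+ 4.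
    by rewrite -a2; field.
  by rewrite expr_div_n e1 e2; field; rewrite c0' b0'.
transitivity (K ^+ 2 / b * (expR (- x ^+ 2 / (1 *+ 2)) *
   expR (- ((u - a * x) / b) ^+ 2 / (1 *+ 2)))); first by field.
by rewrite E; field; rewrite c0' b0'.
Qed.

Local Open Scope ereal_scope.

Let is_derive_affine (a b x : R) :
  is_derive x (1 : R)%R (fun t => a * t + b)%R a.
Proof.
have := @is_derive_secant R (fun t => a * t + b)%R (fun=> a) x.
by apply => [t|]; [ring|exact: cont_cst].
Qed.

Lemma ge0_integral_affine (a b : R) (g : R -> \bar R) : (0 < a)%R ->
  measurable_fun setT g -> (forall x, 0 <= g x) ->
  \int[lebesgue_measure]_x (g (a * x + b)%R * a%:E) =
  \int[lebesgue_measure]_x g x.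
Proof.
move=> a0 mg g0.
apply: (@ge0_integral_substitution R (fun x => a * x + b)%R (fun=> a) g) => //.
- by move=> x; exact: cvg_cst.
- by move=> y; exists ((y - b) / a)%R; rewrite mulrC divfK ?gt_eqF// subrK.
Qed.

Lemma ge0_integral_normal_scale (s : R) (g : R -> \bar R) : (0 < s)%R ->
  measurable_fun setT g -> (forall x, 0 <= g x) ->
  \int[normal_prob 0%R s]_x g x = \int[normal_prob (0:R) 1]_x g (s * x)%R.
Proof.
move=> s0 mg g0.
have mgs : measurable_fun setT (fun x => g (s * x)%R).
  by apply: measurableT_comp => //; exact: measurable_funM.
rewrite (ge0_integral_normal_prob 0 s mg g0).
rewrite (ge0_integral_normal_prob 0 1 mgs (fun x => g0 _)).
have mgp : measurable_fun setT (fun x => g x * (normal_pdf 0 s x)%:E).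
  apply: emeasurable_funM => //.
  by apply/measurable_EFinP; exact: measurable_normal_pdf.
rewrite -[LHS](ge0_integral_affine 0%R s0 mgp); last first.
  by move=> x; rewrite mule_ge0// lee_fin normal_pdf_ge0.
by apply: eq_integral => x _; rewrite addr0 -muleA -EFinM normal_pdf_scale.
Qed.

Lemma measurable_lin2 (a b : R) : measurable_fun setT
  (fun z : measurableTypeR R * measurableTypeR R => a * z.1 + b * z.2 :
    measurableTypeR R)%R.
Proof. by apply: measurable_funD; exact: measurable_funM. Qed.

(** Integrate the density identity [normal_pdf_conv] in the variable that the
    test function does not see. *)
Lemma normal_stable (a b : R) (g : R -> \bar R) : (0 < a)%R -> (0 < b)%R ->
  measurable_fun setT g -> (forall x, 0 <= g x) ->
  \int[normal_prob (0:R) 1]_x \int[normal_prob (0:R) 1]_y g (a * x + b * y)%R =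
  \int[normal_prob (0:R) 1]_z g (Num.sqrt (a ^+ 2 + b ^+ 2) * z)%R.
Proof.
move=> a0 b0 mg g0; set c := Num.sqrt _.
have c0 : (0 < c)%R by rewrite sqrtr_gt0 ltr_pwDl ?exprn_gt0// sqr_ge0.
have mp m s : measurable_fun [set: measurableTypeR R] (EFin \o normal_pdf m s).
  by apply/measurable_EFinP; exact: measurable_normal_pdf.
have mpdf d (T : measurableType d) (h : T -> R) m s : measurable_fun setT h ->
    measurable_fun setT (fun t => (normal_pdf m s (h t))%:E).
  by move=> mh; apply: (measurableT_comp (mp m s)).
have p0 m s (x : R) : 0 <= (normal_pdf m s x)%:E by rewrite lee_fin normal_pdf_ge0.
rewrite -[RHS](ge0_integral_normal_scale c0 mg g0).
rewrite (ge0_integral_normal_prob 0 c mg g0).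
have mI : measurable_fun [set: measurableTypeR R]
    (fun x => \int[normal_prob (0:R) 1]_y g (a * x + b * y)%R).
  apply: (measurable_fun_fubini_tonelli_F (m2 := normal_prob (0:R) 1)
    (fun z : measurableTypeR R * measurableTypeR R => g (a * z.1 + b * z.2)%R)) => //.
  exact: measurableT_comp mg (measurable_lin2 a b).
rewrite (ge0_integral_normal_prob 0 1 mI); last first.
  by move=> x; exact: integral_ge0.
pose F (z : measurableTypeR R * measurableTypeR R) :=
  g z.2 * ((normal_pdf 0 1 z.1)%:E * ((normal_pdf 0 1 ((z.2 - a * z.1) / b))%:E
    * (b^-1)%:E)).
have F0 z : 0 <= F z.
  by rewrite /F !mule_ge0// lee_fin invr_ge0 ltW.
have mF : measurable_fun setT F.
  apply: emeasurable_funM; first exact: measurableT_comp.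
  apply: emeasurable_funM; first exact: mpdf.
  apply: emeasurable_funM => //; apply: mpdf; apply: measurable_funM => //.
  by apply: measurable_funB => //; exact: measurable_funM.
transitivity (\int[lebesgue_measure]_x \int[lebesgue_measure]_u F (x, u)).
  apply: eq_integral => x _.
  have mgx : measurable_fun setT (fun y => g (a * x + b * y)%R).
    by apply: measurableT_comp => //; apply: measurable_funD => //.
  rewrite (ge0_integral_normal_prob 0 1 mgx (fun y => g0 _)).
  rewrite -ge0_integralZr//; last 2 first.
  - exact: (emeasurable_funM mgx (mp 0%R 1%R)).
  - by move=> y _; rewrite mule_ge0.
  have mFx : measurable_fun setT (fun u => F (x, u)).
    exact: measurableT_comp mF (measurable_pair1 _).
  rewrite -[RHS](ge0_integral_affine (a * x)%R b0 mFx); last first.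
    by move=> u; exact: F0.
  apply: eq_integral => y _; rewrite /F /=.
  have -> : ((b * y + a * x - a * x) / b = y)%R by field; rewrite gt_eqF.
  rewrite (addrC (b * y)%R) -!muleA; congr (_ * _).
  by rewrite -(EFinM b^-1) mulVf ?gt_eqF// mule1 muleC.
rewrite (fubini_tonelli F)//; apply: eq_integral => u _.
transitivity (\int[lebesgue_measure]_x
   (g u * (normal_pdf 0 c u)%:E * (normal_pdf (a * u / c ^+ 2) (b / c) x)%:E)).
  apply: eq_integral => x _; rewrite /F /= -muleA -!EFinM; congr (_ * _%:E).
  exact: normal_pdf_conv.
rewrite ge0_integralZl//; last 2 first.
- exact: mpdf.
- by rewrite mule_ge0.
by rewrite integral_normal_pdf mule1.
Qed.

Lemma measurable_lin2_rV n (a b : R) :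
  measurable_fun setT (fun z : 'rV[R]_n * 'rV[R]_n => a *: z.1 + b *: z.2)%R.
Proof. by apply: measurable_addrV; exact: measurable_scalerV. Qed.

(** The coordinates are independent, so the claim reduces to dimension one. *)
Lemma gauss_stable n (a b : R) (g : 'rV[R]_n -> \bar R) :
  (0 < a)%R -> (0 < b)%R -> measurable_fun setT g -> (forall x, 0 <= g x) ->
  \int[gauss_rV R n]_x \int[gauss_rV R n]_y g (a *: x + b *: y)%R =
  \int[gauss_rV R n]_z g (Num.sqrt (a ^+ 2 + b ^+ 2) *: z)%R.
Proof.
move=> a0 b0; set c := Num.sqrt _; elim: n g => [|n IH] g mg g0.
  have g1 h : measurable_fun setT (fun z => g (h z)) ->
     \int[gauss_rV R 0]_z g (h z) = g 0%R.
    move=> mh; rewrite ge0_integral_gauss0//; congr g; by apply/rowP => -[].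
  rewrite (_ : (fun x => _) = cst (g 0%R)); last first.
    apply/funext => x; rewrite (g1 (fun y => a *: x + b *: y)%R)//.
    by apply: measurableT_comp => //; apply: measurable_addrV => //;
      exact: measurable_scalerV.
  rewrite ge0_integral_gauss0// (g1 (fun z => c *: z)%R)//.
  by apply: measurableT_comp => //; exact: measurable_scalerV.
have consZ (t x : R) (z : 'rV[R]_n) : (t *: rV_cons (x, z) = rV_cons (t * x, t *: z))%R.
  apply/rowP => j; rewrite mxE.
  by case: (unliftP ord0 j) => [i|] ->; rewrite ?rV_cons_tail ?rV_cons_head//= mxE.
have mgc : measurable_fun setT (g \o @rV_cons R n).
  by apply: measurableT_comp => //; exact: measurable_rV_cons.
pose G (x : measurableTypeR R * 'rV[R]_n) (y : measurableTypeR R * 'rV[R]_n) :=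
  g (rV_cons (a * x.1 + b * y.1, a *: x.2 + b *: y.2))%R.
have mG d (T : measurableType d) (x1 y1 : T -> R) (x2 y2 : T -> 'rV[R]_n) :
   measurable_fun setT x1 -> measurable_fun setT y1 ->
   measurable_fun setT x2 -> measurable_fun setT y2 ->
   measurable_fun setT (fun t => G (x1 t, x2 t) (y1 t, y2 t)).
  move=> m1 m2 m3 m4; apply: (measurableT_comp mgc).
  apply: measurable_fun_pair.
    by apply: measurable_funD; exact: measurable_funM.
  by apply: measurable_addrV; exact: measurable_scalerV.
have G0 x y : 0 <= G x y by exact: g0.
have mg2 : measurable_fun setT
    (fun z : 'rV[R]_n.+1 * 'rV[R]_n.+1 => g (a *: z.1 + b *: z.2)%R).
  exact: measurableT_comp mg (@measurable_lin2_rV n.+1 a b).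
have mI : measurable_fun setT
    (fun x : 'rV[R]_n.+1 => \int[gauss_rV R n.+1]_y g (a *: x + b *: y)%R) :=
  measurable_fun_fubini_tonelli_F (m2 := gauss_rV R n.+1)
  (fun z : 'rV[R]_n.+1 * 'rV[R]_n.+1 => g (a *: z.1 + b *: z.2)%R)
  mg2 (fun z => g0 _).
rewrite (ge0_integral_gauss_cons mI); last by move=> x; exact: integral_ge0.
transitivity (\int[normal_prob (0:R) 1]_x1 \int[gauss_rV R n]_x2
   \int[normal_prob (0:R) 1]_y1 \int[gauss_rV R n]_y2 G (x1, x2) (y1, y2)).
  apply: eq_integral => x1 _; apply: eq_integral => x2 _.
  have mgx : measurable_fun setT
      (fun y : 'rV[R]_n.+1 => g (a *: rV_cons (x1, x2) + b *: y)%R) :=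
    measurableT_comp mg2 (measurable_pair1 (rV_cons (x1, x2))).
  rewrite /fubini_F/= (ge0_integral_gauss_cons mgx (fun y => g0 _)).
  apply: eq_integral => y1 _; apply: eq_integral => y2 _.
  by rewrite !consZ rV_consD.
have mcz : measurable_fun setT (fun z : 'rV[R]_n.+1 => g (c *: z)%R).
  by apply: measurableT_comp => //; exact: measurable_scalerV.
rewrite [RHS](ge0_integral_gauss_cons mcz (fun z => g0 _)).
pose h (u : R) := \int[gauss_rV R n]_z g (rV_cons (u, c *: z))%R.
have h0 u : 0 <= h u by exact: integral_ge0.
have mh : measurable_fun setT h.
  apply: (measurable_fun_fubini_tonelli_F (m2 := gauss_rV R n)
    (fun z : measurableTypeR R * 'rV[R]_n => g (rV_cons (z.1, c *: z.2))%R)) => //.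
  apply: (measurableT_comp mgc); apply: measurable_fun_pair => //.
  exact: measurable_scalerV.
rewrite -[RHS](_ : \int[normal_prob (0:R) 1]_x h (c * x)%R = _); last first.
  by apply: eq_integral => x _; apply: eq_integral => z _; rewrite consZ.
rewrite -(normal_stable a0 b0 mh h0).
apply: eq_integral => x1 _.
rewrite (fubini_tonelli (m1 := gauss_rV R n) (m2 := normal_prob (0:R) 1)
  (fun z : 'rV[R]_n * measurableTypeR R =>
    \int[gauss_rV R n]_y2 G (x1, z.1) (z.2, y2)))/=; last 2 first.
- apply: (measurable_fun_fubini_tonelli_F (m2 := gauss_rV R n)
    (fun z : ('rV[R]_n * measurableTypeR R) * 'rV[R]_n =>
       G (x1, z.1.1) (z.1.2, z.2))) => //.
  apply: mG => //; exact: measurableT_comp.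
- by move=> z; exact: integral_ge0.
apply: eq_integral => y1 _.
rewrite (IH (fun z => g (rV_cons (a * x1 + b * y1, z)%R)))//.
exact: measurableT_comp mg (measurable_consr _).
Qed.

(** A power is dominated by an exponential of a small multiple of [x^2], at the
    price of doubling the standard deviation. *)
Lemma normal_pdf_moment (p : nat) : exists2 C : R, (0 <= C)%R &
  forall x : R, (`|x| ^+ p * normal_pdf 0 1 x <= C * normal_pdf 0 2 x)%R.
Proof.
pose k : R := (4 * p.+1%:R)%R.
have k0 : (0 < k)%R by rewrite mulr_gt0.
exists (k ^+ p * (normal_peak 1 / normal_peak 2))%R.
  by rewrite mulr_ge0 ?exprn_ge0 ?divr_ge0 ?normal_peak_ge0// ltW.
move=> x; rewrite !normal_pdfE// /normal_fun !subr0.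
have p2 : (0 < normal_peak 2 :> R)%R by exact: normal_peak_gt0.
rewrite [leRHS](_ : _ = k ^+ p * normal_peak 1 *
  expR (- x ^+ 2 / (2 ^+ 2 *+ 2)))%R; last first.
  by field; rewrite gt_eqF.
rewrite mulrCA -(mulrA (_ ^+ _)%R) [leRHS]mulrCA ler_wpM2l ?normal_peak_ge0//.
have xk : (`|x| <= k * expR (x ^+ 2 / k))%R.
  apply: (@le_trans _ _ (k * (1 + x ^+ 2 / k))%R).
    rewrite mulrDr mulr1 mulrCA divff ?gt_eqF// mulr1.
    have := sqr_ge0 (`|x| - 1)%R; have := real_normK (num_real x).
    have : (4 <= k)%R by rewrite /k ler_peMr// ler1n.
    by rewrite !expr2 => ? <-; nra.
  by rewrite ler_pM2l// expR_ge1Dx.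
apply: (@le_trans _ _ ((k * expR (x ^+ 2 / k)) ^+ p *
    expR (- x ^+ 2 / (1 ^+ 2 *+ 2)))%R).
  by rewrite ler_wpM2r ?expR_ge0// lerXn2r ?nnegrE// mulr_ge0 ?expR_ge0// ltW.
rewrite exprMn -mulrA ler_wpM2l ?exprn_ge0 ?(ltW k0)//.
rewrite -expRM_natl -expRD ler_expR.
have : (p%:R * (x ^+ 2 / k) <= x ^+ 2 / 4)%R.
  rewrite mulrCA ler_wpM2l ?sqr_ge0// ler_pdivrMr// /k mulrA mulVf ?mul1r//.
  by rewrite ler_nat.
have := sqr_ge0 x; rewrite expr1n; move: (_ * _)%R => A; nra.
Qed.

Lemma moments_normal : moments (normal_prob (0:R) 1) id.
Proof.
split=> // p.
have [C C0 xC] := normal_pdf_moment p.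
have mp s : measurable_fun [set: measurableTypeR R] (EFin \o normal_pdf 0 s).
  by apply/measurable_EFinP; exact: measurable_normal_pdf.
have mx : measurable_fun [set: measurableTypeR R] (fun x : R => (`|x| ^+ p)%:E).
  by apply: measurable_normX.
rewrite (ge0_integral_normal_prob 0 1 mx)//.
apply: (@le_lt_trans _ _ (\int[lebesgue_measure]_x (C%:E * (normal_pdf 0 2 x)%:E))).
  apply: ge0_le_integral => //.
  - by move=> x _; rewrite mule_ge0// lee_fin normal_pdf_ge0.
  - exact: (emeasurable_funM mx (mp 1%R)).
  - exact: (measurable_funeM _ (mp 2%R)).
  - by move=> x _; rewrite -!EFinM lee_fin.
rewrite ge0_integralZl//; [|exact: (mp 2%R)|].
  by rewrite integral_normal_pdf mule1 ltry.
by move=> x _; rewrite lee_fin normal_pdf_ge0.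
Qed.

Lemma moments_gauss n i : moments (gauss_rV R n) (fun z => z ord0 i).
Proof.
elim: n i => [|n IH] i; first by case: i.
have mi : measurable_fun setT (fun z : 'rV[R]_n.+1 => z ord0 i).
  exact: (measurable_rV_coord i).
split=> // p; rewrite ge0_integral_gauss_cons//; last exact: measurable_normX.
have [_ /(_ p) fin] : moments (normal_prob (0:R) 1 \x gauss_rV R n)
    (fun z => rV_cons z ord0 i).
  case: (unliftP ord0 i) => [j|] ->.
    under eq_fun do rewrite rV_cons_tail; exact: (moments_snd _ (IH j)).
  under eq_fun do rewrite rV_cons_head; exact: (moments_fst _ moments_normal).
rewrite fubini_tonelli1//= in fin.
apply: measurable_normX; apply: (measurable_coord i).
exact: measurable_rV_cons.
Qed.

Definition merge_rV m n (f : 'I_m -> 'I_n) (u : 'rV[R]_m) (z : 'rV[R]_n) :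
    'rV[R]_n :=
  (\row_k if [pick i | f i == k] is Some i then u ord0 i else z ord0 k)%R.

Lemma measurable_merge m n (f : 'I_m -> 'I_n) : measurable_fun setT
  (fun z : 'rV[R]_n * 'rV[R]_m => merge_rV f z.2 z.1).
Proof.
apply: measurable_fun_rV => k.
rewrite (_ : _ \o _ = fun z : 'rV[R]_n * 'rV[R]_m => if [pick i | f i == k] is Some i
  then z.2 ord0 i else z.1 ord0 k); last first.
  by apply/funext => z; rewrite /= /rV_coord mxE.
by case: pickP => [i _|_]; exact: measurable_coord.
Qed.

(** Replacing some coordinates by fresh independent ones does not change the
    law: on a box, both measures are products over the coordinates. *)
Lemma ge0_integral_gauss_merge m n (f : 'I_m -> 'I_n) (g : 'rV[R]_n -> \bar R) :
  injective f -> measurable_fun setT g -> (forall x, 0 <= g x) ->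
  \int[gauss_rV R n]_z g z =
  \int[gauss_rV R n]_z \int[gauss_rV R m]_u g (merge_rV f u z).
Proof.
move=> finj mg g0.
have mm := measurable_merge f.
have := @ge0_integral_pushforward _ _ _ _ R _ mm (gauss_rV R n \x gauss_rV R m)
  setT g measurableT mg (fun y _ => g0 y).
rewrite preimage_setT fubini_tonelli1/=; last 2 first.
- exact: measurableT_comp.
- by move=> z; exact: g0.
move=> <-; apply: (@eq_measure_integral _ _ _ _ (pushm (gauss_rV R n \x gauss_rV R m) mm)).
move=> A mA _; apply: (@rV_measure_unique_box R n (gauss_rV R n) _ _ _ A mA).
  move=> k; apply: (@le_lt_trans _ _ 1); last exact: ltry.
  by apply: probability_le1; apply: measurable_box => i; exact: measurable_itv.
move=> B mB; apply/esym.
transitivity (\prod_(i < n) normal_prob (0:R) 1 (B i)); last exact/esym/gauss_box.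
rewrite /pushm /= /pushforward.
pose B' k := if k \in codom f then setT else B k.
have mB' k : measurable (B' k) by rewrite /B'; case: ifP.
transitivity ((gauss_rV R n \x gauss_rV R m)%E (box B' `*` box (fun i => B (f i)))).
  congr (_ _); apply/seteqP; split => -[z u] /=.
    move=> Bz; split => k.
      rewrite /B'; case: ifP => // /negbT kf; have := Bz k; rewrite mxE.
      by case: pickP => // i /eqP fik; rewrite -fik codom_f in kf.
    have := Bz (f k); rewrite mxE; case: pickP => [i /eqP/finj ->//|/(_ k)].
    by rewrite eqxx.
  move=> [Bz Bu] k; rewrite mxE; case: pickP => [i /eqP <-//|fk].
  have := Bz k; rewrite /B'; case: ifP => // /codomP[i ki].
  by have := fk i; rewrite ki eqxx.
rewrite product_measure1E//; last 2 first.
- exact: measurable_box.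
- by apply: measurable_box => i; exact: mB.
transitivity ((\prod_(k < n) normal_prob (0:R) 1 (B' k)) *
    (\prod_(i < m) normal_prob (0:R) 1 (B (f i)))).
  by congr (_ * _); apply: gauss_box => // i; exact: mB.
rewrite [RHS](bigID (fun k => k \in codom f))/= [RHS]muleC; congr (_ * _).
  rewrite (bigID (fun k => k \in codom f))/= big1 ?mul1e.
    by apply: eq_bigr => k; rewrite /B' => /negbTE ->.
  by move=> k; rewrite /B' => ->; exact: probability_setT.
transitivity (\prod_(k in [set f i | i in [set: 'I_m]]%SET)
    normal_prob (0:R) 1 (B k)).
  rewrite big_imset/=; last by move=> i j _ _; exact: finj.
  by apply: eq_bigl => i; rewrite inE.
rewrite big_mkcond [RHS]big_mkcond; apply: eq_bigr => k _.
congr (if _ then _ else _).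
by apply/imsetP/codomP => [[i _ ->]|[i ->]]; exists i.
Qed.

End gauss_scale.

(** * Averages over the unit interval *)

Section calculus01.
Variable R : realType.

Definition I01 (f : R -> R) : R :=
  (\int[lebesgue_measure]_(t in `[0, 1]) f t)%R.

Lemma integrable01 (f : R -> R) : continuous f ->
  (@lebesgue_measure R).-integrable `[0, 1] (EFin \o f).
Proof.
move=> cf; apply: continuous_compact_integrable; first exact: segment_compact.
exact: continuous_subspaceT.
Qed.

Lemma I01D (f g : R -> R) : continuous f -> continuous g ->
  I01 (fun t => f t + g t) = I01 f + I01 g.
Proof. by move=> cf cg; apply: RintegralD => //; exact: integrable01. Qed.

Lemma I01B (f g : R -> R) : continuous f -> continuous g ->
  I01 (fun t => f t - g t) = I01 f - I01 g.
Proof. by move=> cf cg; apply: RintegralB => //; exact: integrable01. Qed.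

Lemma I01Z (c : R) (f : R -> R) : continuous f ->
  I01 (fun t => c * f t) = c * I01 f.
Proof. by move=> cf; apply: RintegralZl => //; exact: integrable01. Qed.

Lemma I01_cst (c : R) : I01 (fun=> c) = c.
Proof.
rewrite /I01 Rintegral_cst//= lebesgue_measure_itv/= lte_fin ltr01.
by rewrite oppr0 adde0 mulr1.
Qed.

Lemma le_I01 (f g : R -> R) : continuous f -> continuous g ->
  (forall t, 0 <= t <= 1 -> f t <= g t) -> I01 f <= I01 g.
Proof.
move=> cf cg fg; apply: le_Rintegral => //; try exact: integrable01.
Qed.

Lemma I01_sum (I : finType) (f : I -> R -> R) : (forall i, continuous (f i)) ->
  I01 (fun t => \sum_i f i t) = \sum_i I01 (f i).
Proof.
move=> cf; elim: (index_enum I) => [|i s IH].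
  by rewrite big_nil -[RHS](I01_cst 0); congr I01; apply/funext => t; rewrite big_nil.
rewrite big_cons -IH -I01D//.
  by congr I01; apply/funext => t; rewrite big_cons.
elim: s {IH} => [|j s IH]; first by under eq_fun do rewrite big_nil; exact: cont_cst.
by under eq_fun do rewrite big_cons; exact: cont_add.
Qed.

Lemma norm_I01_le (f : R -> R) (M : R) : continuous f ->
  (forall t, 0 <= t <= 1 -> `|f t| <= M) -> `|I01 f| <= M.
Proof.
move=> cf fM; rewrite ler_norml -[X in - X](I01_cst M) -{2}(I01_cst M).
rewrite -mulN1r -I01Z; last exact: cont_cst.
by apply/andP; split; apply: le_I01 => //; try exact: cont_cst; move=> t /fM;
  rewrite ler_norml ?mulN1r => /andP[].
Qed.

(** The unit interval is compact, so continuity in the parameter is uniform in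
    the integration variable. *)
Lemma cont_I01 (Z : topologicalType) (f : R -> Z -> R) :
  continuous (fun z : R * Z => f z.1 z.2) -> continuous (fun z => I01 (f ^~ z)).
Proof.
move=> cf z0.
have cfz z : continuous (f ^~ z).
  refine (@cont_comp _ _ _ (fun t : R => (t, z)) _ _ cf).
  by apply: cont_pair; [exact: cont_id|move=> t; exact: cvg_cst].
apply/cvgrPdist_le => e e0.
have /compact_near_coveringP cov := @segment_compact R 0 1.
have : \forall z \near z0, `[0, 1]%classic `<=` (fun t => `|f t z0 - f t z| <= e).
  apply: (cov _ (nbhs z0) (fun z t => `|f t z0 - f t z| <= e)) => t _.
  have e2 : 0 < e / 2 by rewrite divr_gt0.
  have /cvgrPdist_lt/(_ _ e2) := cf (t, z0).
  have /cvgrPdist_lt/(_ _ e2) := cfz z0 t.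
  move=> h1 [[A B] /= [nA nB] AB].
  exists ([set s | `|f t z0 - f s z0| < e / 2] `&` A, B) => /=.
    by split => //; exact: filterI.
  move=> [s z] /= [[h As] Bz].
  have hs : `|f t z0 - f s z| < e / 2 := AB (s, z) (conj As Bz).
  rewrite (le_trans (ler_distD (f t z0) _ _))// [leRHS]splitr.
  by apply: lerD; apply: ltW => //; rewrite distrC.
apply: filterS => z hz; rewrite -I01B//.
apply: norm_I01_le; first exact: cont_sub.
by move=> t t01; apply: hz; rewrite /= in_itv.
Qed.

Lemma FTC01 (f f' : R -> R) : (forall t, is_derive t (1 : R) f (f' t)) ->
  continuous f' -> I01 f' = f 1 - f 0.
Proof.
move=> df cf'.
have cf : continuous f.
  move=> x; apply: differentiable_continuous; apply/derivable1_diffP.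
  exact: ex_derive.
rewrite /I01 /Rintegral (@continuous_FTC2 _ f' f)//.
- exact: continuous_subspaceT.
- split.
  + by move=> x _; exact: ex_derive.
  + exact: cvg_at_right_filter (cf 0).
  + exact: cvg_at_left_filter (cf 1).
- by move=> x _; rewrite derive1E; exact: derive_val.
Qed.

(** A continuous difference quotient has the derivative as its value at 0. This
    is how averages along segments and expectations are differentiated. *)
Lemma is_derive_quotient n (f : 'rV[R]_n -> R) (y v : 'rV[R]_n) (q : R -> R) :
  (forall t, f (y + t *: v) - f y = t * q t) -> continuous q ->
  is_derive y v f (q 0).
Proof.
move=> fq cq.
have df : t^-1 *: (f (t *: v + y) - f y) @[t --> 0^'] --> q 0.
  have : q t @[t --> 0^'] --> q 0.
    by apply: (@cvg_within_filter _ _ _ (nbhs (0 : R))); exact: cq.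
  apply: cvg_trans; apply: near_eq_cvg; near=> t.
  have t0 : t != 0 by near: t; exact: nbhs_dnbhs_neq.
  by rewrite [t *: v + y]addrC fq [RHS]mulrA mulVf// mul1r.
split; first by apply/cvg_ex; exists (q 0).
exact/cvg_lim.
Unshelve. all: end_near. Qed.

Lemma is_derive_line n (f g : 'rV[R]_n -> R) (v : 'rV[R]_n) :
  (forall y, is_derive y v f (g y)) -> forall y (a t : R),
  is_derive t (1 : R) (fun s => f (y + (a * s) *: v)) (a * g (y + (a * t) *: v)).
Proof.
move=> df y a t.
pose phi s := f (y + s *: v).
have dphi s : is_derive s (1 : R) phi (g (y + s *: v)).
  have [df1 df2] := df (y + s *: v).
  have E : (fun h : R => h^-1 *: (phi (h *: (1 : R) + s) - phi s)) =
      (fun h : R => h^-1 *: (f (h *: v + (y + s *: v)) - f (y + s *: v))).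
    apply/funext => h; rewrite /phi; congr (_ *: (f _ - _)).
    by rewrite [h *: 1]mulr1 scalerDl addrCA.
  by split; rewrite ?/derivable /derive E.
have da : is_derive t (1 : R) (fun s : R => a * s) a.
  have := @is_derive_secant R (fun s => a * s) (fun=> a) t.
  by apply => [s|]; [ring|exact: cont_cst].
have := @is_derive1_comp R phi (fun s => a * s) t _ _ (dphi (a * t)) da.
by rewrite mulrC.
Qed.

Lemma increment_line n (f g : 'rV[R]_n -> R) (v : 'rV[R]_n) :
  (forall y, is_derive y v f (g y)) -> continuous g -> forall y a,
  f (y + a *: v) - f y = a * I01 (fun t => g (y + (a * t) *: v)).
Proof.
move=> df cg y a.
have cl : continuous (fun t : R => y + (a * t) *: v).
  apply: cont_add; first exact: cont_cst.
  apply: cont_scale; last exact: cont_cst.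
  by apply: cont_mul; [exact: cont_cst|exact: cont_id].
rewrite -I01Z; last exact: cont_comp cl cg.
rewrite (FTC01 (is_derive_line df y a)) ?mulr1 ?mulr0 ?scale0r ?addr0//.
by apply: cont_mul; [exact: cont_cst|exact: cont_comp cl cg].
Qed.

End calculus01.

(** * Functions with continuous partial derivatives *)

Section C1.
Variable R : realType.
Implicit Types (n : nat).

Local Notation e_ i := (delta_mx ord0 i).

(** Only the coordinate directions appear, because these are the derivatives
    that [smooth] speaks of; [has_grad_derive] recovers the other directions. *)
Definition has_grad n (f : 'rV[R]_n -> R) (g : 'I_n -> 'rV[R]_n -> R) :=
  (forall i y, is_derive y (e_ i : 'rV[R]_n) f (g i y)) /\ forall i, continuous (g i).

Lemma cont_line (T : topologicalType) n (y v : T -> 'rV[R]_n) (a : T -> R) :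
  continuous y -> continuous a -> continuous v ->
  continuous (fun t => y t + a t *: v t).
Proof. by move=> cy ca cv; apply: cont_add => //; exact: cont_scale. Qed.

(** Walk from [y] to [y + t v] along the coordinate axes one after the other:
    each leg contributes an average of one continuous partial derivative. *)
Lemma has_grad_derive n (f : 'rV[R]_n -> R) g : has_grad f g ->
  forall y v, is_derive y v f (\sum_i v ord0 i * g i y).
Proof.
move=> [df cg] y v.
pose P (k : nat) (t : R) : 'rV[R]_n :=
  y + t *: (\sum_(i < n | (i < k)%N) v ord0 i *: e_ i).
have cP k : continuous (P k).
  by apply: cont_line; [exact: cont_cst|exact: cont_id|exact: cont_cst].
pose q (i : 'I_n) (t : R) :=
  v ord0 i * I01 (fun s => g i (P i t + (t * v ord0 i * s) *: e_ i)).
have cq i : continuous (q i).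
  apply: cont_mul; first exact: cont_cst.
  apply: (cont_I01 (f := fun s t => g i (P i t + (t * v ord0 i * s) *: e_ i))).
  refine (@cont_comp _ _ _ (fun z : R * R =>
    P i z.2 + (z.2 * v ord0 i * z.1) *: e_ i) (g i) _ _) => //.
  apply: cont_line; last exact: cont_cst.
    by refine (@cont_comp _ _ _ snd (P i) _ _) => //; exact: cont_snd.
  apply: cont_mul; last exact: cont_fst.
  by apply: cont_mul; [exact: cont_snd|exact: cont_cst].
have step (i : 'I_n) t : f (P i.+1 t) - f (P i t) = t * q i t.
  rewrite /q mulrA -(increment_line (df i) (cg i)).
  congr (f _ - _); rewrite /P (bigD1 i)//= scalerDr scalerA.
  rewrite -addrA; congr (_ + _); rewrite addrC; congr (_ + _).
  congr (_ *: _); apply: eq_bigl => j; by rewrite ltnS ltn_neqAle andbC.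
have tele t : f (y + t *: v) - f y = t * \sum_i q i t.
  have -> : y + t *: v = P n t.
    rewrite /P; congr (_ + _ *: _); rewrite [LHS]row_sum_delta.
    by apply: eq_big => // i; rewrite ltn_ord.
  have -> : f y = f (P 0%N t); first congr f.
    by rewrite /P big_pred0 ?scaler0 ?addr0// => i; rewrite ltn0.
  rewrite -(telescope_sumr (fun k => f (P k t)) (leq0n n)) big_mkord mulr_sumr.
  by apply: eq_bigr => i _; exact: step.
have -> : \sum_i v ord0 i * g i y = (fun t => \sum_i q i t) 0.
  apply: eq_bigr => i _; rewrite /q; congr (_ * _).
  rewrite (_ : (fun s => _) = fun=> g i y) ?I01_cst//.
  by apply/funext => s; rewrite /P !mul0r !scale0r !addr0.
exact: (@is_derive_quotient R n f y v (fun t => \sum_i q i t) tele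
  (continuous_sum cq)).
Qed.

Lemma has_grad_secant n (f : 'rV[R]_n -> R) g : has_grad f g -> forall y y',
  f y' - f y = \sum_i (y' - y) ord0 i * I01 (fun s => g i (y + s *: (y' - y))).
Proof.
move=> fg y y'; have [_ cg] := fg.
have dv := has_grad_derive fg.
have cl : continuous (fun s : R => y + s *: (y' - y)).
  by apply: cont_line; [exact: cont_cst|exact: cont_id|exact: cont_cst].
have cgl i : continuous (fun s : R => g i (y + s *: (y' - y))).
  exact: cont_comp cl (cg i).
have cs : continuous (fun x => \sum_i (y' - y) ord0 i * g i x).
  by apply: continuous_sum => i; apply: cont_mul; [exact: cont_cst|exact: cg].
have := @increment_line R n f (fun x => \sum_i (y' - y) ord0 i * g i x) (y' - y)
  (fun x => dv x (y' - y)) cs y 1.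
rewrite scale1r (addrC y (y' - y)) subrK mul1r => ->.
rewrite (_ : (fun t => _) = fun t =>
  \sum_i (y' - y) ord0 i * g i (y + t *: (y' - y))); last first.
  by apply/funext => t; rewrite mul1r.
rewrite I01_sum => [|i]; last by apply: cont_mul; [exact: cont_cst|exact: cgl].
by apply: eq_bigr => i _; rewrite I01Z.
Qed.

(** Symmetry of second derivatives: both mixed derivatives are the limit of the
    same second difference. *)
Lemma schwarz n (f : 'rV[R]_n -> R) (fi fj fij fji : 'rV[R]_n -> R) (u v : 'rV[R]_n) :
  (forall y, is_derive y u f (fi y)) -> (forall y, is_derive y v f (fj y)) ->
  (forall y, is_derive y u fj (fij y)) -> (forall y, is_derive y v fi (fji y)) ->
  continuous fi -> continuous fj -> continuous fij -> continuous fji ->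
  forall y, fij y = fji y.
Proof.
have half (f' g k : 'rV[R]_n -> R) (a b y : 'rV[R]_n) :
    (forall y, is_derive y b f' (g y)) -> (forall y, is_derive y a g (k y)) ->
    continuous g -> continuous k ->
    exists2 q : R -> R, continuous q /\ q 0 = k y & forall t,
      (f' (y + t *: a + t *: b) - f' (y + t *: a)) - (f' (y + t *: b) - f' y) =
      t ^+ 2 * q t.
  move=> df dg cg ck.
  pose q t := I01 (fun s => I01 (fun r => k (y + (t * s) *: b + (t * r) *: a))).
  have ckk : continuous (fun z : R * (R * R) =>
      k (y + (z.2.2 * z.2.1) *: b + (z.2.2 * z.1) *: a)).
    refine (@cont_comp _ _ _ (fun z : R * (R * R) =>
      y + (z.2.2 * z.2.1) *: b + (z.2.2 * z.1) *: a) k _ _) => //.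
    have c22 : continuous (fun z : R * (R * R) => z.2.2).
      refine (@cont_comp _ _ _ (@snd R (R * R)) (@snd R R) _ _).
        exact: cont_snd.
      exact: cont_snd.
    have c21 : continuous (fun z : R * (R * R) => z.2.1).
      refine (@cont_comp _ _ _ (@snd R (R * R)) (@fst R R) _ _).
        exact: cont_snd.
      exact: cont_fst.
    apply: cont_line; [|by apply: cont_mul => //; exact: cont_fst|exact: cont_cst].
    by apply: cont_line; [exact: cont_cst|exact: cont_mul|exact: cont_cst].
  have ck1 : continuous (fun z : R * R =>
      I01 (fun r => k (y + (z.2 * z.1) *: b + (z.2 * r) *: a))).
    exact: (cont_I01 (f := fun r (z : R * R) =>
      k (y + (z.2 * z.1) *: b + (z.2 * r) *: a)) ckk).
  exists q; first split.
  - refine (cont_I01 (f := fun s (t : R) =>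
      I01 (fun r => k (y + (t * s) *: b + (t * r) *: a))) ck1).
  - rewrite /q (_ : (fun s => _) = fun=> k y) ?I01_cst//; apply/funext => s.
    rewrite (_ : (fun r => _) = fun=> k y) ?I01_cst//; apply/funext => r.
    by rewrite !mul0r !scale0r !addr0.
  move=> t; rewrite !(increment_line df cg) -mulrBr expr2 -mulrA; congr (_ * _).
  have cgl x : continuous (fun s : R => g (x + (t * s) *: b)).
    refine (@cont_comp _ _ _ (fun s : R => x + (t * s) *: b) g _ _) => //.
    apply: cont_line; [exact: cont_cst| |exact: cont_cst].
    by apply: cont_mul; [exact: cont_cst|exact: cont_id].
  rewrite -I01B// /q -I01Z; last first.
    refine (@cont_comp _ _ _ (fun s : R => (s, t)) _ _ ck1).
    by apply: cont_pair; [exact: cont_id|exact: cont_cst].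
  congr I01; apply/funext => s.
  by rewrite addrAC (increment_line dg ck).
move=> dfi dfj dfij dfji ci cj cij cji y.
have [q [cq q0] qE] := half f fj fij u v y dfj dfij cj cij.
have [r [cr r0] rE] := half f fi fji v u y dfi dfji ci cji.
have qr t : t != 0 -> q t = r t.
  move=> t0; apply: (mulfI (expf_neq0 2 t0)); rewrite -qE -rE.
  by rewrite (addrAC y (t *: v)); ring.
rewrite -q0 -r0.
have hq : q t @[t --> (0 : R)^'] --> q 0.
  by apply: (@cvg_within_filter _ _ _ (nbhs (0 : R))); exact: cq.
have hr : r t @[t --> (0 : R)^'] --> r 0.
  by apply: (@cvg_within_filter _ _ _ (nbhs (0 : R))); exact: cr.
have hqr : q t @[t --> (0 : R)^'] --> r 0.
  apply: cvg_trans hr; apply: near_eq_cvg; near=> t.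
  by apply/esym/qr; near: t; exact: nbhs_dnbhs_neq.
have <- : lim (q t @[t --> (0 : R)^']) = q 0 by exact/cvg_lim.
exact/cvg_lim.
Unshelve. all: end_near. Qed.

End C1.

Section rayleigh.
Variable R : realType.

Lemma compact_sphere n : compact [set u : 'rV[R]_n | vdot u u = 1].
Proof.
apply: bounded_closed_compact.
  exists 1; split; first exact: num_real.
  move=> M M1 u /= u1; rewrite (le_trans _ (ltW M1))//.
  have := sqr_norm_le_vdot u; rewrite u1 -[leRHS](expr1n _ 2).
  by rewrite ler_sqr ?nnegrE.
apply: (@closed_comp _ _ (fun u : 'rV[R]_n => vdot u u) [set 1]).
  by move=> u _; apply: (continuous_vdot (f := id) (g := id)); exact: cont_id.
exact: closed_eq.
Qed.

(** The minimum of the Rayleigh quotient is an eigenvalue. *)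
Lemma lambda_min_coercive n (A : 'M[R]_n) (a : R) : (0 < n)%N -> A^T = A ->
  a <= lambda_min A -> coercive_mx a A.
Proof.
move=> n0 symA aA.
pose phi (u : 'rV[R]_n) := vdot (u *m A) u.
have cphi : continuous phi.
  apply: continuous_vdot; last exact: cont_id.
  by apply: continuous_mulmx; [exact: cont_id|move=> i j; exact: cont_cst].
have symphi u w : vdot (u *m A) w = vdot (w *m A) u.
  have As i j : A i j = A j i by rewrite -{1}symA mxE.
  rewrite /vdot; under eq_bigr do rewrite mxE mulr_suml.
  under [RHS]eq_bigr do rewrite mxE mulr_suml.
  rewrite exchange_big /=; apply: eq_bigr => i _; apply: eq_bigr => j _.
  by rewrite As; ring.
have S0 : [set u : 'rV[R]_n | vdot u u = 1] !=set0.
  exists (delta_mx ord0 (Ordinal n0)); rewrite /= /vdot (bigD1 (Ordinal n0))//= big1.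
    by rewrite mxE !eqxx mulr1 addr0.
  by move=> i i0; rewrite mxE (negbTE i0) andbF mulr0.
have [u0 + umin] := EVT_min_rV S0 (@compact_sphere n) (continuous_subspaceT cphi).
rewrite inE /= => u01; set la := phi u0 in umin.
have phiZ t u : phi (t *: u) = t ^+ 2 * phi u.
  by rewrite /phi -scalemxAl vdotZl vdotZr mulrA.
have la_le u : la * vdot u u <= phi u.
  have [u_eq0|un0] := eqVneq (vdot u u) 0.
    have -> : u = 0 by apply: vdot_eq0; rewrite u_eq0.
    by rewrite /phi /vdot !big1 ?mulr0// => i _; rewrite ?mul0mx mxE mul0r.
  have u_gt0 : 0 < vdot u u by rewrite lt_neqAle eq_sym un0 vdot_ge0.
  pose s := (Num.sqrt (vdot u u))^-1.
  have s2 : s ^+ 2 = (vdot u u)^-1 by rewrite exprVn sqr_sqrtr// ltW.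
  have : phi u0 <= phi (s *: u).
    apply: umin; rewrite inE /= vdotZl vdotZr mulrA -expr2 s2 mulVf//.
  by rewrite phiZ s2 mulrC ler_pdivlMr.
have eig : u0 *m A = la *: u0.
  apply/eqP; rewrite -subr_eq0; apply/eqP.
  have [w wE] : exists w, w = u0 *m A - la *: u0 by exists (u0 *m A - la *: u0).
  rewrite -wE; apply: vdot_eq0; rewrite leNgt; apply/negP => w0.
  have key t : 0 <= 2 * t * vdot w w + t ^+ 2 * (phi w - la * vdot w w).
    have := la_le (u0 + t *: w); rewrite /phi mulmxDl.
    rewrite !(vdotDl, vdotDr) -scalemxAl !(vdotZl, vdotZr) u01 -/(phi u0) -/la.
    rewrite (symphi w u0) -/(phi w).
    have -> : vdot (u0 *m A) w = vdot w w + la * vdot u0 w.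
      by rewrite -vdotZl -vdotDl wE subrK.
    rewrite (vdotC w u0); lra.
  set M := phi w - la * vdot w w in key.
  have := key (- (vdot w w / (`|M| + 1))).
  have M1 : 0 < `|M| + 1 by rewrite ltr_wpDl.
  set t := vdot w w / _; have t0 : 0 < t by rewrite divr_gt0.
  have tM : t * (`|M| + 1) = vdot w w by rewrite divfK ?gt_eqF.
  have := ler_norm M; rewrite sqrrN expr2; move: (vdot w w) tM w0 => W <- w0.
  move=> h1; apply/negP; rewrite -ltNge.
  have tt : 0 < t * t by rewrite mulr_gt0.
  have := normr_ge0 M; nra.
have u0n0 : u0 != 0.
  apply: contra_eq_neq u01 => ->; rewrite /vdot big1 ?(eq_sym 0) ?oner_neq0//.
  by move=> i _; rewrite mxE mul0r.
suff : lambda_min A <= la.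
  move=> /(le_trans aA) ala u; apply: le_trans (la_le u).
  by rewrite ler_wpM2r// vdot_ge0.
apply: ge_inf; last by apply/eigenvalueP; exists u0.
exists la => b /= /eigenvalueP[u uA un0].
have := la_le u; rewrite /phi uA vdotZl ler_pM2r// lt_neqAle vdot_ge0 andbT eq_sym.
by apply: contra un0 => /eqP u0'; apply/eqP/vdot_eq0; rewrite u0'.
Qed.

End rayleigh.

(** * The averaged gradient and the momentum maps of a step *)

Section potential.
Variables (R : realType) (m : nat) (F : 'rV[R]_m -> R).
Hypothesis smF : smooth F.
Local Notation e_ i := (delta_mx ord0 i).

Lemma smooth_cont a : continuous (pderiv a F).
Proof. by have [] := smF (leqnn (size a)). Qed.

Lemma smooth_has_grad a : has_grad (pderiv a F) (fun i => pderiv (i :: a) F).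
Proof.
split=> [i y|i]; last exact: smooth_cont.
have [_ /(_ (ltnSn _))/(_ i y)] := smF (leqnSn (size a)).
exact: derivableP.
Qed.

Lemma hessian_sym y : (hessian F y)^T = hessian F y.
Proof.
apply/matrixP => i j; rewrite !mxE.
have [dF cF] := smooth_has_grad [::].
have [dFi _] := smooth_has_grad [:: i]; have [dFj _] := smooth_has_grad [:: j].
refine (@schwarz R m F _ _ (pderiv [:: j; i] F) (pderiv [:: i; j] F) (e_ j) (e_ i) (dF j) (dF i) (dFi j) (dFj i)
  (cF j) (cF i) (@smooth_cont [:: j; i]) (@smooth_cont [:: i; j]) y).
Qed.

(** Averages of the derivatives of [F] along segments; the averaged gradient of
    the scheme is [avg [:: i] 0], and derivatives in [y] stay in this family. *)
Definition avg (a : seq 'I_m) (r : nat) (q y : 'rV[R]_m) : R :=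
  I01 (fun t => t ^+ r * pderiv a F (q + t *: (y - q))).

Lemma cont_exp (T : topologicalType) (f : T -> R) r : continuous f ->
  continuous (fun t => f t ^+ r).
Proof.
move=> cf; elim: r => [|r IH]; first exact: cont_cst.
by under eq_fun do rewrite exprS; exact: cont_mul.
Qed.

Lemma cont_seg_avg a (T : topologicalType) (q y : T -> 'rV[R]_m) (t : T -> R) r :
  continuous q -> continuous y -> continuous t ->
  continuous (fun z => t z ^+ r * pderiv a F (q z + t z *: (y z - q z))).
Proof.
move=> cq cy ct; apply: cont_mul; first exact: cont_exp.
refine (@cont_comp _ _ _ (fun z => q z + t z *: (y z - q z)) _ _ (@smooth_cont a)).
by apply: cont_line => //; exact: cont_sub.
Qed.

Lemma cont_avg a r : continuous (fun z : 'rV[R]_m * 'rV[R]_m => avg a r z.1 z.2).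
Proof.
refine (cont_I01 (f := fun t (z : 'rV[R]_m * 'rV[R]_m) =>
  t ^+ r * pderiv a F (z.1 + t *: (z.2 - z.1))) _).
apply: cont_seg_avg; last exact: cont_fst.
- refine (@cont_comp _ _ _ (@snd R _) fst _ _); [exact: cont_snd|exact: cont_fst].
- refine (@cont_comp _ _ _ (@snd R _) snd _ _); [exact: cont_snd|exact: cont_snd].
Qed.

Lemma cont_avg_comp (T : topologicalType) a r (q y : T -> 'rV[R]_m) :
  continuous q -> continuous y -> continuous (fun t => avg a r (q t) (y t)).
Proof.
move=> cq cy; refine (@cont_comp _ _ _ (fun t => (q t, y t)) _ _ (@cont_avg a r)).
exact: cont_pair.
Qed.

Lemma is_derive_avg a r q y j :
  is_derive y (e_ j : 'rV[R]_m) (avg a r q) (avg (j :: a) r.+1 q y).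
Proof.
pose Q (t : R) := I01 (fun s => s ^+ r * (s *
  I01 (fun u => pderiv (j :: a) F (q + s *: (y - q) + (s * t * u) *: e_ j)))).
have cseg (T : topologicalType) (s t u : T -> R) : continuous s -> continuous t ->
    continuous u -> continuous (fun z => pderiv (j :: a) F
      (q + s z *: (y - q) + (s z * t z * u z) *: e_ j)).
  move=> cs ct cu; refine (@cont_comp _ _ _
    (fun z => q + s z *: (y - q) + (s z * t z * u z) *: e_ j) _ _
    (@smooth_cont (j :: a))).
  apply: cont_line; last exact: cont_cst.
    by apply: cont_line => //; exact: cont_cst.
  by apply: cont_mul => //; exact: cont_mul.
have cin : continuous (fun z : R * R =>
    I01 (fun u => pderiv (j :: a) F (q + z.1 *: (y - q) + (z.1 * z.2 * u) *: e_ j))).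
  refine (cont_I01 (f := fun u (z : R * R) =>
    pderiv (j :: a) F (q + z.1 *: (y - q) + (z.1 * z.2 * u) *: e_ j)) _).
  apply: cseg; last exact: cont_fst.
  - refine (@cont_comp _ _ _ (@snd R (R * R)) fst _ _); [exact: cont_snd|exact: cont_fst].
  - refine (@cont_comp _ _ _ (@snd R (R * R)) snd _ _); [exact: cont_snd|exact: cont_snd].
have cin2 : continuous (fun z : R * R => z.1 ^+ r * (z.1 *
    I01 (fun u => pderiv (j :: a) F (q + z.1 *: (y - q) + (z.1 * z.2 * u) *: e_ j)))).
  by apply: cont_mul; [apply: cont_exp; exact: cont_fst|
    apply: cont_mul => //; exact: cont_fst].
have cQ : continuous Q.
  exact: (cont_I01 (f := fun s (t : R) => s ^+ r * (s *
    I01 (fun u => pderiv (j :: a) F (q + s *: (y - q) + (s * t * u) *: e_ j)))) cin2).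
have -> : avg (j :: a) r.+1 q y = Q 0.
  rewrite /avg /Q; congr I01; apply/funext => s; rewrite exprSr -mulrA.
  congr (_ * (_ * _)); rewrite (_ : (fun u => _) = fun=>
    pderiv (j :: a) F (q + s *: (y - q))) ?I01_cst//.
  by apply/funext => u; rewrite mulr0 mul0r scale0r addr0.
apply: is_derive_quotient => // t.
have cA z : continuous (fun s : R => s ^+ r * pderiv a F (q + s *: (z - q))).
  by apply: cont_seg_avg; [exact: cont_cst|exact: cont_cst|exact: cont_id].
rewrite /avg -I01B// /Q -I01Z; last first.
  refine (@cont_comp _ _ _ (fun s : R => (s, t)) _ _ cin2).
  by apply: cont_pair; [exact: cont_id|exact: cont_cst].
congr I01; apply/funext => s; rewrite -mulrBr mulrCA; congr (_ * _).
have [dF cF] := smooth_has_grad a.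
rewrite mulrA (mulrC t) -(increment_line (dF j) (cF j)).
congr (pderiv a F _ - _).
by rewrite (addrAC y) scalerDr scalerA addrA.
Qed.

Lemma avg_growth a r (C : R) (p : nat) :
  (forall y, `|pderiv a F y| <= C * (1 + `|y|) ^+ p) ->
  forall q y, `|avg a r q y| <= C * (1 + `|q| + `|y|) ^+ p.
Proof.
move=> gF q y; apply: norm_I01_le.
  by apply: cont_seg_avg; [exact: cont_cst|exact: cont_cst|exact: cont_id].
move=> t /andP[t0 t1].
have C0 : 0 <= C.
  have := le_trans (normr_ge0 _) (gF 0).
  by rewrite normr0 addr0 expr1n mulr1.
rewrite normrM normrX (ger0_norm t0) (le_trans (ler_piMl _ _))//.
  exact: exprn_ile1.
rewrite (le_trans (gF _))// ler_wpM2l// lerXn2r ?nnegrE ?addr_ge0//.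
rewrite -addrA lerD2l.
have -> : q + t *: (y - q) = (1 - t) *: q + t *: y.
  by rewrite scalerBr scalerBl scale1r addrA addrAC.
rewrite (le_trans (ler_normD _ _))// lerD// normrZ ger0_norm ?subr_ge0//.
- by rewrite ler_piMl// lerBlDr lerDl.
- by rewrite ler_piMl.
Qed.

Variables (h K : R).
Hypotheses (h0 : 0 < h) (Hcoer : forall y, coercive_mx (- K) (hessian F y)).

Definition avg_grad (q y : 'rV[R]_m) : 'rV[R]_m := \row_i avg [:: i] 0 q y.

(** For an AVF step from position [q] to position [y], the implicit equations
    make [stepG q y] the momentum before the step and [stepH q y] the momentum
    after it. Fixing [q], a step thus solves [stepG q y = p] for [y]. *)
Definition stepG q y := h^-1 *: (y - q) + (h / 2) *: avg_grad q y.

Definition stepH q y := h^-1 *: (y - q) - (h / 2) *: avg_grad q y.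

(** The secant matrix of [stepG q]. Row [j] is the direction of
    differentiation; the weight in [avg _ 1] comes from differentiating
    [q + t (y - q)] in [y]. *)
Definition stepA q (y y' : 'rV[R]_m) : 'M[R]_m :=
  \matrix_(j, i) (h^-1 * (j == i)%:R +
    h / 2 * I01 (fun s => avg [:: j; i] 1 q (y + s *: (y' - y)))).

Lemma cont_avg_grad (T : topologicalType) (q y : T -> 'rV[R]_m) :
  continuous q -> continuous y -> continuous (fun t => avg_grad (q t) (y t)).
Proof.
move=> cq cy; apply: continuous_rV => i; under eq_fun do rewrite mxE.
exact: cont_avg_comp.
Qed.

Lemma cont_stepG (T : topologicalType) (q y : T -> 'rV[R]_m) :
  continuous q -> continuous y -> continuous (fun t => stepG (q t) (y t)).
Proof.
move=> cq cy; apply: cont_add.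
  by apply: cont_scale; [exact: cont_cst|exact: cont_sub].
by apply: cont_scale; [exact: cont_cst|exact: cont_avg_grad].
Qed.

Lemma cont_stepH (T : topologicalType) (q y : T -> 'rV[R]_m) :
  continuous q -> continuous y -> continuous (fun t => stepH (q t) (y t)).
Proof.
move=> cq cy; apply: cont_sub.
  by apply: cont_scale; [exact: cont_cst|exact: cont_sub].
by apply: cont_scale; [exact: cont_cst|exact: cont_avg_grad].
Qed.

Lemma avg_has_grad i q :
  has_grad (avg [:: i] 0 q) (fun j => avg [:: j; i] 1 q).
Proof.
split=> [j y|j]; first exact: is_derive_avg.
by apply: cont_avg_comp; [exact: cont_cst|exact: cont_id].
Qed.

Let cont_avgl j i r q y v :
  continuous (fun s : R => avg [:: j; i] r q (y + s *: v)).
Proof.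
apply: cont_avg_comp; first exact: cont_cst.
by apply: cont_line; [exact: cont_cst|exact: cont_id|exact: cont_cst].
Qed.

(** The Hessian is bounded below by [- K]; the weight [t] has average 1/2 over
    the unit interval and the gradient enters [stepG] with the factor [h / 2],
    whence the loss [h K / 4]. *)
Lemma stepA_coercive q y y' : coercive_mx (h^-1 - h * K / 4) (stepA q y y').
Proof.
move=> u.
have hess_quad x : vdot (u *m hessian F x) u =
    \sum_i \sum_j u ord0 j * u ord0 i * pderiv [:: j; i] F x.
  apply: eq_bigr => i _; rewrite mxE mulr_suml; apply: eq_bigr => j _.
  by rewrite mxE; ring.
have quad : vdot (u *m stepA q y y') u = h^-1 * vdot u u + h / 2 *
    \sum_i \sum_j u ord0 j * u ord0 i *
      I01 (fun s => avg [:: j; i] 1 q (y + s *: (y' - y))).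
  rewrite /vdot !mulr_sumr -big_split; apply: eq_bigr => i _ /=.
  rewrite mxE mulr_suml mulr_sumr.
  under eq_bigr do rewrite mxE mulrDr mulrDl.
  rewrite big_split /=; congr (_ + _); last by apply: eq_bigr => j _; ring.
  rewrite (bigD1 i)//= eqxx mulr1 big1 ?addr0; first by ring.
  by move=> j /negbTE ->; rewrite !mulr0 mul0r.
rewrite quad mulrBl lerD2l.
have lin x : \sum_i \sum_j u ord0 j * u ord0 i * avg [:: j; i] 1 q x =
    I01 (fun t => t * vdot (u *m hessian F (q + t *: (x - q))) u).
  have cA i j : continuous (fun t : R =>
      t ^+ 1 * pderiv [:: j; i] F (q + t *: (x - q))).
    by apply: cont_seg_avg; [exact: cont_cst|exact: cont_cst|exact: cont_id].
  have cAu i j : continuous (fun t : R => u ord0 j * u ord0 i *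
      (t ^+ 1 * pderiv [:: j; i] F (q + t *: (x - q)))).
    by apply: cont_mul => //; exact: cont_cst.
  transitivity (I01 (fun t => \sum_i \sum_j u ord0 j * u ord0 i *
      (t ^+ 1 * pderiv [:: j; i] F (q + t *: (x - q))))).
    rewrite I01_sum => [|i]; last exact: continuous_sum.
    apply: eq_bigr => i _; rewrite I01_sum//; apply: eq_bigr => j _.
    by rewrite I01Z.
  congr I01; apply/funext => t; rewrite hess_quad mulr_sumr.
  apply: eq_bigr => i _; rewrite mulr_sumr; apply: eq_bigr => j _.
  by rewrite expr1; ring.
have half (k : R) : I01 (fun t => t * k) = k / 2.
  have dk t : is_derive t (1 : R) (fun s => s ^+ 2 * (k / 2)) (t * k).
    pose Q s := (2 * t + s) * (k / 2).
    have -> : t * k = Q 0 by rewrite /Q; field.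
    apply: is_derive_secant => [s|]; first by rewrite /Q; ring.
    apply: cont_mul; last exact: cont_cst.
    by apply: cont_add; [exact: cont_cst|exact: cont_id].
  rewrite (FTC01 dk) ?expr1n ?expr0n/= ?mul0r ?subr0 ?mul1r//.
  by apply: cont_mul; [exact: cont_id|exact: cont_cst].
have lb x : - K * vdot u u / 2 <=
    \sum_i \sum_j u ord0 j * u ord0 i * avg [:: j; i] 1 q x.
  rewrite lin -half; apply: le_I01.
  - by apply: cont_mul; [exact: cont_id|exact: cont_cst].
  - apply: cont_mul; first exact: cont_id.
    apply: continuous_vdot; last exact: cont_cst.
    apply: continuous_mulmx => [|i j]; first exact: cont_cst.
    under eq_fun do rewrite mxE.
    refine (@cont_comp _ _ _ (fun t : R => q + t *: (x - q)) _ _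
      (@smooth_cont [:: i; j])).
    by apply: cont_line; [exact: cont_cst|exact: cont_id|exact: cont_cst].
  - by move=> t /andP[t0 _]; rewrite ler_wpM2l//; exact: Hcoer.
have cAu i j : continuous (fun s : R => u ord0 j * u ord0 i *
    avg [:: j; i] 1 q (y + s *: (y' - y))).
  by apply: cont_mul => //; exact: cont_cst.
have -> : \sum_i \sum_j u ord0 j * u ord0 i *
      I01 (fun s => avg [:: j; i] 1 q (y + s *: (y' - y))) =
    I01 (fun s => \sum_i \sum_j u ord0 j * u ord0 i *
      avg [:: j; i] 1 q (y + s *: (y' - y))).
  rewrite I01_sum => [|i]; last exact: continuous_sum.
  apply: eq_bigr => i _; rewrite I01_sum//; apply: eq_bigr => j _.
  by rewrite I01Z.
have : - K * vdot u u / 2 <= I01 (fun s => \sum_i \sum_j u ord0 j * u ord0 i *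
      avg [:: j; i] 1 q (y + s *: (y' - y))).
  rewrite -[leLHS]I01_cst; apply: le_I01 => //; first exact: cont_cst.
  by apply: continuous_sum => i; exact: continuous_sum.
move=> /(ler_wpM2l (ltW (divr_gt0 h0 (ltr0n R 2)))); apply: le_trans.
by rewrite le_eqVlt; apply/orP; left; apply/eqP; field.
Qed.

Lemma stepG_secant q : secant (h^-1 - h * K / 4) (stepG q) (stepA q).
Proof.
split; last exact: stepA_coercive.
- move=> y y'; apply/rowP => i; have E := has_grad_secant (avg_has_grad i q) y y'.
  transitivity (h^-1 * (y' - y) ord0 i + h / 2 *
      (avg [:: i] 0 q y' - avg [:: i] 0 q y)).
    rewrite !mxE; move: (avg _ _ q y') (avg _ _ q y) => A B.
    by move: (h^-1) (h / 2) => h1 h2; ring.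
  rewrite E [RHS]mxE.
  under [RHS]eq_bigr do rewrite [stepA _ _ _ _ _]mxE mulrDr.
  rewrite big_split /=; congr (_ + _).
    rewrite (bigD1 i)//= eqxx mulr1 big1 ?addr0; first by rewrite mulrC.
    by move=> j /negbTE ->; rewrite !mulr0.
  by rewrite mulr_sumr; apply: eq_bigr => j _; ring.
- move=> j i; under eq_fun do rewrite mxE.
  apply: cont_add; first exact: cont_cst.
  apply: cont_mul; first exact: cont_cst.
  refine (cont_I01 (f := fun s (z : 'rV[R]_m * 'rV[R]_m) =>
    avg [:: j; i] 1 q (z.1 + s *: (z.2 - z.1))) _).
  have c1 : continuous (fun z : R * ('rV[R]_m * 'rV[R]_m) => z.2.1).
    refine (@cont_comp _ _ _ (@snd R _) fst _ _); [exact: cont_snd|exact: cont_fst].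
  have c2 : continuous (fun z : R * ('rV[R]_m * 'rV[R]_m) => z.2.2).
    refine (@cont_comp _ _ _ (@snd R _) snd _ _); [exact: cont_snd|exact: cont_snd].
  apply: cont_avg_comp; first exact: cont_cst.
  apply: cont_line; [exact: c1|exact: cont_fst|].
  by apply: cont_sub; [exact: c2|exact: c1].
Qed.

Lemma stepA_diag q y : stepA q y y =
  \matrix_(j, i) (h^-1 * (j == i)%:R + h / 2 * avg [:: j; i] 1 q y).
Proof.
apply/matrixP => j i.
have E : I01 (fun s => avg [:: j; i] 1 q (y + s *: (y - y))) = avg [:: j; i] 1 q y.
  rewrite (_ : (fun s => _) = fun=> avg [:: j; i] 1 q y); first exact: I01_cst.
  by apply/funext => s; rewrite subrr scaler0 addr0.
by rewrite [LHS]mxE E [RHS]mxE.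
Qed.

End potential.

(** * Laws independent of the past *)

Section dominated_EFin.
Local Open Scope ereal_scope.

Lemma dominated_EFin d (T : measurableType d) (R : realType)
    (mu : {measure set T -> \bar R}) (f_ : nat -> T -> R) (f g : T -> R) :
  (forall n, measurable_fun setT (f_ n)) -> measurable_fun setT f ->
  {ae mu, forall x, f_ n x @[n --> \oo] --> f x} ->
  mu.-integrable setT (EFin \o g) ->
  (forall n x, `|f_ n x| <= g x)%R ->
  \int[mu]_x (f_ n x)%:E @[n --> \oo] --> \int[mu]_x (f x)%:E.
Proof.
move=> mf_ mf cf ig fg.
have mE n : measurable_fun setT (fun x => (f_ n x)%:E) by exact/measurable_EFinP.
have mE' : measurable_fun setT (fun x => (f x)%:E) by exact/measurable_EFinP.
have cE : {ae mu, forall x, setT x -> (f_ n x)%:E @[n --> \oo] --> (f x)%:E}.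
  by apply: filterS cf => x cx _; apply: cvg_EFin => //; exact: nearW.
have bE : {ae mu, forall x n, setT x -> `|(f_ n x)%:E| <= (g x)%:E}.
  by apply: aeW => x n _; rewrite abse_EFin lee_fin.
by have [] := dominated_convergence measurableT mE mE' cE ig bE.
Qed.

End dominated_EFin.

Section continuous_unique.
Variable R : realType.
Local Open Scope ereal_scope.

Let ramp (n : nat) (c x : R) : R := Num.min 1%R (n%:R * Num.max 0 (x - c))%R.

Let ramp01 n c x : (0 <= ramp n c x <= 1)%R.
Proof.
by rewrite /ramp le_min ler01 mulr_ge0 ?le_max ?lexx// ge_min lexx.
Qed.

Let ramp_cvg c x : ramp n c x @[n --> \oo] --> (\1_(`]c, +oo[%classic : set R) x : R).
Proof.
rewrite indicE; have [xc|cx] := leP x c.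
  rewrite memNset/=; last by rewrite in_itv/= andbT ltNge xc.
  rewrite (_ : (fun n => _) = cst 0%R); first exact: cvg_cst.
  apply/funext => n; rewrite /ramp (max_l (_ : x - c <= 0)%R) ?subr_le0//.
  by rewrite mulr0 min_r.
rewrite mem_set/=; last by rewrite in_itv/= andbT.
apply: cvg_near_cst; near=> n; rewrite /= /ramp min_l// max_r ?subr_ge0 ?ltW//.
rewrite -ltr_pdivrMr ?subr_gt0// div1r.
by near: n; exact: nbhs_infty_gtr.
Unshelve. all: end_near. Qed.

Let ramp_cont n c : continuous (ramp n c).
Proof.
move=> x; apply: (@continuous_min _ _ (cst 1%R)
  (fun x => n%:R * Num.max 0 (x - c))%R); first exact: cvg_cst.
apply: cvgM; first exact: cvg_cst.
apply: (@continuous_max _ _ (cst 0%R) (fun x => x - c)%R); first exact: cvg_cst.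
by apply: cvgB; [exact: cvg_id|exact: cvg_cst].
Qed.

(** The indicator of an open orthant is the limit of products of piecewise
    linear ramps, and dominated convergence passes to the limit. *)
Lemma rV_measure_unique_continuous n (m1 m2 : {measure set 'rV[R]_n -> \bar R}) :
  m1 setT < +oo -> m2 setT < +oo ->
  (forall g : 'rV[R]_n -> R, continuous g -> (forall x, 0 <= g x <= 1)%R ->
    \int[m1]_x (g x)%:E = \int[m2]_x (g x)%:E) ->
  forall A, measurable A -> m1 A = m2 A.
Proof.
move=> m1oo m2oo m12; apply: rV_measure_unique_ray => // c.
set B := box _; pose g k (x : 'rV[R]_n) : R := (\prod_i ramp k (c i) (x ord0 i))%R.
have mB : measurable B by apply: measurable_box => i; exact: measurable_itv.
have g01 k x : (0 <= g k x <= 1)%R.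
  apply/andP; split; first by apply: prodr_ge0 => i _; have /andP[] := ramp01 k (c i) (x ord0 i).
  rewrite /g -[leRHS](@big1 _ 1%R *%R _ (index_enum 'I_n) xpredT (fun=> 1%R))//.
  by apply: ler_prod => i _; exact: ramp01.
have cg k : continuous (g k).
  apply: continuous_prod => i.
  refine (@cont_comp _ _ _ (@rV_coord R n i) _ _ (@ramp_cont k (c i))).
  exact: continuous_rV_coord.
have gB x : g k x @[k --> \oo] --> (\1_B x : R).
  have -> : (\1_B x : R) = (\prod_i \1_(`]c i, +oo[%classic : set R) (x ord0 i))%R.
    rewrite indicE; have [Bx|nBx] := pselect (B x).
      rewrite mem_set// big1// => i _; rewrite indicE mem_set//; exact: Bx.
    rewrite memNset//; apply/esym/eqP; rewrite prodf_seq_eq0; apply/hasP.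
    have /existsNP[i nBi] := nBx.
    by exists i; rewrite ?mem_index_enum//= indicE memNset.
  have prods (s : seq 'I_n) : (\prod_(i <- s) ramp k (c i) (x ord0 i))%R @[k --> \oo] -->
      (\prod_(i <- s) \1_(`]c i, +oo[%classic : set R) (x ord0 i) : R)%R.
    elim: s => [|i s IH].
      by under eq_fun do rewrite big_nil; rewrite big_nil; exact: cvg_cst.
    under eq_fun do rewrite big_cons; rewrite big_cons.
    by apply: cvgM => //; exact: ramp_cvg.
  exact: prods.
have cvgB (m : {measure set 'rV[R]_n -> \bar R}) : m setT < +oo ->
    \int[m]_x (g k x)%:E @[k --> \oo] --> m B.
  move=> moo.
  have i1 : m.-integrable setT (cst 1 : 'rV[R]_n -> \bar R).
    apply/integrableP; split; first exact: measurable_cst.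
    under eq_integral do rewrite gee0_abs//=.
    by rewrite integral_cst// mul1e.
  have mg k : measurable_fun setT (g k) by apply: continuous_measurable_rV; exact: cg.
  have mi : measurable_fun setT (\1_B : 'rV[R]_n -> R) by exact: measurable_indic.
  have -> : m B = \int[m]_x (\1_B x)%:E by rewrite integral_indic// setIT.
  apply: (@dominated_EFin _ _ _ _ _ _ (cst 1%R)) => //; first exact: aeW.
  by move=> k x; have /andP[g0 g1] := g01 k x; rewrite ger0_norm.
rewrite -(cvg_lim _ (cvgB m1 m1oo))// -(cvg_lim _ (cvgB m2 m2oo))//.
suff -> : (fun k => \int[m1]_x (g k x)%:E) = (fun k => \int[m2]_x (g k x)%:E) by [].
by apply/funext => k; exact: m12.
Qed.

End continuous_unique.

Section independent_law.
Local Open Scope ereal_scope.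
Variables (R : realType) (disp : measure_display) (Omega : measurableType disp).
Variables (Pr : probability Omega R) (d : nat).

(** [Z] is independent of the class [C], and its law is given through a map
    [phi] of a standard Gaussian vector, since the laws below need not have a
    density. *)
Definition indep_law n (C : set (set Omega)) (Z : Omega -> 'rV[R]_n)
    (phi : 'rV[R]_d -> 'rV[R]_n) : Prop :=
  [/\ measurable_fun setT Z, measurable_fun setT phi &
    forall A B, C A -> measurable B ->
      Pr (A `&` Z @^-1` B) = Pr A * gauss_rV R d (phi @^-1` B)].

(** The joint law of [X] and [Z] is the product of their laws; apply Fubini. *)
Lemma indep_law_integral dT (T : measurableType dT) n C (Z : Omega -> 'rV[R]_n) phi
    (X : Omega -> T) (g : T * 'rV[R]_n -> \bar R) :
  indep_law C Z phi -> measurable_fun setT X ->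
  (forall A, measurable A -> C (X @^-1` A)) ->
  measurable_fun setT g -> (forall x, 0 <= g x) ->
  \int[Pr]_w g (X w, Z w) = \int[Pr]_w \int[gauss_rV R d]_z g (X w, phi z).
Proof.
move=> [mZ mphi ZP] mX CX mg g0.
have mXZ : measurable_fun setT (fun w => (X w, Z w)) by exact: measurable_fun_pair.
pose nX := distribution Pr (mfun_of mX).
pose nphi := distribution (gauss_rV R d) (mfun_of mphi).
have E := @ge0_integral_pushforward _ _ _ _ R _ mXZ Pr setT g measurableT mg
  (fun y _ => g0 y).
rewrite preimage_setT in E; rewrite -[LHS]E.
transitivity (\int[nX \x nphi]_z g z).
  apply: (@eq_measure_integral _ _ _ _ (nX \x nphi)%E (pushm Pr mXZ)) => A mA _.
  apply/esym; apply: product_measure_unique => // A' B mA' mB.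
  exact: (ZP _ _ (CX _ mA') mB).
rewrite fubini_tonelli1//.
have mF : measurable_fun setT (fun x => \int[nphi]_y g (x, y)).
  exact: (measurable_fun_fubini_tonelli_F (m2 := nphi) g).
rewrite /fubini_F.
have E2 := @ge0_integral_pushforward _ _ _ _ R _ mX Pr setT _ measurableT mF
  (fun y _ => integral_ge0 _ (fun z _ => g0 _)).
rewrite preimage_setT in E2; rewrite [LHS]E2.
apply: eq_integral => w _ /=.
have mgw : measurable_fun setT (fun y => g (X w, y)).
  exact: measurableT_comp mg (measurable_pair1 _).
have E3 := @ge0_integral_pushforward _ _ _ _ R _ mphi (gauss_rV R d) setT _ measurableT
  mgw (fun y _ => g0 _).
by rewrite preimage_setT in E3; rewrite [LHS]E3.
Qed.

Let mind (A : set Omega) : measurable A ->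
  measurable_fun setT (fun w => (\1_A w : R)%:E).
Proof. by move=> mA; apply/measurable_EFinP; exact: measurable_indic. Qed.

Let ind0 (A : set Omega) w : 0 <= (\1_A w : R)%:E.
Proof. by rewrite lee_fin. Qed.

(** Defined through a density rather than as a restriction, so that its integrals
    reduce to integrals against [Pr]. *)
Definition restr_prob A (mA : measurable A) : {measure set Omega -> \bar R} :=
  density_measure Pr (mind mA) (ind0 A).

Lemma restr_probE A (mA : measurable A) B : measurable B ->
  restr_prob mA B = Pr (A `&` B).
Proof. by move=> mB; rewrite /restr_prob /= /mdensity integral_indic. Qed.

Lemma ge0_integral_restr A (mA : measurable A) f : measurable_fun setT f ->
  (forall w, 0 <= f w) ->
  \int[restr_prob mA]_w f w = \int[Pr]_w (f w * (\1_A w : R)%:E).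
Proof. by move=> mf f0; apply: ge0_integral_density. Qed.

Lemma indep_law_unique n (C : set (set Omega)) (Z : Omega -> 'rV[R]_n)
    (phi : 'rV[R]_d -> 'rV[R]_n) : C `<=` measurable ->
  measurable_fun setT Z -> measurable_fun setT phi ->
  (forall A (mZ : measurable_fun setT Z) (mphi : measurable_fun setT phi)
     (mA : measurable A), C A -> forall B, measurable B ->
     pushm (restr_prob mA) mZ B =
     mscale (NngNum (fine_ge0 (measure_ge0 Pr A))) (pushm (gauss_rV R d) mphi) B) ->
  indep_law C Z phi.
Proof.
move=> Cm mZ mphi H; split=> // A B CA mB.
have mZB : measurable (Z @^-1` B).
  by rewrite -[X in measurable X]setTI; exact: mZ.
rewrite -(restr_probE (Cm _ CA) mZB).
rewrite [LHS](H A mZ mphi (Cm _ CA) CA B mB).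
by rewrite /mscale /= fineK// fin_num_measure//; exact: Cm.
Qed.

Lemma indep_law_box n (C : set (set Omega)) (Z : Omega -> 'rV[R]_n)
    (phi : 'rV[R]_d -> 'rV[R]_n) : C `<=` measurable ->
  measurable_fun setT Z -> measurable_fun setT phi ->
  (forall A B, C A -> (forall i, measurable (B i)) ->
    Pr (A `&` Z @^-1` box B) = Pr A * gauss_rV R d (phi @^-1` box B)) ->
  indep_law C Z phi.
Proof.
move=> Cm mZ mphi H; apply: indep_law_unique => // A mZ' mphi' mA CA B mB.
have mpre D : measurable D -> measurable (Z @^-1` D).
  by move=> mD; rewrite -[X in measurable X]setTI; exact: mZ.
apply: rV_measure_unique_box mB => [k|B' mB'].
  have mk : measurable (@cube R n k) by apply: measurable_box => i; exact: measurable_itv.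
  rewrite [X in X < _](restr_probE mA (mpre _ mk)).
  apply: (@le_lt_trans _ _ 1); last exact: ltry.
  by apply: probability_le1; apply: measurableI => //; exact: mpre.
have mk := measurable_box mB'.
rewrite [LHS](restr_probE mA (mpre _ mk)) H//; congr (_ * _).
by rewrite /= fineK// fin_num_measure.
Qed.

(** Continuous test functions make the property pass to almost sure limits. *)
Lemma indep_law_continuous n (C : set (set Omega)) (Z : Omega -> 'rV[R]_n)
    (phi : 'rV[R]_d -> 'rV[R]_n) : C `<=` measurable ->
  measurable_fun setT Z -> measurable_fun setT phi ->
  (forall A (g : 'rV[R]_n -> R), C A -> continuous g ->
    (forall x, 0 <= g x <= 1)%R ->
    \int[Pr]_w (\1_A w * g (Z w))%:E = Pr A * \int[gauss_rV R d]_z (g (phi z))%:E) ->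
  indep_law C Z phi.
Proof.
move=> Cm mZ mphi H; apply: indep_law_unique => // A mZ' mphi' mA CA B mB.
have PA : Pr A \is a fin_num by rewrite fin_num_measure.
apply: rV_measure_unique_continuous mB.
- rewrite [X in X < _](restr_probE mA measurableT) setIT.
  by rewrite (le_lt_trans (probability_le1 _ _))// ltry.
- change ((fine (Pr A))%:E * gauss_rV R d setT < +oo).
  by rewrite [X in _ * X]probability_setT mule1 ltry.
move=> g cg g01.
have mg : measurable_fun setT (fun x => (g x)%:E).
  by apply/measurable_EFinP; apply: continuous_measurable_rV.
have g0 x : 0 <= (g x)%:E by rewrite lee_fin; have /andP[] := g01 x.
have E1 := @ge0_integral_pushforward _ _ _ _ R _ mZ (restr_prob mA) setT _
  measurableT mg (fun y _ => g0 _).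
have E2 := @ge0_integral_pushforward _ _ _ _ R _ mphi (gauss_rV R d) setT _
  measurableT mg (fun y _ => g0 _).
rewrite preimage_setT in E1 E2.
have mgZ : measurable_fun setT (fun w => (g (Z w))%:E) by exact: measurableT_comp mg mZ.
have E3 := ge0_integral_restr mA mgZ (fun w => g0 _).
etransitivity; first exact: E1.
etransitivity; first exact: E3.
rewrite ge0_integral_mscale//.
transitivity (Pr A * \int[gauss_rV R d]_z (g (phi z))%:E); last first.
  by rewrite -[in LHS](fineK PA); congr (_ * _); exact/esym/E2.
rewrite -H//.
by apply: eq_integral => w _; rewrite -EFinM mulrC.
Qed.

End independent_law.

(** * Adapted variables and sums of independent Gaussian vectors *)

Section adapted.
Context disp (Omega : measurableType disp).

(** Measurability with respect to a class of events of a fixed space. The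
    sigma-algebra is part of a measurable type, so [adaptedP] moves to
    [g_sigma_algebraType C], where the theory of measurable functions applies. *)
Definition adapted (C : set (set Omega)) dT (T : measurableType dT) (X : Omega -> T) :=
  forall B, measurable B -> C (X @^-1` B).

Lemma adaptedP C dT (T : measurableType dT) (X : Omega -> T) : sigma_algebra setT C ->
  adapted C X <-> measurable_fun [set: g_sigma_algebraType C] (X : g_sigma_algebraType C -> T).
Proof.
move=> sC; split => [aX _ B mB|mX B mB].
  by rewrite setTI; apply: sub_sigma_algebra; exact: aX.
have := mX measurableT B mB; rewrite setTI.
by rewrite /measurable /= sigma_algebra_id.
Qed.

Lemma adapted_comp C d1 d2 (T1 : measurableType d1) (T2 : measurableType d2)
    (X : Omega -> T1) (f : T1 -> T2) :
  measurable_fun setT f -> adapted C X -> adapted C (fun w => f (X w)).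
Proof.
by move=> mf aX B mB; apply: (aX (f @^-1` B)); rewrite -[X in measurable X]setTI; exact: mf.
Qed.

Lemma adapted_mono C D dT (T : measurableType dT) (X : Omega -> T) :
  C `<=` D -> adapted C X -> adapted D X.
Proof. by move=> CD aX B mB; exact/CD/aX. Qed.

Lemma adapted_pair C d1 d2 (T1 : measurableType d1) (T2 : measurableType d2)
    (X : Omega -> T1) (Y : Omega -> T2) : sigma_algebra setT C ->
  adapted C X -> adapted C Y -> adapted C (fun w => (X w, Y w)).
Proof.
move=> sC /(adaptedP _ sC) mX /(adaptedP _ sC) mY; apply/(adaptedP _ sC).
exact: measurable_fun_pair.
Qed.

Lemma adapted_rV C (R : realType) n (X : Omega -> 'rV[R]_n) : sigma_algebra setT C ->
  (forall i, adapted C (fun w => X w ord0 i : measurableTypeR R)) -> adapted C X.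
Proof.
move=> sC aX; apply/(adaptedP _ sC); apply: measurable_fun_rV => i.
exact/(adaptedP _ sC)/aX.
Qed.

Lemma adapted_cst C dT (T : measurableType dT) (x : T) : sigma_algebra setT C ->
  adapted C (fun=> x).
Proof. by move=> sC; apply/(adaptedP _ sC); exact: measurable_cst. Qed.

Lemma adapted_indic C (R : realType) A : sigma_algebra setT C -> C A ->
  adapted C (fun w => \1_A w : measurableTypeR R).
Proof.
move=> sC CA; apply/(adaptedP _ sC).
apply: (@measurable_indic _ (g_sigma_algebraType C)).
exact: sub_sigma_algebra.
Qed.

Lemma adapted_measurable C dT (T : measurableType dT) (X : Omega -> T) :
  C `<=` measurable -> adapted C X -> measurable_fun setT X.
Proof. by move=> Cm aX _ B mB; rewrite setTI; exact/Cm/aX. Qed.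

End adapted.

Section independent_sum.
Local Open Scope ereal_scope.
Variables (R : realType) (disp : measure_display) (Omega : measurableType disp).
Variables (Pr : probability Omega R) (d : nat).

Lemma indep_law_event n (C : set (set Omega)) (Z : Omega -> 'rV[R]_n)
    (phi : 'rV[R]_d -> 'rV[R]_n) A (g : 'rV[R]_n -> \bar R) :
  sigma_algebra setT C -> C `<=` measurable -> C A ->
  indep_law Pr C Z phi -> measurable_fun setT g -> (forall x, 0 <= g x) ->
  \int[Pr]_w ((\1_A w)%:E * g (Z w)) = Pr A * \int[gauss_rV R d]_z g (phi z).
Proof.
move=> sC Cm CA iZ mg g0; have [mZ mphi _] := iZ.
have mA := Cm _ CA.
pose h (x : measurableTypeR R * 'rV[R]_n) := (Num.max 0 x.1)%:E * g x.2.
have h0 x : 0 <= h x by rewrite mule_ge0// lee_fin le_max lexx.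
have m1 : measurable_fun setT
    (fun x : measurableTypeR R * 'rV[R]_n => (Num.max 0 x.1)%R : R).
  exact: (@measurable_maxr _ _ _ _ (cst 0%R) fst).
have mh : measurable_fun setT h.
  apply: emeasurable_funM; first exact/measurable_EFinP.
  exact: measurableT_comp mg measurable_snd.
have aA := adapted_indic (R := R) sC CA.
have i1 w : (0 <= \1_A w :> R)%R by [].
have := indep_law_integral iZ (adapted_measurable Cm aA) aA mh h0.
rewrite /h /=; under eq_integral do rewrite max_r//.
move=> ->; under eq_integral do rewrite max_r//.
have mgphi : measurable_fun setT (fun z => g (phi z)) by exact: measurableT_comp mg mphi.
have gi0 : 0 <= \int[gauss_rV R d]_z g (phi z) by exact: integral_ge0.
transitivity (\int[Pr]_w ((\1_A w)%:E * \int[gauss_rV R d]_z g (phi z))).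
  by apply: eq_integral => w _; rewrite ge0_integralZl.
rewrite ge0_integralZr//; last by apply/measurable_EFinP; exact: measurable_indic.
by rewrite integral_indic// setIT.
Qed.

(** Integrate out [U], which is independent of [D], hence jointly of [Z] and of
    the events of [C]; then integrate out [Z]. *)
Lemma indep_law_add n (C D : set (set Omega)) (Z U : Omega -> 'rV[R]_n)
    (phi psi chi : 'rV[R]_d -> 'rV[R]_n) :
  sigma_algebra setT C -> C `<=` D -> sigma_algebra setT D -> D `<=` measurable ->
  indep_law Pr C Z phi -> adapted D Z -> indep_law Pr D U psi ->
  measurable_fun setT chi ->
  (forall g : 'rV[R]_n -> \bar R, measurable_fun setT g -> (forall x, 0 <= g x) ->
    \int[gauss_rV R d]_x \int[gauss_rV R d]_y g (phi x + psi y)%R =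
    \int[gauss_rV R d]_z g (chi z)) ->
  indep_law Pr C (fun w => Z w + U w)%R chi.
Proof.
move=> sC CD sD Dm iZ aZ iU mchi H.
have [mZ mphi _] := iZ; have [mU mpsi _] := iU.
have Cm : C `<=` measurable by move=> A /CD/Dm.
split => //; first exact: measurable_addrV.
move=> A B CA mB; have mA := Cm _ CA.
pose g (x : 'rV[R]_n) : \bar R := (\1_B x)%:E.
have mg : measurable_fun setT g by apply/measurable_EFinP; exact: measurable_indic.
have g0 x : 0 <= g x by rewrite lee_fin.
pose h (x : (measurableTypeR R * 'rV[R]_n) * 'rV[R]_n) :=
  (Num.max 0 x.1.1)%:E * g (x.1.2 + x.2)%R.
have h0 x : 0 <= h x by rewrite mule_ge0// lee_fin le_max lexx.
have m11 : measurable_fun setT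
    (fun x : (measurableTypeR R * 'rV[R]_n) * 'rV[R]_n => x.1.1).
  exact: measurableT_comp measurable_fst measurable_fst.
have m1 : measurable_fun setT
    (fun x : (measurableTypeR R * 'rV[R]_n) * 'rV[R]_n => (Num.max 0 x.1.1)%R : R).
  exact: (@measurable_maxr _ _ _ _ (cst 0%R) (fun x => x.1.1)).
have mh : measurable_fun setT h.
  apply: emeasurable_funM; first exact/measurable_EFinP.
  apply: measurableT_comp mg _; apply: measurable_addrV => //.
  exact: measurableT_comp measurable_snd measurable_fst.
have aX := adapted_pair sD (adapted_indic (R := R) sD (CD _ CA)) aZ.
have i1 w : (0 <= \1_A w :> R)%R by [].
pose G x := \int[gauss_rV R d]_z g (x + psi z)%R.
have mxy : measurable_fun setT (fun z : 'rV[R]_n * 'rV[R]_d => (z.1 + psi z.2)%R).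
  apply: measurable_addrV => //; exact: measurableT_comp mpsi measurable_snd.
have mgx : measurable_fun setT (fun z : 'rV[R]_n * 'rV[R]_d => g (z.1 + psi z.2)%R).
  exact: measurableT_comp mg mxy.
have mG : measurable_fun setT G.
  exact: (measurable_fun_fubini_tonelli_F (m2 := gauss_rV R d)
    (fun z : 'rV[R]_n * 'rV[R]_d => g (z.1 + psi z.2)%R)).
have G0 x : 0 <= G x by exact: integral_ge0.
transitivity (\int[Pr]_w h ((\1_A w, Z w), U w)).
  have mAB : measurable (A `&` (fun w => Z w + U w)%R @^-1` B).
    apply: measurableI => //; rewrite -[X in measurable X]setTI.
    by apply: (measurable_addrV mZ mU) => //.
  transitivity (\int[Pr]_w (\1_(A `&` (fun w => Z w + U w)%R @^-1` B) w)%:E).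
    by rewrite integral_indic// setIT.
  apply: eq_integral => w _; rewrite /h /g /= max_r// -EFinM; congr EFin.
  by rewrite indicI !indicE.
rewrite (indep_law_integral iU (adapted_measurable Dm aX) aX mh h0).
rewrite -[RHS]mul1e.
transitivity (\int[Pr]_w ((\1_A w)%:E * G (Z w))).
  apply: eq_integral => w _; rewrite /h /= max_r// ge0_integralZl//.
  apply: (measurableT_comp mg); apply: measurable_addrV => //.
rewrite (indep_law_event sC Cm CA iZ mG G0) mul1e; congr (_ * _).
rewrite /G H//; rewrite integral_indic ?setIT//.
by rewrite -[X in measurable X]setTI; exact: mchi.
Qed.

Lemma indep_law_map n k (C : set (set Omega)) (Z : Omega -> 'rV[R]_n)
    (phi : 'rV[R]_d -> 'rV[R]_n) (f : 'rV[R]_n -> 'rV[R]_k) :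
  measurable_fun setT f -> indep_law Pr C Z phi ->
  indep_law Pr C (fun w => f (Z w)) (fun z => f (phi z)).
Proof.
move=> mf [mZ mphi iZ]; split; [exact: measurableT_comp mf mZ|exact: measurableT_comp mf mphi|].
move=> A B CA mB; apply: (iZ A (f @^-1` B)) => //.
by rewrite -[X in measurable X]setTI; exact: mf.
Qed.

Lemma indep_law_stable (C D : set (set Omega)) (Z U : Omega -> 'rV[R]_d) (a b c : R) :
  sigma_algebra setT C -> C `<=` D -> sigma_algebra setT D -> D `<=` measurable ->
  (0 < a)%R -> (0 < b)%R -> (0 < c)%R ->
  indep_law Pr C Z (fun z => a *: z)%R -> adapted D Z ->
  indep_law Pr D U (fun z => b *: z)%R ->
  indep_law Pr C (fun w => Z w + c *: U w)%R
    (fun z => Num.sqrt (a ^+ 2 + (c * b) ^+ 2) *: z)%R.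
Proof.
move=> sC CD sD Dm a0 b0 c0 iZ aZ iU.
apply: (indep_law_add sC CD sD Dm iZ aZ (psi := fun z => (c * b) *: z)%R).
- have -> : (fun z : 'rV[R]_d => (c * b) *: z)%R = (fun z => c *: (b *: z))%R.
    by apply/funext => z; rewrite scalerA.
  apply: (indep_law_map (f := fun z => c *: z)%R) iU.
  exact: measurable_scalerV.
- exact: measurable_scalerV.
- by move=> g mg g0; rewrite gauss_stable// mulr_gt0.
Qed.

End independent_sum.

(** * Second moments of stochastic integrals of step functions *)

Section polarization.
Context d (T : measurableType d) (R : realType).
Variable mu : {measure set T -> \bar R}.

(** Finite integrals of real functions, in the form of a relation that is
    stable under linear combinations. *)
Definition has_integral (f : T -> R) (r : R) :=
  mu.-integrable setT (EFin \o f) /\ (\int[mu]_x (f x)%:E = r%:E)%E.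

Lemma has_integralD f g r s : has_integral f r -> has_integral g s ->
  has_integral (fun x => f x + g x) (r + s).
Proof.
move=> [fi fr] [gi gs]; split.
  rewrite (_ : _ \o _ = (EFin \o f) \+ (EFin \o g))%E; first exact: integrableD.
  by apply/funext => x; rewrite /= EFinD.
under eq_integral do rewrite EFinD.
by rewrite integralD// fr gs.
Qed.

Lemma has_integralZ k f r : has_integral f r ->
  has_integral (fun x => k * f x) (k * r).
Proof.
move=> [fi fr]; split.
  rewrite (_ : _ \o _ = (fun x => k%:E * (EFin \o f) x)%E); first exact: integrableZl.
  by apply/funext => x; rewrite /= EFinM.
under eq_integral do rewrite EFinM.
by rewrite integralZl// fr.
Qed.

Lemma has_integral0 : has_integral (fun=> 0) 0.
Proof.
split; last by rewrite integral0_eq.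
by rewrite (_ : _ \o _ = cst 0%E)//; exact: integrable0.
Qed.

Lemma has_integral_sum (I : eqType) (s : seq I) (f : I -> T -> R) (r : I -> R) :
  (forall i, i \in s -> has_integral (f i) (r i)) ->
  has_integral (fun x => \sum_(i <- s) f i x) (\sum_(i <- s) r i).
Proof.
elim: s => [|i s IH] H.
  by rewrite big_nil; under eq_fun do rewrite big_nil; exact: has_integral0.
rewrite big_cons; under eq_fun do rewrite big_cons.
apply: has_integralD; first by apply: H; rewrite mem_head.
by apply: IH => j js; apply: H; rewrite inE js orbT.
Qed.

(** By polarization, four squared increments determine the inner product of two
    increments; when squared increments are proportional to lengths, the
    squared norm of a combination of increments is this form in the
    coefficients and endpoints. *)
Definition slope_form (l : seq (R * (R * R))) : R :=
  \sum_(e <- l) \sum_(f <- l) e.1 * f.1 / 2 *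
    (`|f.2.2 - e.2.1| + `|e.2.2 - f.2.1| - `|e.2.2 - f.2.2| - `|e.2.1 - f.2.1|).

(** The right-hand side depends on the process only through [c]. Comparing the
    Wiener process with [ray], whose increments are indicators of intervals,
    gives the isometry for step functions on unrelated subdivisions. *)
Lemma has_integral_increments (X : R -> T -> R) (c : R) (D : set R) l :
  (forall s t, D s -> D t -> has_integral (fun x => (X t x - X s x) ^+ 2) (c * `|t - s|)) ->
  (forall e, e \in l -> D e.2.1 /\ D e.2.2) ->
  has_integral (fun x => (\sum_(e <- l) e.1 * (X e.2.2 x - X e.2.1 x)) ^+ 2)
    (c * slope_form l).
Proof.
move=> HX HD.
pose q s t (x : T) := (X t x - X s x) ^+ 2.
pose g (e f : R * (R * R)) x := e.1 * f.1 / 2 *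
  (q e.2.1 f.2.2 x + q f.2.1 e.2.2 x + -1 * q f.2.2 e.2.2 x + -1 * q f.2.1 e.2.1 x).
have -> : (fun x => (\sum_(e <- l) e.1 * (X e.2.2 x - X e.2.1 x)) ^+ 2) =
    (fun x => \sum_(e <- l) \sum_(f <- l) g e f x).
  apply/funext => x; rewrite expr2 mulr_suml; apply: eq_bigr => e _.
  by rewrite mulr_sumr; apply: eq_bigr => f _; rewrite /g /q; field.
have -> : c * slope_form l = \sum_(e <- l) \sum_(f <- l) e.1 * f.1 / 2 *
    (c * `|f.2.2 - e.2.1| + c * `|e.2.2 - f.2.1| + -1 * (c * `|e.2.2 - f.2.2|)
    + -1 * (c * `|e.2.1 - f.2.1|)).
  rewrite /slope_form mulr_sumr; apply: eq_bigr => e _; rewrite mulr_sumr.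
  apply: eq_bigr => f _.
  by move: `|_ - _| `|_ - _| `|_ - _| `|_ - _| => x1 x2 x3 x4; field.
apply: has_integral_sum => e el; apply: has_integral_sum => f fl.
have [e1 e2] := HD _ el; have [f1 f2] := HD _ fl.
apply: has_integralZ; rewrite /q.
by repeat apply: has_integralD; try apply: has_integralZ; exact: HX.
Qed.

End polarization.

Section lebesgue_increments.
Variable R : realType.
Local Notation mu := (@lebesgue_measure R).

Definition ray (t : R) : R -> R := \1_(`]0, t]).

Lemma ray_sub (s t x : R) : 0 <= s -> s <= t ->
  ray t x - ray s x = \1_(`]s, t]) x.
Proof.
move=> s0 st; rewrite /ray !indicE.
have [xs|sx] := leP x s; have [x0|x0] := leP x 0; have [xt|tx] := leP x t.
- by rewrite !memNset ?subrr//= in_itv/= ?(le_gtF xs)// ltNge x0.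
- by move: tx; rewrite ltNge (le_trans xs).
- rewrite mem_set/= ?in_itv/= ?x0// mem_set/= ?in_itv/= ?x0// memNset/= ?subrr//.
  by rewrite in_itv/= ltNge xs.
- by move: tx; rewrite ltNge (le_trans xs).
- by move: sx; rewrite ltNge (le_trans x0).
- by move: sx; rewrite ltNge (le_trans x0).
- rewrite mem_set/= ?in_itv/= ?x0// memNset/= ?in_itv/= ?x0 ?leNgt ?sx//.
  by rewrite mem_set/= ?subr0// in_itv/= sx.
- by rewrite !memNset/= ?subrr// in_itv/= ?(lt_geF tx) ?(lt_geF sx) andbF.
Qed.

Lemma ray_increment (s t : R) : 0 <= s -> 0 <= t ->
  has_integral mu (fun x => (ray t x - ray s x) ^+ 2) (1 * `|t - s|).
Proof.
wlog st : s t / s <= t => [H s0 t0|s0 _].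
  have [st|/ltW ts] := leP s t; first exact: H.
  rewrite distrC; have := H _ _ ts t0 s0.
  by rewrite (_ : (fun x => _) = fun x => (ray t x - ray s x) ^+ 2)//; apply/funext => x; ring.
rewrite mul1r ger0_norm ?subr_ge0//.
have E : (fun x => (ray t x - ray s x) ^+ 2) = \1_(`]s, t]).
  apply/funext => x; rewrite ray_sub//.
  by rewrite indicE; case: (x \in _); rewrite ?expr1n// expr0n.
have muI : mu `]s, t]%classic = (t - s)%:E.
  by rewrite lebesgue_measure_itv/= lte_fin; case: ltgtP st => // -> _; rewrite subrr.
have I : (\int[mu]_x (\1_`]s, t] x : R)%:E = (t - s)%:E)%E.
  by rewrite integral_indic// setIT.
rewrite E; split => //.
apply/integrableP; split; first by apply/measurable_EFinP; exact: measurable_indic.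
under eq_integral do rewrite gee0_abs ?lee_fin//=.
by rewrite I ltry.
Qed.

End lebesgue_increments.

Section step_sums.
Variable R : realType.

Definition sf_list (phi : step_fun R) : seq (R * (R * R)) :=
  [seq (sf_val phi i, (sf_knot phi i, sf_knot phi i.+1)) | i <- iota 0 (sf_size phi)].

Definition sf_diff (phi psi : step_fun R) :=
  sf_list phi ++ [seq (- e.1, e.2) | e <- sf_list psi].

Lemma sf_diffE (phi psi : step_fun R) (x : R -> R) :
  \sum_(e <- sf_diff phi psi) e.1 * (x e.2.2 - x e.2.1) =
  \sum_(i < sf_size phi) sf_val phi i * (x (sf_knot phi i.+1) - x (sf_knot phi i)) -
  \sum_(i < sf_size psi) sf_val psi i * (x (sf_knot psi i.+1) - x (sf_knot psi i)).
Proof.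
have E (chi : step_fun R) :
    \sum_(e <- sf_list chi) e.1 * (x e.2.2 - x e.2.1) =
    \sum_(i < sf_size chi) sf_val chi i * (x (sf_knot chi i.+1) - x (sf_knot chi i)).
  rewrite big_map -(big_mkord xpredT (fun i =>
    sf_val chi i * (x (sf_knot chi i.+1) - x (sf_knot chi i)))).
  by rewrite /index_iota subn0.
rewrite /sf_diff big_cat /= -!E; congr (_ + _).
rewrite (big_map (fun e : R * (R * R) => (- e.1, e.2)) xpredT
  (fun e : R * (R * R) => e.1 * (x e.2.2 - x e.2.1))) -sumrN.
by apply: eq_bigr => i _; rewrite mulNr.
Qed.

Lemma sf_knot_ge (a b : R) (phi : step_fun R) i : sf_subdivision a b phi ->
  (i <= sf_size phi)%N -> a <= sf_knot phi i.
Proof.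
move=> [k0 _ mono]; elim: i => [_|i IH isz]; first by rewrite k0.
exact: le_trans (IH (ltnW isz)) (mono _ isz).
Qed.

Lemma sf_diff_ge0 (a b : R) (phi psi : step_fun R) e : 0 <= a ->
  sf_subdivision a b phi -> sf_subdivision a b psi ->
  e \in sf_diff phi psi -> 0 <= e.2.1 /\ 0 <= e.2.2.
Proof.
move=> a0 sphi spsi.
have H chi e' : sf_subdivision a b chi -> e' \in sf_list chi ->
    0 <= e'.2.1 /\ 0 <= e'.2.2.
  move=> schi /mapP[i]; rewrite mem_iota add0n => /andP[_ isz] ->/=.
  by split; apply: le_trans a0 (sf_knot_ge schi _) => //; exact: ltnW.
rewrite mem_cat => /orP[el|/mapP[e' el ->]]; [exact: H el|exact: H el].
Qed.

Lemma sf_fun_ray (a b : R) (phi : step_fun R) t : 0 <= a -> sf_subdivision a b phi ->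
  sf_fun phi t = \sum_(i < sf_size phi)
    sf_val phi i * (ray (sf_knot phi i.+1) t - ray (sf_knot phi i) t).
Proof.
move=> a0 sphi; apply: eq_bigr => i _; rewrite ray_sub//.
- by apply: le_trans a0 (sf_knot_ge sphi _); exact: ltnW.
- by have [_ _] := sphi; apply.
Qed.

Lemma measurable_sf_fun (phi : step_fun R) : measurable_fun setT (sf_fun phi).
Proof.
by apply: measurable_sum => i; exact: measurable_funM.
Qed.

End step_sums.

Section brownian.
Local Open Scope ereal_scope.
Variables (R : realType) (disp : measure_display) (Omega : measurableType disp).
Variables (Pr : probability Omega R) (d : nat) (Ft : R -> set (set Omega)).
Variables (W : 'I_d -> R -> Omega -> R).
Hypotheses (hFt : filtration Ft) (hW : wiener_process Pr Ft W).

Lemma filtration_sigma t : (0 <= t)%R -> sigma_algebra setT (Ft t).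
Proof. by move=> t0; have [/(_ t t0)[]] := hFt. Qed.

Lemma filtration_measurable t : (0 <= t)%R -> Ft t `<=` measurable.
Proof. by move=> t0; have [/(_ t t0)[]] := hFt. Qed.

Lemma filtration_mono s t : (0 <= s)%R -> (s <= t)%R -> Ft s `<=` Ft t.
Proof. by have [_] := hFt; apply. Qed.

Lemma adapted_wiener k t : (0 <= t)%R -> adapted (Ft t) (W k t : Omega -> measurableTypeR R).
Proof. by move=> t0 B mB; have [+ _ _ _ _] := hW; apply. Qed.

Lemma measurable_wiener k t : (0 <= t)%R -> measurable_fun setT (W k t).
Proof.
move=> t0; exact: adapted_measurable (filtration_measurable t0) (adapted_wiener k t0).
Qed.

Definition increment (s t : R) (w : Omega) : 'rV[R]_d := \row_k (W k t w - W k s w)%R.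

Lemma adapted_increment s t : (0 <= s)%R -> (s <= t)%R -> adapted (Ft t) (increment s t).
Proof.
move=> s0 st; have t0 := le_trans s0 st.
have sT := filtration_sigma t0.
apply: adapted_rV => // k; apply/(adaptedP _ sT).
have -> : (fun w => increment s t w ord0 k) = (W k t \- W k s)%R.
  by apply/funext => w; rewrite mxE.
apply: measurable_funB; apply/(adaptedP _ sT); first exact: adapted_wiener.
exact: adapted_mono (filtration_mono s0 st) (adapted_wiener k s0).
Qed.

Lemma normal_prob_scale (s : R) (B : set R) : (0 < s)%R -> measurable B ->
  normal_prob 0%R s B = normal_prob (0:R) 1 ((fun x => s * x)%R @^-1` B).
Proof.
move=> s0 mB.
have mg : measurable_fun [set: measurableTypeR R] (fun x => (\1_B x : R)%:E).
  by apply/measurable_EFinP; exact: measurable_indic.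
have g0 (x : R) : 0 <= (\1_B x : R)%:E by rewrite lee_fin.
have mB' : measurable ((fun x => s * x)%R @^-1` B).
  rewrite -[X in measurable X]setTI; exact: (@measurable_funM _ _ R setT (cst s) id).
have indE (m : {measure set (measurableTypeR R) -> \bar R}) A : measurable A ->
    \int[m]_x (\1_A x : R)%:E = m A.
  by move=> mA; rewrite integral_indic// setIT.
transitivity (\int[normal_prob 0%R s]_x (\1_B x : R)%:E); first exact/esym/indE.
transitivity (\int[normal_prob (0:R) 1]_x
    (\1_((fun x => s * x)%R @^-1` B) x : R)%:E); last exact: indE.
exact: (ge0_integral_normal_scale s0 mg g0).
Qed.

Lemma increment_law s t : (0 <= s)%R -> (s < t)%R ->
  indep_law Pr (Ft s) (increment s t) (fun z => Num.sqrt (t - s) *: z)%R.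
Proof.
move=> s0 st; have t0 : (0 <= t)%R by rewrite (le_trans s0)// ltW.
have r0 : (0 < Num.sqrt (t - s))%R by rewrite sqrtr_gt0 subr_gt0.
have [_ _ _ W4 W5] := hW.
apply: indep_law_box; first exact: filtration_measurable.
- exact: adapted_measurable (filtration_measurable t0) (adapted_increment s0 (ltW st)).
- exact: measurable_scalerV.
move=> A B FA mB.
have mrB k : measurable ((fun x : R => Num.sqrt (t - s) * x)%R @^-1` B k).
  rewrite -[X in measurable X]setTI.
  by apply: (@measurable_funM _ _ R setT (cst (Num.sqrt (t - s))) id).
transitivity (Pr (A `&` [set w | forall k, B k (W k t w - W k s w)%R])).
  congr (Pr (A `&` _)); apply/seteqP; split=> w /= H k; have := H k; by rewrite mxE.
rewrite W5//; congr (_ * _).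
transitivity (gauss_rV R d (box (fun k => (fun x : R => Num.sqrt (t - s) * x)%R @^-1` B k))).
  rewrite (gauss_box mrB); apply: eq_bigr => k _.
  rewrite (W4 k s t s0 st _ (mB k)); exact: normal_prob_scale.
have -> // : box (fun k => (fun x : R => Num.sqrt (t - s) * x)%R @^-1` B k) =
  (fun z : 'rV[R]_d => Num.sqrt (t - s) *: z)%R @^-1` box B.
by apply/seteqP; split=> z /= H k; have := H k; rewrite /= mxE.
Qed.

(** The variance of the standard normal law, as an abstract finite constant. *)
Definition normal_var : R := fine (\int[normal_prob (0:R) 1]_x (x ^+ 2)%:E).

Lemma normal_varE : \int[normal_prob (0:R) 1]_x (x ^+ 2)%:E = normal_var%:E.
Proof.
rewrite /normal_var fineK// ge0_fin_numE; last first.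
  by apply: integral_ge0 => x _; rewrite lee_fin sqr_ge0.
have [_ /(_ 2%N)] := @moments_normal R.
by under eq_integral do rewrite -normrX ger0_norm ?sqr_ge0//.
Qed.

Lemma wiener_increment k s t : (0 <= s)%R -> (0 <= t)%R ->
  has_integral Pr (fun w => (W k t w - W k s w) ^+ 2)%R (normal_var * `|t - s|)%R.
Proof.
wlog st : s t / (s < t)%R => [H s0 t0|s0 t0].
  have [st|ts|->] := ltgtP s t; first exact: H.
    have := H _ _ ts t0 s0; rewrite distrC.
    rewrite (_ : (fun x => _) = fun w => (W k t w - W k s w) ^+ 2)%R//.
    by apply/funext => x; ring.
  rewrite subrr normr0 mulr0.
  rewrite (_ : (fun x => _) = fun=> 0%R); first exact: has_integral0.
  by apply/funext => x; rewrite subrr expr0n.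
have r0 : (0 < Num.sqrt (t - s))%R by rewrite sqrtr_gt0 subr_gt0.
have mD : measurable_fun setT
    ((fun w => W k t w - W k s w)%R : Omega -> measurableTypeR R).
  by apply: measurable_funB; exact: measurable_wiener.
have msq : measurable_fun [set: measurableTypeR R] (fun x : R => (x ^+ 2)%:E).
  by apply/measurable_EFinP; exact: measurable_funX.
have sq0 (x : R) : 0 <= (x ^+ 2)%:E by rewrite lee_fin sqr_ge0.
have I : \int[Pr]_w ((W k t w - W k s w) ^+ 2)%:E = (normal_var * `|t - s|)%:E.
  have := @ge0_integral_pushforward _ _ _ _ R _ mD Pr setT _ measurableT msq
    (fun y _ => sq0 y).
  rewrite preimage_setT => E; rewrite -[LHS]E.
  transitivity (\int[normal_prob 0%R (Num.sqrt (t - s))]_x (x ^+ 2)%:E).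
    transitivity (\int[pushm Pr mD]_x (x ^+ 2)%:E) => //.
    apply: eq_measure_integral => A mA _.
    by have [_ _ _ W4 _] := hW; exact: (W4 k s t s0 st A mA).
  rewrite (ge0_integral_normal_scale r0 msq sq0).
  under eq_integral do rewrite exprMn EFinM.
  rewrite ge0_integralZl// normal_varE -EFinM sqr_sqrtr ?subr_ge0 1?ltW//.
  by rewrite mulrC gtr0_norm// subr_gt0.
split => //; apply/integrableP; split.
  by apply/measurable_EFinP; exact: measurable_funX.
under eq_integral do rewrite gee0_abs//=.
by rewrite I ltry.
Qed.

Lemma wiener_isometry k (a b : R) (phi psi : step_fun R) : (0 <= a)%R ->
  sf_subdivision a b phi -> sf_subdivision a b psi ->
  \int[Pr]_w ((sf_wiener_integral (W k) phi w - sf_wiener_integral (W k) psi w) ^+ 2)%:E =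
  normal_var%:E * \int[lebesgue_measure]_t ((sf_fun phi t - sf_fun psi t) ^+ 2)%:E.
Proof.
move=> a0 sphi spsi.
have H e := @sf_diff_ge0 R a b phi psi e a0 sphi spsi.
have [_ HW] := @has_integral_increments _ _ _ Pr (W k) normal_var [set t | 0 <= t]%R
  (sf_diff phi psi) (fun s t s0 t0 => wiener_increment k s0 t0) H.
have [_ HL] := @has_integral_increments _ _ _ lebesgue_measure (@ray R) 1 [set t | 0 <= t]%R
  (sf_diff phi psi) (fun s t s0 t0 => ray_increment s0 t0) H.
transitivity (normal_var%:E * (1 * slope_form (sf_diff phi psi))%:E).
  rewrite -EFinM mul1r -HW; apply: eq_integral => w _.
  by rewrite (sf_diffE phi psi (fun t => W k t w)).
rewrite -HL; congr (_ * _); apply: eq_integral => t _.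
by rewrite (sf_diffE phi psi (fun u => ray u t)) (sf_fun_ray _ a0 sphi)
  (sf_fun_ray _ a0 spsi).
Qed.

End brownian.

(** * Step approximation of the exponential kernel *)

Section L2_limits.
Local Open Scope ereal_scope.
Context d (T : measurableType d) (R : realType).
Variable mu : {measure set T -> \bar R}.

Lemma ge0_le_integral_sqrD (D : set T) (f g h : T -> R) : measurable D ->
  measurable_fun D f -> measurable_fun D g -> measurable_fun D h ->
  \int[mu]_(x in D) ((f x - h x) ^+ 2)%:E <=
  2%:E * \int[mu]_(x in D) ((f x - g x) ^+ 2)%:E +
  2%:E * \int[mu]_(x in D) ((g x - h x) ^+ 2)%:E.
Proof.
move=> mD mf mg mh.
have msq (u v : T -> R) : measurable_fun D u -> measurable_fun D v ->
    measurable_fun D (fun x => ((u x - v x) ^+ 2)%:E).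
  move=> mu' mv; apply/measurable_EFinP/measurable_funX; exact: measurable_funB.
have sq0 (x : R) : 0 <= (x ^+ 2)%:E by rewrite lee_fin sqr_ge0.
have mfg := msq _ _ mf mg; have mgh := msq _ _ mg mh.
have m2 (u : T -> \bar R) : measurable_fun D u -> measurable_fun D (fun x => 2%:E * u x).
  by move=> mu'; exact: (measurable_funeM 2%:E mu').
rewrite -!ge0_integralZl//; try by [].
rewrite -ge0_integralD//; try by move=> x _; rewrite mule_ge0.
- apply: ge0_le_integral => //.
  + exact: msq.
  + exact: (emeasurable_funD (m2 _ mfg) (m2 _ mgh)).
  + move=> x _; rewrite -!EFinM -EFinD lee_fin -subr_ge0.
    have -> : (2 * (f x - g x) ^+ 2 + 2 * (g x - h x) ^+ 2 - (f x - h x) ^+ 2)%R =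
       (((f x - g x) - (g x - h x)) ^+ 2)%R by ring.
    exact: sqr_ge0.
- exact: m2.
- exact: m2.
Qed.

(** Chebyshev and Borel-Cantelli in one stroke: the sum of the squares has a
    finite integral, so it is finite almost everywhere. *)
Lemma ae_cvg0_summable (X : nat -> T -> R) (C : R) :
  (forall j, measurable_fun setT (X j)) ->
  (forall j, \int[mu]_x ((X j x) ^+ 2)%:E <= (C / (2 ^ (j + 1))%:R)%:E) ->
  {ae mu, forall x, X j x @[j --> \oo] --> 0%R}.
Proof.
move=> mX bX.
pose u j x : \bar R := ((X j x) ^+ 2)%:E.
have mu_ j : measurable_fun setT (u j) by apply/measurable_EFinP/measurable_funX.
have u0 j x : 0 <= u j x by rewrite lee_fin sqr_ge0.
have mS : measurable_fun setT (fun x => \sum_(j <oo) u j x).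
  by apply: ge0_emeasurable_sum => // k x _ _.
have iS : mu.-integrable setT (fun x => \sum_(j <oo) u j x).
  apply/integrableP; split => //.
  under eq_integral do rewrite gee0_abs ?nneseries_ge0//.
  rewrite integral_nneseries//.
  apply: (@le_lt_trans _ _ (\sum_(j <oo) (C / (2 ^ (j + 1))%:R)%:E)).
    apply: lee_nneseries => [j _ _|j _]; [exact: integral_ge0|exact: bX].
  by have /cvg_lim := @cvg_geometric_eseries_half R C 0; rewrite /eseries => ->//; rewrite ltry.
apply: filterS (integrable_ae measurableT iS) => x /(_ Logic.I) fx.
have /nnseries_is_cvg H : \sum_(j <oo) ((X j x) ^+ 2)%:E < +oo.
  by rewrite ltey_eq fx.
have /cvg_series_cvg_0 c0 := H (fun i => sqr_ge0 _).
have : Num.sqrt ((X j x) ^+ 2) @[j --> \oo] --> Num.sqrt 0%R.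
  exact: (continuous_cvg _ (@sqrt_continuous _ _) c0).
rewrite sqrtr0; under eq_fun do rewrite sqrtr_sqr.
exact: norm_cvg0.
Qed.

End L2_limits.

Section exponential_kernel.
Variables (R : realType) (v a b : R).
Hypotheses (v0 : 0 < v) (a0 : 0 <= a) (ab : a < b).
Local Notation mu := (@lebesgue_measure R).

(** The kernel of the stochastic integral on the step from [a] to [b]; the
    derivative of [ker_prim] is its square. *)
Definition ker (t : R) : R := expR (- v * (b - t)).

Definition ker_prim (t : R) : R := ker t ^+ 2 / (2 * v).

Definition knot n i : R := a + i%:R * ((b - a) / n.+1%:R).

Definition mesh n : R := (b - a) / n.+1%:R.

(** On each interval of the uniform subdivision the step function takes the
    quadratic mean of the kernel, so that the variance of its stochastic
    integral is exactly that of the kernel. *)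
Definition ker_val n i : R :=
  Num.sqrt ((ker_prim (knot n i.+1) - ker_prim (knot n i)) / mesh n).

Definition ker_step (c : R) n : step_fun R :=
  StepFun n.+1 (knot n) (fun i => c * ker_val n i).

Lemma ker_gt0 t : 0 < ker t. Proof. exact: expR_gt0. Qed.

Lemma ker_sqrt t : ker t = Num.sqrt (ker t ^+ 2).
Proof. by rewrite sqrtr_sqr gtr0_norm ?ker_gt0. Qed.

Lemma kerD s t : ker t = ker s * expR (v * (t - s)).
Proof. by rewrite /ker -expRD; congr expR; ring. Qed.

Lemma mesh_gt0 n : 0 < mesh n. Proof. by rewrite divr_gt0 ?subr_gt0. Qed.

Lemma knotS n i : knot n i.+1 - knot n i = mesh n.
Proof. by rewrite /knot /mesh -natr1; ring. Qed.

Lemma knot0 n : knot n 0 = a. Proof. by rewrite /knot mul0r addr0. Qed.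

Lemma knot_last n : knot n n.+1 = b.
Proof. by rewrite /knot mulrC divfK ?pnatr_eq0// addrC subrK. Qed.

Lemma knot_lt n i : knot n i < knot n i.+1.
Proof. by rewrite -subr_gt0 knotS mesh_gt0. Qed.

Lemma knot_le n i : a <= knot n i.
Proof. by rewrite /knot lerDl mulr_ge0// ltW// mesh_gt0. Qed.

Lemma knot_le_last n i : (i <= n.+1)%N -> knot n i <= b.
Proof.
move=> ni; rewrite -(knot_last n) /knot lerD2l ler_wpM2r ?ler_nat//.
exact/ltW/mesh_gt0.
Qed.

Lemma ker_step_subdivision c n : sf_subdivision a b (ker_step c n).
Proof. by split; [exact: knot0|exact: knot_last|move=> i _; exact/ltW/knot_lt]. Qed.

Lemma ker_prim_ge s t : s <= t -> ker s ^+ 2 * (t - s) <= ker_prim t - ker_prim s.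
Proof.
move=> st; rewrite /ker_prim -mulrBl ler_pdivlMr ?mulr_gt0// (kerD s t) exprMn.
have : 1 + 2 * v * (t - s) <= expR (v * (t - s)) ^+ 2.
  by rewrite -expRM_natl mulrA; exact: expR_ge1Dx.
have : 0 <= ker s ^+ 2 by exact: sqr_ge0.
move: (expR _ ^+ 2) (ker s ^+ 2) => x y y0 xy; rewrite -subr_ge0.
have -> : y * x - y - y * (t - s) * (2 * v) = y * (x - (1 + 2 * v * (t - s))) by ring.
by rewrite mulr_ge0// subr_ge0.
Qed.

Lemma ker_prim_le s t : s <= t -> ker_prim t - ker_prim s <= ker t ^+ 2 * (t - s).
Proof.
move=> st; rewrite /ker_prim -mulrBl ler_pdivrMr ?mulr_gt0// (kerD t s) exprMn.
have : 1 + 2 * v * (s - t) <= expR (v * (s - t)) ^+ 2.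
  by rewrite -expRM_natl mulrA; exact: expR_ge1Dx.
have : 0 <= ker t ^+ 2 by exact: sqr_ge0.
move: (expR _ ^+ 2) (ker t ^+ 2) => x y y0 xy; rewrite -subr_ge0.
have -> : y * (t - s) * (2 * v) - (y - y * x) = y * (x - (1 + 2 * v * (s - t))) by ring.
by rewrite mulr_ge0// subr_ge0.
Qed.

Lemma ker_val_ge n i : ker (knot n i) <= ker_val n i.
Proof.
rewrite [leLHS]ker_sqrt /ker_val ler_wsqrtr//.
by rewrite ler_pdivlMr ?mesh_gt0// -(knotS n i) ker_prim_ge// ltW// knot_lt.
Qed.

Lemma ker_val_le n i : ker_val n i <= ker (knot n i.+1).
Proof.
rewrite [leRHS]ker_sqrt /ker_val ler_wsqrtr//.
by rewrite ler_pdivrMr ?mesh_gt0// -(knotS n i) ker_prim_le// ltW// knot_lt.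
Qed.

Lemma ker_val_gt0 n i : 0 < ker_val n i.
Proof. exact: lt_le_trans (ker_gt0 _) (ker_val_ge n i). Qed.

Lemma sqr_ker_val n i :
  ker_val n i ^+ 2 * mesh n = ker_prim (knot n i.+1) - ker_prim (knot n i).
Proof.
rewrite /ker_val sqr_sqrtr ?divfK//; first by rewrite gt_eqF ?mesh_gt0.
rewrite divr_ge0//; last exact/ltW/mesh_gt0.
apply: le_trans (ker_prim_ge (ltW (knot_lt n i))).
by rewrite mulr_ge0 ?sqr_ge0// knotS ltW// mesh_gt0.
Qed.

Lemma ker_prim_lt n i : ker_prim (knot n i) < ker_prim (knot n i.+1).
Proof. by rewrite -subr_gt0 -sqr_ker_val mulr_gt0 ?mesh_gt0// exprn_gt0// ker_val_gt0. Qed.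

Lemma ker_le s t : s <= t -> ker s <= ker t.
Proof. by move=> st; rewrite ler_expR !mulNr lerN2 ler_pM2l// lerB. Qed.

(** Both numbers lie between the values of the kernel at the ends of the
    interval. *)
Lemma ker_val_near n i t : (i < n.+1)%N -> knot n i < t <= knot n i.+1 ->
  `|ker t - ker_val n i| <= v * mesh n.
Proof.
move=> ni /andP[/ltW it ti].
have h1 := ker_val_ge n i; have h2 := ker_val_le n i.
have h3 := ker_le it; have h4 := ker_le ti.
suff : ker (knot n i.+1) - ker (knot n i) <= v * mesh n.
  by rewrite ler_distlC; move=> h5; apply/andP; split; lra.
rewrite (kerD (knot n i.+1) (knot n i)).
have k1 : ker (knot n i.+1) <= 1.
  rewrite /ker -expR0 ler_expR mulNr oppr_le0 mulr_ge0 ?(ltW v0)// subr_ge0.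
  exact: knot_le_last.
have e1 : 1 - v * mesh n <= expR (v * (knot n i - knot n i.+1)).
  rewrite -(knotS n i); apply: le_trans (expR_ge1Dx _).
  by rewrite lerD2l -mulrN opprB.
have vm : 0 <= v * mesh n by rewrite mulr_ge0 ?ltW// mesh_gt0.
have k0 := ker_gt0 (knot n i.+1).
move: (ker _) (expR _) (v * mesh n) k1 e1 vm k0 => k e m k1 e1 m0 k0; nra.
Qed.

(** The indicators of the intervals add up to 1, so the error is a convex
    combination of the errors of [ker_val_near]. *)
Lemma ker_step_near c n t : a < t <= b ->
  `|c * ker t - sf_fun (ker_step c n) t| <= `|c| * (v * mesh n).
Proof.
move=> /andP[at_ tb].
have one : \sum_(i < n.+1) \1_(`]knot n i, knot n i.+1]) t = 1 :> R.
  rewrite -(big_mkord xpredT (fun i => \1_(`]knot n i, knot n i.+1]) t)) /=.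
  under eq_bigr do rewrite -ray_sub ?(le_trans a0) ?knot_le ?(ltW (knot_lt _ _))//.
  rewrite telescope_sumr// knot0 knot_last ray_sub// ?ltW//.
  by rewrite indicE mem_set//= in_itv/= at_ tb.
rewrite -[c * ker t]mulr1 -{1}one mulr_sumr /sf_fun /= -sumrB.
rewrite -[leRHS]mulr1 -one mulr_sumr (le_trans (ler_norm_sum _ _ _))//.
apply: ler_sum => i _; rewrite -mulrBl normrM -mulrBr normrM.
rewrite indicE; case: (boolP (t \in _)) => [|_]; last by rewrite normr0 !mulr0.
rewrite inE/= in_itv/= => ti; rewrite normr1 !mulr1 ler_wpM2l//.
by apply: ker_val_near => //; exact: ltn_ord.
Qed.

Lemma ker_step_L2 c n :
  (\int[mu]_(t in `[a, b]) ((c * ker t - sf_fun (ker_step c n) t) ^+ 2)%:E <=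
   ((c * (v * mesh n)) ^+ 2 * (b - a))%:E)%E.
Proof.
have mD : measurable_fun setT (fun t => c * ker t - sf_fun (ker_step c n) t).
  apply: measurable_funB; last exact: measurable_sf_fun.
  apply: measurable_funM => //; apply: measurableT_comp => //.
  by apply: measurable_funM => //; exact: measurable_funB.
have mD2 (D : set R) : measurable_fun D
    (fun t => ((c * ker t - sf_fun (ker_step c n) t) ^+ 2)%:E).
  by apply: measurable_funTS; apply/measurable_EFinP; exact: measurable_funX.
rewrite -integral_itv_obnd_cbnd//.
have -> : ((c * (v * mesh n)) ^+ 2 * (b - a))%:E =
    (\int[mu]_(t in `]a, b]) ((c * (v * mesh n)) ^+ 2)%:E)%E.
  rewrite integral_cst//= lebesgue_measure_itv/= lte_fin ab.
  by rewrite -EFinB -EFinM.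
apply: ge0_le_integral => //.
- by move=> t _; rewrite lee_fin sqr_ge0.
- exact: mD2.
- move=> t; rewrite /= in_itv/= lee_fin => tab.
  have vm : 0 <= v * mesh n by rewrite mulr_ge0 ?ltW// mesh_gt0.
  rewrite -[leLHS]real_normK ?num_real// -[leRHS]real_normK ?num_real//.
  by rewrite lerXn2r ?nnegrE// normrM (ger0_norm vm); exact: ker_step_near.
Qed.

End exponential_kernel.

(** * Stochastic integrals as limits *)

Section wiener_integral.
Local Open Scope ereal_scope.
Variables (R : realType) (disp : measure_display) (Omega : measurableType disp).
Variables (Pr : probability Omega R) (d : nat) (Ft : R -> set (set Omega)).
Variables (W : 'I_d -> R -> Omega -> R).
Hypotheses (hFt : filtration Ft) (hW : wiener_process Pr Ft W).
Local Notation mu := (@lebesgue_measure R).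

Lemma sf_fun_out (a b : R) (phi : step_fun R) t : sf_subdivision a b phi ->
  ~ `[a, b]%classic t -> sf_fun phi t = 0%R.
Proof.
move=> sphi nt; rewrite /sf_fun big1// => i _.
rewrite indicE memNset ?mulr0//= in_itv/= => /andP[it ti]; apply: nt.
have ia := sf_knot_ge sphi (ltnW (ltn_ord i)).
have [_ kb mono] := sphi.
have ib : forall j, (j <= sf_size phi)%N -> (sf_knot phi (sf_size phi - j) <= b)%R.
  elim=> [|j IH] jsz; first by rewrite subn0 kb.
  apply: le_trans (IH (ltnW jsz)); rewrite -(subnSK jsz); apply: mono.
  by rewrite ltn_subrL/= (leq_ltn_trans _ jsz).
rewrite /= in_itv/= (le_trans ia (ltW it)) (le_trans ti)//.
by have := ib (sf_size phi - i.+1)%N (leq_subr _ _); rewrite subKn.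
Qed.

Lemma measurable_sf_integral k (a b : R) (phi : step_fun R) : (0 <= a)%R ->
  sf_subdivision a b phi -> measurable_fun setT (sf_wiener_integral (W k) phi).
Proof.
move=> a0 sphi; apply: measurable_sum => i; apply: measurable_funM => //.
have k0 j : (j <= sf_size phi)%N -> (0 <= sf_knot phi j)%R.
  by move=> jsz; apply: le_trans a0 (sf_knot_ge sphi jsz).
apply: measurable_funB; apply: (measurable_wiener hFt hW); apply: k0 => //.
exact: ltnW.
Qed.

Lemma normal_var_ge0 : (0 <= normal_var R)%R.
Proof. by apply/fine_ge0/integral_ge0 => x _; rewrite lee_fin sqr_ge0. Qed.

(** Pass through the defining approximation [phi n]. The isometry turns the
    second half of the error into an L^2 distance of step functions; the
    constant 4 comes from using [(x + y)^2 <= 2 x^2 + 2 y^2] twice. *)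
Lemma wiener_integral_approx k (a b : R) f I (psi : step_fun R) (D : R) : (0 <= a)%R ->
  is_wiener_integral Pr (W k) a b f I -> measurable_fun setT f ->
  sf_subdivision a b psi ->
  \int[mu]_(t in `[a, b]) ((f t - sf_fun psi t) ^+ 2)%:E <= D%:E ->
  \int[Pr]_w ((I w - sf_wiener_integral (W k) psi w) ^+ 2)%:E <=
  (4 * normal_var R * D)%:E.
Proof.
move=> a0 [mI [phi [sphi fphi Iphi]]] mf spsi fD.
have mS chi : sf_subdivision a b chi -> measurable_fun setT (sf_wiener_integral (W k) chi).
  exact: measurable_sf_integral.
have mF chi : measurable_fun `[a, b]%classic (sf_fun chi).
  by apply: measurable_funTS; exact: measurable_sf_fun.
have mfD : measurable_fun `[a, b]%classic f by exact: measurable_funTS.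
set A := (fun n => _) in Iphi; set B := (fun n => _) in fphi.
have sq0 (x : R) : 0 <= (x ^+ 2)%:E by rewrite lee_fin sqr_ge0.
have c0 : 0 <= (normal_var R)%:E by rewrite lee_fin normal_var_ge0.
have cv : (fun n => 2%:E * A n + (4 * normal_var R)%:E * B n +
    (4 * normal_var R * D)%:E) @ \oo --> (4 * normal_var R * D)%:E.
  rewrite -[X in _ --> X]add0e; apply: cvgeD => //; last exact: cvg_cst.
  rewrite -[X in _ --> X]adde0; apply: cvgeD => //.
  - by rewrite -(mule0 2%:E); exact: cvgeZl.
  - by rewrite -(mule0 (4 * normal_var R)%:E); exact: cvgeZl.
apply: cvge_ge cv; near=> n.
apply: le_trans (ge0_le_integral_sqrD Pr measurableT mI (mS _ (sphi n)) (mS _ spsi)) _.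
rewrite -addeA leeD2l//.
rewrite (wiener_isometry hFt hW k a0 (sphi n) spsi).
have -> : \int[mu]_t ((sf_fun (phi n) t - sf_fun psi t) ^+ 2)%:E =
    \int[mu]_(t in `[a, b]) ((sf_fun (phi n) t - sf_fun psi t) ^+ 2)%:E.
  rewrite [RHS]integral_mkcond; apply: eq_integral => t _; rewrite patchE.
  case: ifPn => // /negP; rewrite inE => nt.
  by rewrite (sf_fun_out (sphi n) nt) (sf_fun_out spsi nt) subrr expr0n.
have := ge0_le_integral_sqrD mu (measurable_itv _) (mF (phi n)) mfD (mF psi).
have -> : \int[mu]_(x in `[a, b]) ((sf_fun (phi n) x - f x) ^+ 2)%:E = B n.
  by apply: eq_integral => t _; congr EFin; ring.
move=> H; apply: (@le_trans _ _ (2%:E * ((normal_var R)%:E * (2%:E * B n + 2%:E * D%:E)))).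
  rewrite lee_pmul2l//; apply: lee_wpmul2l => //.
  by apply: le_trans H _; rewrite leeD2l// lee_pmul2l.
have B0 : 0 <= B n by apply: integral_ge0 => x _; exact: sq0.
have D0 : (0 <= D)%R by rewrite -lee_fin (le_trans _ fD)// integral_ge0.
rewrite muleA ge0_muleDr ?mule_ge0//.
rewrite !muleA -!EFinM.
have -> : (2 * normal_var R * 2 = 4 * normal_var R)%R by ring.
by [].
Unshelve. all: end_near. Qed.

End wiener_integral.

(** * The noise of one step *)

Lemma cvg_rV (R : realType) n (u : nat -> 'rV[R]_n) (x : 'rV[R]_n) :
  (forall i, u j ord0 i @[j --> \oo] --> x ord0 i) -> u j @[j --> \oo] --> x.
Proof.
move=> cu; apply/cvgrPdist_lt => e e0.
have : \forall j \near \oo, forall i, `|x ord0 i - u j ord0 i| < e.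
  by apply: filter_forall => i; have /cvgrPdist_lt := cu i; apply.
by apply: filterS => j fj; apply: norm_rV_lt => // i; rewrite !mxE.
Qed.

Section exponential_noise.
Local Open Scope ereal_scope.
Variables (R : realType) (disp : measure_display) (Omega : measurableType disp).
Variables (Pr : probability Omega R) (d m : nat) (Ft : R -> set (set Omega)).
Variables (W : 'I_d -> R -> Omega -> R) (sigma : 'I_d -> 'rV[R]_m).
Hypotheses (hFt : filtration Ft) (hW : wiener_process Pr Ft W).
Variables (v a b : R).
Hypotheses (v0 : (0 < v)%R) (a0 : (0 <= a)%R) (ab : (a < b)%R).
Local Notation knot := (knot a b).
Local Notation prim := (ker_prim v b).

Definition noise_mx : 'M[R]_(d, m) := \matrix_(k, i) sigma k ord0 i.

Definition noise_std : R := Num.sqrt (prim b - prim a).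

Definition partial_noise n j (w : Omega) : 'rV[R]_d :=
  (\sum_(i < j) ker_val v a b n i *: increment W (knot n i) (knot n i.+1) w)%R.

Let knot_ge0 n i : (0 <= knot n i)%R := le_trans a0 (knot_le ab n i).

Lemma adapted_partial_noise n j : adapted (Ft (knot n j)) (partial_noise n j).
Proof.
have sF i := filtration_sigma hFt (knot_ge0 n i).
elim: j => [|j IH].
  rewrite (_ : partial_noise n 0 = fun=> 0%R); first exact: adapted_cst.
  by apply/funext => w; rewrite /partial_noise big_ord0.
have -> : partial_noise n j.+1 = (fun w => partial_noise n j w +
    ker_val v a b n j *: increment W (knot n j) (knot n j.+1) w)%R.
  by apply/funext => w; rewrite /partial_noise big_ord_recr.
apply/(adaptedP _ (sF _)); apply: measurable_addrV.
  apply/(adaptedP _ (sF _)); apply: adapted_mono IH.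
  by apply: (filtration_mono hFt) => //; exact/ltW/knot_lt.
apply: measurable_scalerV => //; apply/(adaptedP _ (sF _)).
by apply: (adapted_increment hFt hW) => //; exact/ltW/knot_lt.
Qed.

Lemma ker_val_std n i : (ker_val v a b n i * Num.sqrt (knot n i.+1 - knot n i) =
  Num.sqrt (prim (knot n i.+1) - prim (knot n i)))%R.
Proof.
have k0 := ltW (ker_val_gt0 v0 ab n i).
by rewrite -(sqr_ker_val v0 ab) sqrtrM ?sqr_ge0// sqrtr_sqr ger0_norm// knotS.
Qed.

Lemma prim_gt n j : (0 < prim (knot n j.+1) - prim a)%R.
Proof.
rewrite subr_gt0; elim: j => [|j IH].
  by have := ker_prim_lt v0 ab n 0; rewrite knot0.
exact: lt_trans IH (ker_prim_lt v0 ab n j.+1).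
Qed.

(** Successive increments are independent, so variances add; the choice of
    [ker_val] makes the sum telescope. *)
Lemma partial_noise_law n j : indep_law Pr (Ft a) (partial_noise n j.+1)
  (fun z => Num.sqrt (prim (knot n j.+1) - prim a) *: z)%R.
Proof.
have law i := increment_law hFt hW (knot_ge0 n i) (knot_lt ab n i).
elim: j => [|j IH].
  have -> : partial_noise n 1 = (fun w =>
      ker_val v a b n 0 *: increment W (knot n 0) (knot n 1) w)%R.
    by apply/funext => w; rewrite /partial_noise big_ord1.
  have -> : (fun z : 'rV[R]_d => Num.sqrt (prim (knot n 1) - prim a) *: z)%R =
      (fun z => ker_val v a b n 0 *: (Num.sqrt (knot n 1 - knot n 0) *: z))%R.
    by apply/funext => z; rewrite scalerA ker_val_std knot0.
  apply: (indep_law_map (f := fun z => ker_val v a b n 0 *: z)%R).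
    exact: measurable_scalerV.
  by have := law 0%N; rewrite {1}knot0.
have -> : partial_noise n j.+2 = (fun w => partial_noise n j.+1 w +
    ker_val v a b n j.+1 *: increment W (knot n j.+1) (knot n j.+2) w)%R.
  by apply/funext => w; rewrite /partial_noise big_ord_recr.
have -> : (prim (knot n j.+2) - prim a =
    Num.sqrt (prim (knot n j.+1) - prim a) ^+ 2 +
    (ker_val v a b n j.+1 * Num.sqrt (knot n j.+2 - knot n j.+1)) ^+ 2)%R.
  rewrite ker_val_std !sqr_sqrtr ?subr_ge0; first by ring.
  - exact/ltW/ker_prim_lt.
  - by rewrite -subr_ge0; exact/ltW/prim_gt.
apply: (indep_law_stable (filtration_sigma hFt a0) (D := Ft (knot n j.+1))) IH _ (law _).
- by apply: (filtration_mono hFt) => //; exact: knot_le.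
- exact: (filtration_sigma hFt).
- exact: (filtration_measurable hFt).
- by rewrite sqrtr_gt0; exact: prim_gt.
- by rewrite sqrtr_gt0 subr_gt0; exact: knot_lt.
- exact: ker_val_gt0.
- exact: adapted_partial_noise.
Qed.

Definition noise_step n (w : Omega) : 'rV[R]_m := (partial_noise n n.+1 w *m noise_mx)%R.

Lemma noise_step_law n : indep_law Pr (Ft a) (noise_step n)
  (fun z => (noise_std *: z) *m noise_mx)%R.
Proof.
apply: (indep_law_map (f := fun z => z *m noise_mx)%R).
  exact: measurable_mulmxrV.
by have := partial_noise_law n n; rewrite knot_last.
Qed.

Lemma adapted_noise_step n : adapted (Ft b) (noise_step n).
Proof.
apply: (adapted_comp (f := fun z => z *m noise_mx)%R).
  exact: measurable_mulmxrV.
by have := adapted_partial_noise n n.+1; rewrite knot_last.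
Qed.

Lemma noise_stepE n w i : noise_step n w ord0 i =
  (\sum_k sf_wiener_integral (W k) (ker_step v a b (sigma k ord0 i) n) w)%R.
Proof.
rewrite /noise_step mxE; apply: eq_bigr => k _.
rewrite /partial_noise summxE mulr_suml; apply: eq_bigr => j _.
by rewrite !mxE /=; ring.
Qed.

Variable J : 'I_d -> Omega -> 'rV[R]_m.
Hypothesis hJ : forall k i, is_wiener_integral Pr (W k) a b
  (fun t => expR (- v * (b - t)) * sigma k ord0 i)%R (fun w => J k w ord0 i).

(** The step function of index [n] has [n.+1] intervals; along 2^j intervals
    the mean square errors are summable. *)
Lemma noise_step_cvg : {ae Pr, forall w i,
  noise_step (2 ^ j).-1 w ord0 i @[j --> \oo] --> (\sum_k J k w)%R ord0 i}.
Proof.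
have step k i : {ae Pr, forall w,
    sf_wiener_integral (W k) (ker_step v a b (sigma k ord0 i) (2 ^ j).-1) w
    @[j --> \oo] --> J k w ord0 i}.
  have sub j := ker_step_subdivision v ab (sigma k ord0 i) (2 ^ j).-1.
  have mJ : measurable_fun setT (fun w => J k w ord0 i) by have [] := hJ k i.
  pose X j w := (J k w ord0 i -
    sf_wiener_integral (W k) (ker_step v a b (sigma k ord0 i) (2 ^ j).-1) w)%R.
  (* The final factor 2 matches the shift in the bound [C / 2 ^ (j + 1)]. *)
  pose C := (4 * normal_var R * ((sigma k ord0 i * v * (b - a)) ^+ 2 * (b - a)) * 2)%R.
  have : {ae Pr, forall x, X j x @[j --> \oo] --> 0%R}.
    apply: (@ae_cvg0_summable _ _ _ Pr X C) => j; rewrite /X.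
      apply: measurable_funB => //; exact: (measurable_sf_integral hFt hW k a0 (sub j)).
    have mf : measurable_fun setT (fun t : R => expR (- v * (b - t)) * sigma k ord0 i)%R.
      apply: measurable_funM => //; apply: measurableT_comp => //.
      by apply: measurable_funM => //; exact: measurable_funB.
    have L2 := ker_step_L2 v0 a0 ab (sigma k ord0 i) (2 ^ j).-1.
    apply: le_trans (wiener_integral_approx hFt hW a0 (hJ k i) mf (sub j) _) _.
      apply: le_trans L2; rewrite le_eqVlt; apply/orP; left; apply/eqP.
      by apply: eq_integral => t _; rewrite /ker mulrC.
    rewrite lee_fin /mesh prednK ?expn_gt0//.
    have p1 : (1 <= (2 ^ j)%:R :> R)%R by rewrite ler1n expn_gt0.
    rewrite addn1 expnSr natrM.
    have -> : (C / ((2 ^ j)%:R * 2%:R) = 4 * normal_var R *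
      ((sigma k ord0 i * v * (b - a)) ^+ 2 * (b - a)) / (2 ^ j)%:R)%R.
      by rewrite /C; field; rewrite gt_eqF// (lt_le_trans _ p1).
    have -> : (4 * normal_var R * ((sigma k ord0 i * (v * ((b - a) / (2 ^ j)%:R))) ^+ 2
        * (b - a)) = 4 * normal_var R *
      ((sigma k ord0 i * v * (b - a)) ^+ 2 * (b - a)) / (2 ^ j)%:R * (2 ^ j)%:R^-1)%R.
      by field; rewrite gt_eqF// (lt_le_trans _ p1).
    rewrite ler_piMr ?invf_le1 ?(lt_le_trans _ p1)//.
    apply: divr_ge0 => //; apply: mulr_ge0.
      by apply: mulr_ge0 => //; exact: normal_var_ge0.
    by apply: mulr_ge0; [exact: sqr_ge0|rewrite subr_ge0 ltW].
  apply: filterS => w cw; rewrite /X in cw.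
  rewrite (_ : (fun j => sf_wiener_integral _ _ w) = fun j => (J k w ord0 i -
    (J k w ord0 i - sf_wiener_integral (W k)
      (ker_step v a b (sigma k ord0 i) (2 ^ j).-1) w))%R); last first.
    by apply/funext => j; rewrite subKr.
  by rewrite -[X in _ --> X]subr0; apply: cvgB => //; exact: cvg_cst.
have all2 : {ae Pr, forall w k i,
    sf_wiener_integral (W k) (ker_step v a b (sigma k ord0 i) (2 ^ j).-1) w
    @[j --> \oo] --> J k w ord0 i}.
  by apply: filter_forall => k; apply: filter_forall => i; exact: step.
apply: filterS all2 => w cw i; rewrite summxE.
under eq_fun do rewrite noise_stepE.
have sums (s : seq 'I_d) : (\sum_(k <- s) sf_wiener_integral (W k)
    (ker_step v a b (sigma k ord0 i) (2 ^ j).-1) w)%R @[j --> \oo] -->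
    (\sum_(k <- s) J k w ord0 i)%R.
  elim: s => [|k s IH].
    by rewrite big_nil; under eq_fun do rewrite big_nil; exact: cvg_cst.
  by rewrite big_cons; under eq_fun do rewrite big_cons; exact: cvgD.
exact: sums.
Qed.

(** The stochastic integrals are defined up to null sets. The upper limit of the
    step integrals is a version that is measurable for [Ft b] itself, and its
    law is the common law of the step integrals. *)
Lemma exponential_noise : exists xi : Omega -> 'rV[R]_m,
  [/\ adapted (Ft b) xi,
      indep_law Pr (Ft a) xi (fun z => (noise_std *: z) *m noise_mx)%R &
      {ae Pr, forall w, (\sum_k J k w)%R = xi w}].
Proof.
have b0 : (0 <= b)%R by rewrite (le_trans a0)// ltW.
pose xi w : 'rV[R]_m := (\row_i fine (limn_esup (fun j => (noise_step (2 ^ j).-1 w ord0 i)%:E)))%R.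
have sFb := filtration_sigma hFt b0.
have axi : adapted (Ft b) xi.
  apply: adapted_rV => // i; apply/(adaptedP _ sFb).
  under eq_fun do rewrite mxE.
  apply: measurableT_comp => //; apply: measurable_fun_limn_esup => j.
  apply/measurable_EFinP; apply: (measurableT_comp (measurable_rV_coord i)).
  by apply/(adaptedP _ sFb); exact: adapted_noise_step.
have exi : {ae Pr, forall w, (\sum_k J k w)%R = xi w}.
  apply: filterS noise_step_cvg => w cw; apply/rowP => i; rewrite mxE.
  have cE : (noise_step (2 ^ j).-1 w ord0 i)%:E @[j --> \oo] -->
      ((\sum_k J k w)%R ord0 i)%:E.
    by apply: cvg_EFin; [exact: nearW|exact: cw].
  by rewrite (cvg_limn_einf_sup cE).2.
exists xi; split => //.
have mxi : measurable_fun setT xi.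
  exact: adapted_measurable (filtration_measurable hFt b0) axi.
have mphi : measurable_fun setT (fun z : 'rV[R]_d => (noise_std *: z) *m noise_mx)%R.
  by have [] := noise_step_law 0%N.
apply: indep_law_continuous => //; first exact: (filtration_measurable hFt).
move=> A g FA cg g01.
have mA := filtration_measurable hFt a0 FA.
have mg : measurable_fun setT g by exact: continuous_measurable_rV.
have mn j : measurable_fun setT (noise_step j).
  exact: adapted_measurable (filtration_measurable hFt b0) (adapted_noise_step j).
have g0 x : 0 <= (g x)%:E by rewrite lee_fin; have /andP[] := g01 x.
have E j : \int[Pr]_w (\1_A w * g (noise_step j w))%:E =
    Pr A * \int[gauss_rV R d]_z (g ((noise_std *: z) *m noise_mx)%R)%:E.
  under eq_integral do rewrite EFinM.
  apply: (indep_law_event (g := EFin \o g) (filtration_sigma hFt a0)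
    (filtration_measurable hFt a0) FA (noise_step_law j)) => //.
  exact/measurable_EFinP.
have cv : \int[Pr]_w (\1_A w * g (noise_step (2 ^ j).-1 w))%:E @[j --> \oo] -->
    \int[Pr]_w (\1_A w * g (xi w))%:E.
  apply: (@dominated_EFin _ _ _ _ _ _ (cst 1%R)).
  - by move=> j; apply: measurable_funM => //; exact: measurableT_comp.
  - by apply: measurable_funM => //; exact: measurableT_comp.
  - apply: filterS2 noise_step_cvg exi => w cw exw.
    apply: cvgM; first exact: cvg_cst.
    have cx : noise_step (2 ^ j).-1 w @[j --> \oo] --> xi w.
      by apply: cvg_rV => i; rewrite -exw; exact: cw.
    exact: (continuous_cvg _ (cg (xi w)) cx).
  - exact: finite_measure_integrable_cst.
  - move=> j w; rewrite normrM indicE.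
    have /andP[h0 h1] := g01 (noise_step (2 ^ j).-1 w).
    by case: (_ \in _); rewrite ?normr1 ?normr0 ?mul1r ?mul0r// ger0_norm.
have := cvg_lim _ cv; rewrite (_ : (fun j => _) = cst
  (Pr A * \int[gauss_rV R d]_z (g ((noise_std *: z) *m noise_mx)%R)%:E)).
  by rewrite lim_cst//; move=> <-.
by apply/funext => j; exact: E.
Qed.

End exponential_noise.

(** * Smoothness of expectations *)

(** Dominated convergence is a statement about sequences, hence this
    criterion. *)
Lemma seq_continuous (R : realType) (V : normedModType R) (f : V -> R) :
  (forall (u : nat -> V) z, u n @[n --> \oo] --> z -> f (u n) @[n --> \oo] --> f z) ->
  continuous f.
Proof.
move=> H z; apply/cvgrPdist_lt => e e0; apply/not_notP => nf.
have ex n : exists y, `|z - y| < n.+1%:R^-1 /\ e <= `|f z - f y|.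
  apply/not_notP => /forallNP nex; apply: nf.
  have : \forall y \near z, `|z - y| < n.+1%:R^-1.
    have /cvgrPdist_lt := @cvg_id _ (nbhs z); apply; by rewrite invr_gt0.
  apply: filterS => y zy; rewrite ltNge; apply/negP => ef.
  by apply: (nex y).
have [u uP] := choice ex.
have cu : u n @[n --> \oo] --> z.
  apply/cvgrPdist_lt => d d0; near=> n.
  apply: lt_trans (uP n).1 _.
  by near: n; exact: (near_infty_natSinv_lt (PosNum d0)).
have /cvgrPdist_lt/(_ _ e0)[N _ fN] := H _ _ cu.
by have := fN N (leqnn N); rewrite /= ltNge (uP N).2.
Unshelve. all: end_near. Qed.

Section growth.
Variables (R : realType) (K : nat).
Implicit Types V : normedModType R.

(** Joint continuity makes a function of the random parameter [w] measurable,
    and polynomial growth makes it integrable when [w] has moments. *)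
Definition growth V (f : 'rV[R]_K -> V -> R) :=
  continuous (fun z : 'rV[R]_K * V => f z.1 z.2) /\
  exists C p, forall w z, `|f w z| <= C * (1 + `|w| + `|z|) ^+ p.

Lemma growth_ge1 V (w : 'rV[R]_K) (z : V) : 1 <= 1 + `|w| + `|z|.
Proof. by rewrite -addrA lerDl addr_ge0. Qed.

Lemma growth_bound V (f : 'rV[R]_K -> V -> R) : growth f ->
  exists2 C, 0 <= C & exists p, forall q, (p <= q)%N ->
    forall w z, `|f w z| <= C * (1 + `|w| + `|z|) ^+ q.
Proof.
move=> [_ [C [p fC]]]; exists `|C| => //; exists p => q pq w z.
apply: le_trans (fC w z) _; apply: le_trans (_ : _ <= `|C| * (1 + `|w| + `|z|) ^+ p) _.
  by rewrite ler_wpM2r ?ler_norm// exprn_ge0// (le_trans ler01)// growth_ge1.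
by rewrite ler_wpM2l// ler_weXn2l// growth_ge1.
Qed.

Lemma growthD V (f g : 'rV[R]_K -> V -> R) : growth f -> growth g ->
  growth (fun w z => f w z + g w z).
Proof.
move=> gf gg; have [C C0 [p fC]] := growth_bound gf; have [D D0 [q gD]] := growth_bound gg.
split; first by apply: cont_add; [exact: gf.1|exact: gg.1].
exists (C + D), (maxn p q) => w z; rewrite (le_trans (ler_normD _ _))// mulrDl.
by apply: lerD; [exact: fC (leq_maxl _ _) _ _|exact: gD (leq_maxr _ _) _ _].
Qed.

Lemma growthM V (f g : 'rV[R]_K -> V -> R) : growth f -> growth g ->
  growth (fun w z => f w z * g w z).
Proof.
move=> gf gg; have [C C0 [p fC]] := growth_bound gf; have [D D0 [q gD]] := growth_bound gg.
split; first by apply: cont_mul; [exact: gf.1|exact: gg.1].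
exists (C * D), (p + q)%N => w z; rewrite normrM exprD mulrACA.
by apply: ler_pM => //; [exact: fC|exact: gD].
Qed.

Lemma growth_cst V c : growth (fun (_ : 'rV[R]_K) (_ : V) => c).
Proof.
split; first exact: cont_cst.
by exists `|c|, 0%N => w z; rewrite expr0 mulr1.
Qed.

End growth.

Section expectation.
Context d (U : measurableType d) (R : realType) (P : probability U R) (K : nat).
Variable Y : U -> 'rV[R]_K.
Hypotheses (mY : measurable_fun setT Y) (momY : moments P (fun u => `|Y u|)).
Implicit Types V : normedModType R.

Definition expect V (f : 'rV[R]_K -> V -> R) (z : V) : R := \int[P]_u f (Y u) z.

Lemma moments_growth (C M : R) p : moments P (fun u => C * (1 + `|Y u| + M) ^+ p).
Proof.
apply: momentsM; first exact: moments_cst.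
apply: momentsX; apply: momentsD; last exact: moments_cst.
by apply: momentsD => //; exact: moments_cst.
Qed.

Lemma measurable_growth V (f : 'rV[R]_K -> V -> R) z : growth f ->
  measurable_fun setT (fun u => f (Y u) z).
Proof.
move=> [cf _]; apply: (measurableT_comp (f := fun w => f w z)) mY.
apply: continuous_measurable_rV.
refine (@cont_comp _ _ _ (fun w => (w, z)) _ _ cf).
by apply: cont_pair; [exact: cont_id|exact: cont_cst].
Qed.

Lemma growth_integrable V (f : 'rV[R]_K -> V -> R) z : growth f ->
  P.-integrable setT (EFin \o (fun u => f (Y u) z)).
Proof.
move=> gf; have [C C0 [p /(_ p (leqnn p)) fC]] := growth_bound gf.
apply: moments_integrable; apply: moments_le (moments_growth C `|z| p).
  exact: measurable_growth.
move=> u; apply: le_trans (fC _ _) _; exact: ler_norm.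
Qed.

Lemma expect_continuous V (f : 'rV[R]_K -> V -> R) : growth f ->
  continuous (expect f).
Proof.
move=> gf; apply: seq_continuous => u z cu.
have [C C0 [p /(_ p (leqnn p)) fC]] := growth_bound gf.
have [M Mu] : exists M, forall n, `|u n| <= M.
  have /cvgrPdist_lt/(_ _ ltr01)[N _ uN] := cu.
  exists (\sum_(i < N) `|u i| + (`|z| + 1)) => n; have [nN|Nn] := ltnP n N.
    rewrite (bigD1 (Ordinal nN))//= -addrA lerDl addr_ge0// ?addr_ge0//.
    exact: sumr_ge0.
  rewrite (le_trans (_ : _ <= `|z| + 1))//; last by rewrite lerDr sumr_ge0.
  rewrite -[u n](subKr z) (le_trans (ler_normB _ _))// lerD2l ltW//.
  exact: uN.
apply: fine_cvg; rewrite fineK; last exact: integrable_fin_num (growth_integrable z gf).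
apply: (@dominated_EFin _ _ _ _ _ _ (fun u => C * (1 + `|Y u| + M) ^+ p)).
- by move=> n; exact: measurable_growth.
- exact: measurable_growth.
- apply: aeW => x; have [cf _] := gf.
  have cfx : continuous (f (Y x)).
    refine (@cont_comp _ _ _ (fun z => (Y x, z)) _ _ cf).
    by apply: cont_pair; [exact: cont_cst|exact: cont_id].
  exact: (continuous_cvg _ (cfx z) cu).
- exact: moments_integrable (moments_growth _ _ _).
- move=> n x; apply: le_trans (fC _ _) _; rewrite ler_wpM2l//.
  rewrite lerXn2r ?nnegrE ?addr_ge0//; first by rewrite (le_trans _ (Mu 0%N)).
  by rewrite lerD2l.
Qed.

Variable n : nat.
Local Notation e_ i := (delta_mx ord0 i : 'rV[R]_n).

(** The difference quotient of the expectation is the expectation of an average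
    of the derivative over a segment, which is continuous by
    [expect_continuous]. *)
Lemma expect_derive (f g : 'rV[R]_K -> 'rV[R]_n -> R) i : growth f -> growth g ->
  (forall w z, is_derive z (e_ i) (f w) (g w z)) ->
  forall z, is_derive z (e_ i) (expect f) (expect g z).
Proof.
move=> gf gg dfg z.
pose h w (t : R) := I01 (fun s => g w (z + (t * s) *: e_ i)).
have cg w : continuous (g w).
  have [cg _] := gg.
  refine (@cont_comp _ _ _ (fun z => (w, z)) _ _ cg).
  by apply: cont_pair; [exact: cont_cst|exact: cont_id].
have cgl w t : continuous (fun s : R => g w (z + (t * s) *: e_ i)).
  refine (@cont_comp _ _ _ (fun s : R => z + (t * s) *: e_ i) _ _ (cg w)).
  apply: cont_line; [exact: cont_cst| |exact: cont_cst].
  by apply: cont_mul; [exact: cont_cst|exact: cont_id].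
have gh : growth h.
  split.
    refine (cont_I01 (f := fun s (x : 'rV[R]_K * R) => g x.1 (z + (x.2 * s) *: e_ i)) _).
    have c2 : continuous (fun x : R * ('rV[R]_K * R) => x.2).
      exact: cont_snd.
    have c21 : continuous (fun x : R * ('rV[R]_K * R) => x.2.1).
      refine (@cont_comp _ _ _ (@snd R ('rV[R]_K * R)) fst c2 _); exact: cont_fst.
    have c22 : continuous (fun x : R * ('rV[R]_K * R) => x.2.2).
      refine (@cont_comp _ _ _ (@snd R ('rV[R]_K * R)) snd c2 _); exact: cont_snd.
    refine (@cont_comp _ _ _ (fun x : R * ('rV[R]_K * R) =>
      (x.2.1, z + (x.2.2 * x.1) *: e_ i)) _ _ gg.1).
    apply: cont_pair; first exact: c21.
    apply: cont_line; [exact: cont_cst| |exact: cont_cst].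
    by apply: cont_mul; [exact: c22|exact: cont_fst].
  have [C C0 [p /(_ p (leqnn p)) gC]] := growth_bound gg.
  exists (C * (1 + `|z| + `|e_ i|) ^+ p), p => w t.
  apply: norm_I01_le => // s /andP[s0 s1]; apply: le_trans (gC _ _) _.
  rewrite -mulrA ler_wpM2l// -exprMn lerXn2r ?nnegrE ?mulr_ge0 ?addr_ge0//.
  have : `|z + (t * s) *: e_ i| <= `|z| + `|t| * `|e_ i|.
    rewrite (le_trans (ler_normD _ _))// lerD2l normrZ normrM ler_wpM2r//.
    by rewrite ler_piMr// ger0_norm.
  move: (normr_ge0 z) (normr_ge0 (e_ i)) (normr_ge0 w) (normr_ge0 t).
  move: `|_ + _| `|z| `|e_ i| `|w| `|t| => x a b c e'; nra.
have -> : expect g z = expect h 0.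
  apply: eq_Rintegral => u _; rewrite /h.
  rewrite (_ : (fun s => _) = fun=> g (Y u) z) ?I01_cst//.
  by apply/funext => s; rewrite mul0r scale0r addr0.
apply: is_derive_quotient; last exact: expect_continuous.
move=> t; rewrite /expect -RintegralB//; try exact: growth_integrable.
rewrite -RintegralZl//; last exact: growth_integrable.
apply: eq_Rintegral => u _.
exact: (increment_line (dfg _)).
Qed.

(** The partial derivatives in [z] up to order [k] exist and belong to
    [growth]. The derivatives are existentially quantified, so that closure
    properties are proved without computing iterated derivatives. *)
Fixpoint cpf k (f : 'rV[R]_K -> 'rV[R]_n -> R) : Prop :=
  growth f /\ if k is k'.+1 then
    forall i, exists2 g, forall w z, is_derive z (e_ i) (f w) (g w z) & cpf k' g
  else True.

Lemma cpf_growth k f : cpf k f -> growth f. Proof. by case: k => [|k] []. Qed.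

Lemma cpf_pred k f : cpf k.+1 f -> cpf k f.
Proof.
elim: k f => [|k IH] f [gf df]; first by split.
by split=> // i; have [g dg cg] := df i; exists g => //; exact: IH.
Qed.

Lemma expect_smooth f : (forall k, cpf k f) -> smooth (expect f).
Proof.
move=> cf k a ak.
have [g [cg gE]] : exists g, cpf (k - size a) g /\ pderiv a (expect f) = expect g.
  elim: a ak => [|i a IH] ak; first by exists f; rewrite subn0.
  have [g [cg gE]] := IH (ltnW ak).
  move: cg; rewrite -subnSK//= => -[gg /(_ i)[g' dg' cg']].
  exists g'; split => //; apply/funext => z /=; rewrite gE.
  by have [_] := expect_derive gg (cpf_growth cg') dg' z.
rewrite gE; split; first exact: expect_continuous (cpf_growth cg).
move=> lak i y; move: cg; rewrite -subnSK//= => -[gg /(_ i)[g' dg' cg']].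
by have [] := expect_derive gg (cpf_growth cg') dg' y.
Qed.

End expectation.

(** * Smooth functions of polynomial growth *)

(** Directional derivatives are derivatives on the line; this gives access to
    the one-variable chain rule. *)
Lemma is_derive_dir (R : realType) n (f : 'rV[R]_n -> R) z v d :
  is_derive (0 : R) (1 : R) (fun t => f (z + t *: v)) d <-> is_derive z v f d.
Proof.
have E : (fun t : R => t^-1 *: (((fun t => f (z + t *: v)) \o shift 0) (t *: (1 : R)) -
    f (z + 0 *: v))) = (fun t : R => t^-1 *: ((f \o shift z) (t *: v) - f z)).
  apply/funext => t /=; rewrite scale0r !addr0 (addrC (t *: v)).
  by rewrite [t *: (1 : R)]mulr1.
by split=> -[dv vd]; split; move: dv vd; rewrite /derivable /derive E.
Qed.

Section closure.
Variables (R : realType) (K n : nat).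
Local Notation e_ i := (delta_mx ord0 i : 'rV[R]_n).
Implicit Types f g : 'rV[R]_K -> 'rV[R]_n -> R.

Lemma cpf_cst k c : @cpf R K n k (fun _ _ => c).
Proof.
elim: k c => [|k IH] c; split; try exact: growth_cst; first by [].
by move=> i; exists (fun _ _ => 0) => // w z; exact: is_derive_cst.
Qed.

Lemma cpfD k f g : cpf k f -> cpf k g -> cpf k (fun w z => f w z + g w z).
Proof.
elim: k f g => [|k IH] f g cf cg; split=> //;
  try exact: growthD (cpf_growth cf) (cpf_growth cg).
move=> i; have [_ /(_ i)[f' df' cf']] := cf; have [_ /(_ i)[g' dg' cg']] := cg.
exists (fun w z => f' w z + g' w z); last exact: IH.
by move=> w z; exact: is_deriveD.
Qed.

Lemma cpfM k f g : cpf k f -> cpf k g -> cpf k (fun w z => f w z * g w z).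
Proof.
elim: k f g => [|k IH] f g cf cg; split=> //;
  try exact: growthM (cpf_growth cf) (cpf_growth cg).
move=> i; have [_ /(_ i)[f' df' cf']] := cf; have [_ /(_ i)[g' dg' cg']] := cg.
exists (fun w z => f w z * g' w z + g w z * f' w z).
  by move=> w z; exact: (is_deriveM (df' w z) (dg' w z)).
by apply: cpfD; apply: IH => //; exact: cpf_pred.
Qed.

Lemma cpfZ k c f : cpf k f -> cpf k (fun w z => c * f w z).
Proof. by move=> cf; apply: cpfM => //; exact: cpf_cst. Qed.

Lemma cpfB k f g : cpf k f -> cpf k g -> cpf k (fun w z => f w z - g w z).
Proof.
move=> cf cg; under eq_fun do under eq_fun do rewrite -mulN1r.
by apply: cpfD => //; exact: cpfZ.
Qed.

Lemma cpf_sum k (I : Type) (s : seq I) (f : I -> 'rV[R]_K -> 'rV[R]_n -> R) :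
  (forall i, cpf k (f i)) -> cpf k (fun w z => \sum_(i <- s) f i w z).
Proof.
move=> cf; elim: s => [|i s IH].
  by under eq_fun do under eq_fun do rewrite big_nil; exact: cpf_cst.
by under eq_fun do under eq_fun do rewrite big_cons; exact: cpfD.
Qed.

Lemma cpf_prod k (I : Type) (s : seq I) (f : I -> 'rV[R]_K -> 'rV[R]_n -> R) :
  (forall i, cpf k (f i)) -> cpf k (fun w z => \prod_(i <- s) f i w z).
Proof.
move=> cf; elim: s => [|i s IH].
  by under eq_fun do under eq_fun do rewrite big_nil; exact: cpf_cst.
by under eq_fun do under eq_fun do rewrite big_cons; exact: cpfM.
Qed.

Lemma cpf_det k p (A : 'rV[R]_K -> 'rV[R]_n -> 'M[R]_p) :
  (forall i j, cpf k (fun w z => A w z i j)) -> cpf k (fun w z => \det (A w z)).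
Proof.
by move=> cA; apply: cpf_sum => s; apply: cpfZ; exact: cpf_prod.
Qed.

Lemma cpf_param k i : cpf k (fun (w : 'rV[R]_K) (_ : 'rV[R]_n) => w ord0 i).
Proof.
have gw : growth (fun (w : 'rV[R]_K) (_ : 'rV[R]_n) => w ord0 i).
  split; first by apply: continuous_coord; exact: cont_fst.
  exists 1, 1%N => w z; rewrite mul1r expr1 (le_trans (ler_coord_norm w i))//.
  by rewrite -addrA addrCA lerDl addr_ge0.
case: k => [|k]; split => // j.
exists (fun _ _ => 0); last exact: cpf_cst.
by move=> w z; exact: is_derive_cst.
Qed.

Lemma cpf_coord k i : cpf k (fun (_ : 'rV[R]_K) (z : 'rV[R]_n) => z ord0 i).
Proof.
have gw : growth (fun (_ : 'rV[R]_K) (z : 'rV[R]_n) => z ord0 i).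
  split; first by apply: continuous_coord; exact: cont_snd.
  exists 1, 1%N => w z; rewrite mul1r expr1 (le_trans (ler_coord_norm z i))//.
  by rewrite lerDr addr_ge0.
case: k => [|k]; split => // j.
exists (fun _ _ => (i == j)%:R); last exact: cpf_cst.
move=> _ z; apply: (@is_derive_quotient R n _ z (e_ j) (fun=> (i == j)%:R)).
  by move=> t; rewrite !mxE eqxx /=; ring.
exact: cont_cst.
Qed.

(** The sign keeps the exponential bounded, so growth is preserved even though
    the exponent is polynomial. *)
Lemma cpf_expN k f : (forall w z, 0 <= f w z) -> cpf k f ->
  cpf k (fun w z => expR (- f w z)).
Proof.
move=> f0; elim: k => [|k IH] cf.
  have ge : growth (fun w z => expR (- f w z)).
    have [c _] := cpf_growth cf.
    split.
      refine (@cont_comp _ _ _ (fun z : 'rV[R]_K * 'rV[R]_n => - f z.1 z.2) expR _ _).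
        exact: cont_opp.
      exact: continuous_expR.
    exists 1, 0%N => w z; rewrite expr0 mulr1 ger0_norm ?expR_ge0//.
    by rewrite -expR0 ler_expR oppr_le0.
  by split.
have [_ df] := cf; have cfk := IH (cpf_pred cf).
split; first exact: cpf_growth cfk.
move=> i; have [f' df' cf'] := df i.
exists (fun w z => -1 * (f' w z * expR (- f w z))); last first.
  by apply: cpfZ; exact: cpfM.
move=> w z.
have df0 := (is_derive_dir _ _ _ _).2 (df' w z).
apply/is_derive_dir.
have de : is_derive (- f w (z + 0 *: e_ i)) (1 : R) expR (expR (- f w (z + 0 *: e_ i))).
  exact: is_derive_expR.
have dN : is_derive (0 : R) (1 : R) (fun t => - f w (z + t *: e_ i)) (- f' w z).
  exact: is_deriveN.
have := @is_derive1_comp R expR (fun t => - f w (z + t *: e_ i)) 0 _ _ de dN.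
rewrite scale0r addr0.
by have -> : expR (- f w z) * - f' w z = -1 * (f' w z * expR (- f w z)) by ring.
Qed.

Lemma cpf_gauss k p (X : 'rV[R]_K -> 'rV[R]_n -> 'rV[R]_p) :
  (forall i, cpf k (fun w z => X w z ord0 i)) ->
  cpf k (fun w z => gauss_pdf (X w z)).
Proof.
move=> cX; apply: cpf_prod => i.
have E w z : normal_pdf 0 1 (X w z ord0 i) =
    normal_peak 1 * expR (- (2^-1 * (X w z ord0 i * X w z ord0 i))).
  rewrite normal_pdfE ?oner_eq0//.
  transitivity (normal_peak 1 * normal_fun 0 1 (X w z ord0 i)) => //.
  rewrite /normal_fun subr0 expr1n.
  by congr (_ * expR _); rewrite expr2 -mulr_natr mul1r; field.
under eq_fun do under eq_fun do rewrite E.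
apply: cpfZ; apply: cpf_expN; last by apply: cpfZ; exact: cpfM.
by move=> w z; rewrite mulr_ge0// -expr2 sqr_ge0.
Qed.

Lemma cpf_mulmx k p q (X : 'rV[R]_K -> 'rV[R]_n -> 'rV[R]_p) (B : 'M[R]_(p, q)) :
  (forall i, cpf k (fun w z => X w z ord0 i)) ->
  forall i, cpf k (fun w z => (X w z *m B) ord0 i).
Proof.
move=> cX i; under eq_fun do under eq_fun do rewrite mxE.
by apply: cpf_sum => j; apply: cpfM => //; exact: cpf_cst.
Qed.

(** Selecting coordinates is how positions and momenta are read in a row; for
    an injective [s], a coordinate direction is mapped to a coordinate
    direction or to zero. *)
Definition subrow m N (s : 'I_m -> 'I_N) (w : 'rV[R]_N) : 'rV[R]_m := \row_j w ord0 (s j).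

Lemma subrow_norm m N (s : 'I_m -> 'I_N) w : `|subrow s w| <= `|w|.
Proof. by apply: norm_rV_le => // i; rewrite mxE; exact: ler_coord_norm. Qed.

Lemma cont_subrow (T : topologicalType) m N (s : 'I_m -> 'I_N) (f : T -> 'rV[R]_N) :
  continuous f -> continuous (fun t => subrow s (f t)).
Proof.
move=> cf; apply: continuous_rV => i; under eq_fun do rewrite mxE.
exact: continuous_coord.
Qed.

(** Differentiation in [z] stays within the family [avg F], whose growth is that
    of the derivatives of [F]. *)
Lemma cpf_avg m (F : 'rV[R]_m -> R) (s : 'I_m -> 'I_n) (t : 'I_m -> 'I_K) : injective s ->
  smooth F ->
  (forall a, exists C p, forall y, `|pderiv a F y| <= C * (1 + `|y|) ^+ p) ->
  forall k a r, cpf k (fun w z => avg F a r (subrow t w) (subrow s z)).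
Proof.
move=> sI smF polyF k.
have ga a r : growth (fun w z => avg F a r (subrow t w) (subrow s z)).
  split.
    by apply: cont_avg_comp => //; apply: cont_subrow; [exact: cont_fst|exact: cont_snd].
  have [C [p CF]] := polyF a; exists C, p => w z.
  have C0 : 0 <= C.
    by have := le_trans (normr_ge0 _) (CF 0); rewrite normr0 addr0 expr1n mulr1.
  apply: le_trans (avg_growth smF r CF _ _) _; rewrite ler_wpM2l//.
  by rewrite lerXn2r ?nnegrE ?addr_ge0// lerD ?lerD2l ?subrow_norm.
elim: k => [|k IH] a r; first by split.
split=> // i.
have subrowD z c : subrow s (z + c *: e_ i) = subrow s z + c *: subrow s (e_ i).
  by apply/rowP => j; rewrite !mxE.
have [[j ij]|ni] := pselect (exists j, i = s j).
  exists (fun w z => avg F (j :: a) r.+1 (subrow t w) (subrow s z)) => // w z.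
  apply/is_derive_dir; under eq_fun do rewrite subrowD.
  have -> : subrow s (e_ i) = delta_mx ord0 j.
    by apply/rowP => l; rewrite !mxE ij (inj_eq sI).
  apply: (is_derive_dir _ _ _ _).2; exact: is_derive_avg.
exists (fun _ _ => 0); last exact: cpf_cst.
move=> w z; apply/is_derive_dir; under eq_fun do rewrite subrowD.
have -> : subrow s (e_ i) = 0.
  apply/rowP => l; rewrite !mxE eqxx/=; case: eqP => // sl.
  by case: ni; exists l.
by under eq_fun do rewrite scaler0 addr0; exact: is_derive_cst.
Qed.

End closure.

Lemma Cp_infty_growth (R : realType) m (F : 'rV[R]_m -> R) : Cp_infty F ->
  forall a, exists C p, forall y, `|pderiv a F y| <= C * (1 + `|y|) ^+ p.
Proof.
move=> [_ polyF] a; have [C [p CF]] := polyF a.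
have ey (y : 'rV[R]_m) : enorm y <= (1 + m%:R) * (1 + `|y|).
  rewrite /enorm big_ord_recl big_ord0 addr0.
  have : \sum_j y ord0 j ^+ 2 <= ((1 + m%:R) * (1 + `|y|)) ^+ 2.
    apply: le_trans (_ : _ <= \sum_(j < m) `|y| ^+ 2) _.
      apply: ler_sum => j _; rewrite -[leLHS]real_normK ?num_real//.
      by rewrite lerXn2r ?nnegrE//; exact: ler_coord_norm.
    rewrite sumr_const card_ord -[leLHS]mulr_natl.
    have : 0 <= m%:R :> R by [].
    move: (m%:R) (normr_ge0 y) => c; move: `|y| => x x0 c0.
    rewrite exprMn ler_pM ?sqr_ge0//; first by nra.
    by rewrite lerXn2r ?nnegrE ?addr_ge0// lerDr.
  have r0 : 0 <= (1 + m%:R) * (1 + `|y|) by rewrite mulr_ge0// addr_ge0.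
  by move=> /ler_wsqrtr; rewrite sqrtr_sqr ger0_norm.
exists (`|C| * (1 + (1 + m%:R) ^+ p)), p => y.
apply: le_trans (CF y) _; apply: le_trans (_ : _ <= `|C| * (1 + enorm y ^+ p)) _.
  by rewrite ler_wpM2r ?ler_norm// addr_ge0// exprn_ge0// sqrtr_ge0.
rewrite -mulrA ler_wpM2l// mulrDl mul1r lerD//.
  by rewrite exprn_ege1// lerDl.
rewrite -exprMn lerXn2r ?nnegrE ?mulr_ge0 ?addr_ge0//.
exact: sqrtr_ge0.
Qed.

(** * Density of the noise *)

Section noise_density.
Local Open Scope ereal_scope.
Variables (R : realType) (m d : nat).

(** Freezing the coordinates outside [f] leaves a nondegenerate Gaussian in
    dimension m; the frozen part only translates it, by [z *m E]. *)
Lemma ge0_integral_gauss_image (M : 'M[R]_(d, m)) (s : R) (f : 'I_m -> 'I_d) :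
  (0 < s)%R -> injective f -> row_free (\matrix_(i < m) row (f i) M) ->
  exists (c : R) (B : 'M[R]_m) (E : 'M[R]_(d, m)), (0 < c)%R /\
    forall g : 'rV[R]_m -> \bar R, measurable_fun setT g -> (forall x, 0 <= g x) ->
    \int[gauss_rV R d]_z g ((s *: z) *m M)%R =
    \int[gauss_rV R d]_z \int[lebesgue_rV R m]_x
      (g x * (c * gauss_pdf ((x - z *m E) *m B))%:E).
Proof.
move=> s0 finj free.
pose A : 'M[R]_m := (s *: \matrix_(i < m) row (f i) M)%R.
have uA : A \in unitmx.
  by rewrite unitmxZ ?unitfE ?gt_eqF// -row_free_unit.
pose E : 'M[R]_(d, m) :=
  (\matrix_(k, j) if [pick i | f i == k] is Some i then 0 else s * M k j)%R.
have uA' : invmx A \in unitmx by rewrite unitmx_inv.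
have [c c0 HA] := ge0_integral_lebesgue_mulmx uA.
exists c, (invmx A), E; split => // g mg g0.
have mergeE u z : ((s *: merge_rV f u z) *m M = u *m A + z *m E)%R.
  apply/rowP => j; rewrite !mxE.
  have -> : (\sum_i u ord0 i * A i j =
      \sum_k (\sum_(i | f i == k) u ord0 i * A i j))%R.
    by rewrite (partition_big f xpredT).
  rewrite -big_split; apply: eq_bigr => k _; rewrite !mxE /=.
  case: pickP => [i /eqP fi|nf].
    rewrite mulr0 addr0 (big_pred1 i); first by rewrite !mxE fi; ring.
    by move=> i'; rewrite /= -fi (inj_eq finj).
  by rewrite big_pred0// add0r; ring.
have mg1 : measurable_fun setT (fun z : 'rV[R]_d => g ((s *: z) *m M)%R).
  by apply: (measurableT_comp mg); apply: measurable_mulmxrV; exact: measurable_scalerV.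
rewrite (ge0_integral_gauss_merge finj mg1 (fun z => g0 _)).
apply: eq_integral => z _.
under eq_integral do rewrite mergeE.
have mgA : measurable_fun setT (fun u => g (u *m A + z *m E)%R).
  by apply: (measurableT_comp mg); apply: measurable_addrV => //; exact: measurable_mulmxrV.
rewrite (ge0_integral_gauss mgA (fun u => g0 _)).
have mpdf (B : 'M[R]_m) : measurable_fun setT (fun x : 'rV[R]_m => (gauss_pdf (x *m B))%:E).
  apply/measurable_EFinP; apply: measurableT_comp; last exact: measurable_mulmxrV.
  by apply: continuous_measurable_rV; exact: continuous_gauss_pdf.
have mG : measurable_fun setT
    (fun x : 'rV[R]_m => g (x + z *m E)%R * (gauss_pdf (x *m invmx A))%:E).
  by apply: emeasurable_funM => //; apply: (measurableT_comp mg); exact: measurable_addrV.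
have G0 x : 0 <= g (x + z *m E)%R * (gauss_pdf (x *m invmx A))%:E.
  by rewrite mule_ge0// lee_fin gauss_pdf_ge0.
have := HA _ mG G0; under eq_integral do rewrite mulmxK//.
move=> ->.
have mG2 : measurable_fun setT
    (fun x : 'rV[R]_m => g x * (c * gauss_pdf ((x - z *m E) *m invmx A))%:E).
  apply: emeasurable_funM => //; apply/measurable_EFinP; apply: measurable_funM => //.
  apply: (measurableT_comp (f := @gauss_pdf R m)).
    by apply: continuous_measurable_rV; exact: continuous_gauss_pdf.
  by apply: measurable_mulmxrV; exact: measurable_addrV.
rewrite -(ge0_integral_lebesgue_rVD (z *m E) mG2); last first.
  by move=> x; rewrite mule_ge0// lee_fin mulr_ge0 ?gauss_pdf_ge0// ltW.
rewrite -ge0_integralZl//; last by rewrite lee_fin ltW.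
by apply: eq_integral => x _; rewrite addrK EFinM muleCA.
Qed.

End noise_density.

(** * Smoothness of the transition density *)

Lemma continuous_measurable_pair (R : realType) a b n (f : 'rV[R]_a * 'rV[R]_b -> 'rV[R]_n) :
  continuous f -> measurable_fun setT f.
Proof.
move=> cf.
have -> : f = (fun x => f (subrow (@lshift a b) x, subrow (@rshift a b) x)) \o
    (fun z => row_mx z.1 z.2).
  apply/funext => -[u w] /=; congr f; congr (_, _); apply/rowP => i; rewrite !mxE.
    by case: split_ordP => j /eqP; rewrite ?eq_lshift ?eq_lrshift// => /eqP ->.
  by case: split_ordP => j /eqP; rewrite ?eq_rshift ?eq_rlshift// => /eqP ->.
apply: measurableT_comp; last exact: measurable_row_mx.
apply: continuous_measurable_rV2.
refine (@cont_comp _ _ _ (fun x : 'rV[R]_(a + b) =>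
  (subrow (@lshift a b) x, subrow (@rshift a b) x)) _ _ cf).
by apply: cont_pair; apply: cont_subrow; exact: cont_id.
Qed.

Lemma continuous_measurable_pairR (R : realType) a b (f : 'rV[R]_a * 'rV[R]_b -> R) :
  continuous f -> measurable_fun setT f.
Proof.
move=> cf; have cg : continuous (fun z => \row_(i < 1) f z).
  by apply: continuous_rV => i; under eq_fun do rewrite mxE.
have := measurableT_comp (measurable_rV_coord (ord0 : 'I_1)) (continuous_measurable_pair cg).
by congr measurable_fun; apply/funext => z; rewrite /= /rV_coord mxE.
Qed.

Lemma subrow_row_mxl (R : realType) m n (u : 'rV[R]_m) (w : 'rV[R]_n) :
  subrow (@lshift m n) (row_mx u w) = u.
Proof. by apply/rowP => i; rewrite mxE row_mxEl. Qed.

Lemma subrow_row_mxr (R : realType) m n (u : 'rV[R]_m) (w : 'rV[R]_n) :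
  subrow (@rshift m n) (row_mx u w) = w.
Proof. by apply/rowP => i; rewrite mxE row_mxEr. Qed.

Section transition_density.
Variables (R : realType) (m : nat) (F : 'rV[R]_m -> R) (h e c : R) (B : 'M[R]_m).
Hypotheses (smF : smooth F)
  (polyF : forall a, exists C p, forall y, `|pderiv a F y| <= C * (1 + `|y|) ^+ p).

Definition noise_pdf (a x : 'rV[R]_m) : R := c * gauss_pdf ((x - a) *m B).

(** The density at [(x, y)] of the position [y] reached from [q] when the
    momentum before the step has density [noise_pdf a], jointly with the
    momentum [x] after the step, whose noise is centred at [b]; the determinant
    is the Jacobian of [stepG q]. *)
Definition step_pdf (q a b x y : 'rV[R]_m) : R :=
  \det (stepA F h q y y) * noise_pdf a (stepG F h q y) *
  noise_pdf b (x - e *: stepH F h q y).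

Definition param_q (w : 'rV[R]_(m + (m + m))) := subrow (@lshift m (m + m)) w.
Definition param_a (w : 'rV[R]_(m + (m + m))) :=
  subrow (@lshift m m) (subrow (@rshift m (m + m)) w).
Definition param_b (w : 'rV[R]_(m + (m + m))) :=
  subrow (@rshift m m) (subrow (@rshift m (m + m)) w).

Definition step_pdf_row (w : 'rV[R]_(m + (m + m))) (z : 'rV[R]_(m + m)) : R :=
  step_pdf (param_q w) (param_a w) (param_b w)
    (subrow (@lshift m m) z) (subrow (@rshift m m) z).

Lemma step_pdf_rowE q a b x y :
  step_pdf_row (row_mx q (row_mx a b)) (row_mx x y) = step_pdf q a b x y.
Proof.
rewrite /step_pdf_row /param_q /param_a /param_b.
by rewrite !(subrow_row_mxl, subrow_row_mxr).
Qed.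

Let cpf_avg_row k a r : cpf k (fun w (z : 'rV[R]_(m + m)) =>
  avg F a r (param_q w) (subrow (@rshift m m) z)).
Proof. by apply: cpf_avg => //; exact: rshift_inj. Qed.

Let cpf_stepGH k (t : R) i : cpf k (fun w (z : 'rV[R]_(m + m)) =>
  (h^-1 *: (subrow (@rshift m m) z - param_q w) +
   t *: avg_grad F (param_q w) (subrow (@rshift m m) z)) ord0 i).
Proof.
under eq_fun do under eq_fun do rewrite !mxE.
apply: cpfD; apply: cpfZ; last exact: cpf_avg_row.
by apply: cpfB; [exact: cpf_coord|exact: cpf_param].
Qed.

Let cpf_noise k (X Z : 'rV[R]_(m + (m + m)) -> 'rV[R]_(m + m) -> 'rV[R]_m) :
  (forall i, cpf k (fun w z => X w z ord0 i)) ->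
  (forall i, cpf k (fun w z => Z w z ord0 i)) ->
  cpf k (fun w z => noise_pdf (Z w z) (X w z)).
Proof.
move=> cX cZ; apply: cpfZ; apply: cpf_gauss; apply: cpf_mulmx => i.
under eq_fun do under eq_fun do rewrite mxE [X in _ + X]mxE.
exact: cpfB.
Qed.

Lemma cpf_step_pdf k : cpf k step_pdf_row.
Proof.
apply: cpfM; first apply: cpfM.
- apply: cpf_det => i j; under eq_fun do under eq_fun do rewrite stepA_diag mxE.
  by apply: cpfD; [exact: cpf_cst|apply: cpfZ; exact: cpf_avg_row].
- apply: cpf_noise => i; first exact: cpf_stepGH.
  by under eq_fun do under eq_fun do rewrite /param_a !mxE; exact: cpf_param.
- apply: cpf_noise => i; last first.
    by under eq_fun do under eq_fun do rewrite /param_b !mxE; exact: cpf_param.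
  under eq_fun do under eq_fun do rewrite mxE [X in _ + X]mxE [X in _ - X]mxE [X in X - _]mxE.
  apply: cpfB; first exact: cpf_coord.
  apply: cpfZ; have := cpf_stepGH k (- (h / 2)) i.
  by under eq_fun do under eq_fun do rewrite scaleNr.
Qed.

End transition_density.

(** * Integrating over one step *)

Section transition.
Local Open Scope ereal_scope.
Variables (R : realType) (m d : nat) (F : 'rV[R]_m -> R) (h e c k : R).
Variables (B : 'M[R]_m) (E : 'M[R]_(d, m)) (phi : 'rV[R]_d -> 'rV[R]_m).
Hypotheses (smF : smooth F)
  (polyF : forall a, exists C p, forall y, (`|pderiv a F y| <= C * (1 + `|y|) ^+ p)%R).
Hypotheses (k0 : (0 < k)%R) (c0 : (0 < c)%R).
Hypothesis Gsec : forall q, secant k (stepG F h q) (stepA F h q).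
Hypothesis mphi : measurable_fun setT phi.
Hypothesis noiseE : forall g : 'rV[R]_m -> \bar R,
  measurable_fun setT g -> (forall x, 0 <= g x) ->
  \int[gauss_rV R d]_z g (phi z) = \int[gauss_rV R d]_z \int[lebesgue_rV R m]_x
    (g x * (noise_pdf c B (z *m E) x)%:E).
Variable Y : 'rV[R]_m -> 'rV[R]_m -> 'rV[R]_m.
Hypotheses (GY : forall q, cancel (Y q) (stepG F h q))
  (YG : forall q, cancel (stepG F h q) (Y q)).
Local Notation gam := (gauss_rV R d).
Local Notation lam := (lebesgue_rV R m).
Local Notation sG := (stepG F h).
Local Notation sH := (stepH F h).

Lemma cont_step_inverse : continuous (fun z : 'rV[R]_m * 'rV[R]_m => Y z.1 z.2).
Proof.
apply: (@expansive_inverse_continuous R _ m k sG) => //.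
  by move=> q; exact: secant_expansive (Gsec q).
by move=> y; apply: cont_stepG => //; [exact: cont_id|exact: cont_cst].
Qed.

Let noise_ge0 a x : (0 <= noise_pdf c B a x)%R.
Proof. by rewrite mulr_ge0 ?gauss_pdf_ge0// ltW. Qed.

Let cont_noise (T : topologicalType) (f g : T -> 'rV[R]_m) :
  continuous f -> continuous g -> continuous (fun t => noise_pdf c B (f t) (g t)).
Proof.
move=> cf cg; apply: cont_mul; first exact: cont_cst.
refine (@cont_comp _ _ _ (fun t => (g t - f t) *m B)%R _ _ (@continuous_gauss_pdf R m)).
apply: continuous_mulmx; first exact: cont_sub.
by move=> i j; exact: cont_cst.
Qed.

Let mnoise dT (T : measurableType dT) (f g : T -> 'rV[R]_m) :
  measurable_fun setT f -> measurable_fun setT g ->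
  measurable_fun setT (fun t => (noise_pdf c B (f t) (g t))%:E).
Proof.
move=> mf mg; apply/measurable_EFinP.
apply: (measurableT_comp (f := fun z : 'rV[R]_m * 'rV[R]_m => noise_pdf c B z.1 z.2)
  (g := fun t => (f t, g t))).
  by apply: continuous_measurable_pairR; apply: cont_noise; [exact: cont_fst|exact: cont_snd].
exact: measurable_fun_pair.
Qed.

Let mG dT (T : measurableType dT) (f g : T -> 'rV[R]_m) :
  measurable_fun setT f -> measurable_fun setT g ->
  measurable_fun setT (fun t => sG (f t) (g t)).
Proof.
move=> mf mg.
apply: (measurableT_comp (f := fun z : 'rV[R]_m * 'rV[R]_m => sG z.1 z.2)
  (g := fun t => (f t, g t))); last exact: measurable_fun_pair.
by apply: continuous_measurable_pair; apply: cont_stepG; [|exact: cont_fst|exact: cont_snd].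
Qed.

Lemma measurable_stepH dT (T : measurableType dT) (f g : T -> 'rV[R]_m) :
  measurable_fun setT f -> measurable_fun setT g ->
  measurable_fun setT (fun t => sH (f t) (g t)).
Proof.
move=> mf mg.
apply: (measurableT_comp (f := fun z : 'rV[R]_m * 'rV[R]_m => sH z.1 z.2)
  (g := fun t => (f t, g t))); last exact: measurable_fun_pair.
by apply: continuous_measurable_pair; apply: cont_stepH; [|exact: cont_fst|exact: cont_snd].
Qed.

Lemma measurable_step_inverse dT (T : measurableType dT) (f g : T -> 'rV[R]_m) :
  measurable_fun setT f -> measurable_fun setT g ->
  measurable_fun setT (fun t => Y (f t) (g t)).
Proof.
move=> mf mg.
apply: (measurableT_comp (f := fun z : 'rV[R]_m * 'rV[R]_m => Y z.1 z.2)
  (g := fun t => (f t, g t))); last exact: measurable_fun_pair.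
by apply: continuous_measurable_pair; exact: cont_step_inverse.
Qed.

Let mdet q : measurable_fun setT (fun y => (\det (stepA F h q y y))%:E).
Proof.
apply/measurable_EFinP; apply: continuous_measurable_rV.
apply: continuous_det => i j.
refine (@cont_comp _ _ _ (fun y : 'rV[R]_m => (y, y)) _ _ (secant_cont (i := i) (j := j) (Gsec q))).
by apply: cont_pair; exact: cont_id.
Qed.

Let det_ge0 q y : (0 <= \det (stepA F h q y y))%R.
Proof. exact/ltW/(coercive_det_gt0 k0)/(secant_coercive (Gsec q)). Qed.

Lemma step_pdf_ge0 q a b x y : (0 <= step_pdf F h e c B q a b x y)%R.
Proof.
apply: mulr_ge0; last exact: noise_ge0.
by apply: mulr_ge0; [exact: det_ge0|exact: noise_ge0].
Qed.

Variable g : 'rV[R]_(m + m) -> \bar R.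
Hypotheses (mg : measurable_fun setT g) (g0 : forall x, 0 <= g x).

Definition step_mean (q y : 'rV[R]_m) : \bar R :=
  \int[gam]_z g (row_mx (e *: sH q y + phi z)%R y).

Lemma measurable_step_mean dT (T : measurableType dT) (f f' : T -> 'rV[R]_m) :
  measurable_fun setT f -> measurable_fun setT f' ->
  measurable_fun setT (fun t => step_mean (f t) (f' t)).
Proof.
move=> mf mf'.
apply: (measurable_fun_fubini_tonelli_F (m2 := gam)
  (fun z : T * 'rV[R]_d => g (row_mx (e *: sH (f z.1) (f' z.1) + phi z.2)%R (f' z.1)))) => //.
have m1 : measurable_fun setT (fun z : T * 'rV[R]_d => f z.1).
  exact: measurableT_comp mf measurable_fst.
have m2 : measurable_fun setT (fun z : T * 'rV[R]_d => f' z.1).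
  exact: measurableT_comp mf' measurable_fst.
apply: (measurableT_comp mg); apply: measurable_row_mx => //.
apply: measurable_addrV; last exact: measurableT_comp mphi measurable_snd.
by apply: measurable_scalerV => //; exact: measurable_stepH.
Qed.

Lemma step_mean_ge0 q y : 0 <= step_mean q y.
Proof. by apply: integral_ge0 => z _; exact: g0. Qed.

Lemma step_meanE q y : step_mean q y = \int[gam]_z \int[lam]_x
  (g (row_mx x y) * (noise_pdf c B (z *m E) (x - e *: sH q y))%:E).
Proof.
rewrite /step_mean.
have m1 : measurable_fun setT (fun x : 'rV[R]_m => g (row_mx (e *: sH q y + x)%R y)).
  by apply: (measurableT_comp mg); apply: measurable_row_mx => //; exact: measurable_addrV.
rewrite (noiseE m1 (fun x => g0 _)); apply: eq_integral => z _.
have m2 : measurable_fun setT (fun x : 'rV[R]_m =>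
    g (row_mx x y) * (noise_pdf c B (z *m E) (x - e *: sH q y))%:E).
  apply: emeasurable_funM.
    by apply: (measurableT_comp mg); exact: measurable_row_mx.
  by apply: mnoise => //; apply: measurable_addrV.
rewrite -(ge0_integral_lebesgue_rVD (e *: sH q y)%R m2); last first.
  by move=> x; rewrite mule_ge0// lee_fin.
by apply: eq_integral => x _; rewrite addrK addrC.
Qed.

(** When the momentum before the step has density [noise_pdf a], substitute
    [p = stepG q y] in its law: the position takes over the density, multiplied
    by the Jacobian. Given the position, the noise of the step supplies the
    density of the momentum. *)
Lemma transition_integral q a :
  \int[lam]_p (step_mean q (Y q p) * (noise_pdf c B a p)%:E) =
  \int[gam]_z \int[lebesgue_rV R (m + m)]_x
    (g x * (step_pdf_row F h e c B (row_mx q (row_mx a (z *m E))) x)%:E).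
Proof.
have mf : measurable_fun setT (fun p : 'rV[R]_m =>
    step_mean q (Y q p) * (noise_pdf c B a p)%:E).
  apply: emeasurable_funM; last exact: mnoise.
  by apply: measurable_step_mean => //; exact: measurable_step_inverse.
have f0 p : 0 <= step_mean q (Y q p) * (noise_pdf c B a p)%:E.
  by rewrite mule_ge0 ?step_mean_ge0 ?lee_fin.
rewrite -(ge0_integral_secant k0 (Gsec q) mf f0).
pose J (u : 'rV[R]_m * 'rV[R]_d) (x : 'rV[R]_m) :=
  g (row_mx x u.1) * (step_pdf F h e c B q a (u.2 *m E) x u.1)%:E.
have J0 u x : 0 <= J u x by rewrite mule_ge0// lee_fin step_pdf_ge0.
have mJ : measurable_fun setT
    (fun v : ('rV[R]_m * 'rV[R]_d) * 'rV[R]_m => J v.1 v.2).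
  have m1 : measurable_fun setT (fun v : ('rV[R]_m * 'rV[R]_d) * 'rV[R]_m => v.1.1).
    exact: measurableT_comp measurable_fst measurable_fst.
  have m2 : measurable_fun setT (fun v : ('rV[R]_m * 'rV[R]_d) * 'rV[R]_m => v.1.2).
    exact: measurableT_comp measurable_snd measurable_fst.
  apply: emeasurable_funM.
    by apply: (measurableT_comp mg); exact: measurable_row_mx.
  under eq_fun do rewrite /step_pdf EFinM EFinM.
  apply: emeasurable_funM; last first.
    apply: mnoise; first exact: measurable_mulmxrV.
    apply: measurable_addrV => //; apply: measurable_opprV.
    by apply: measurable_scalerV => //; exact: measurable_stepH.
  apply: emeasurable_funM; first exact: (measurableT_comp (mdet q) m1).
  by apply: mnoise => //; exact: mG.
have mJ1 u : measurable_fun setT (J u).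
  exact: (measurableT_comp mJ (measurable_pair1 u)).
have mJi : measurable_fun setT (fun u => \int[lam]_x J u x).
  exact: (measurable_fun_fubini_tonelli_F (m2 := lam)
    (fun v : ('rV[R]_m * 'rV[R]_d) * 'rV[R]_m => J v.1 v.2)).
transitivity (\int[lam]_y \int[gam]_z \int[lam]_x J (y, z) x).
  apply: eq_integral => y _; rewrite YG step_meanE.
  set N := (noise_pdf c B a _)%:E; set D := (\det _)%:E.
  have ND0 : 0 <= N * D by rewrite mule_ge0// lee_fin.
  have mg1 : measurable_fun setT (fun v : 'rV[R]_d * 'rV[R]_m =>
      g (row_mx v.2 y) * (noise_pdf c B (v.1 *m E) (v.2 - e *: sH q y))%:E).
    apply: emeasurable_funM.
      by apply: (measurableT_comp mg); exact: measurable_row_mx.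
    apply: mnoise; first exact: measurable_mulmxrV.
    exact: measurable_addrV.
  have g10 v : 0 <= g (row_mx v.2 y) *
      (noise_pdf c B (v.1 *m E) (v.2 - e *: sH q y))%:E.
    by rewrite mule_ge0// lee_fin.
  have mg2 : measurable_fun setT (fun z => \int[lam]_x (g (row_mx x y) *
      (noise_pdf c B (z *m E) (x - e *: sH q y))%:E)).
    exact: (measurable_fun_fubini_tonelli_F (m2 := lam) (fun v : 'rV[R]_d * 'rV[R]_m =>
      g (row_mx v.2 y) * (noise_pdf c B (v.1 *m E) (v.2 - e *: sH q y))%:E)).
  rewrite -muleA -ge0_integralZr//; last first.
    by move=> z _; apply: integral_ge0 => x _; exact: (g10 (z, x)).
  apply: eq_integral => z _; rewrite -ge0_integralZr//; last first.
  - by move=> x _; exact: (g10 (z, x)).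
  - exact: (measurableT_comp mg1 (measurable_pair1 z)).
  apply: eq_integral => x _; rewrite /J /step_pdf /= -muleA; congr (_ * _).
  by rewrite /N /D -!EFinM; congr EFin; ring.
have Ji0 u : 0 <= \int[lam]_x J u x by apply: integral_ge0 => x _.
rewrite (fubini_tonelli (fun u : 'rV[R]_m * 'rV[R]_d => \int[lam]_x J u x))//.
apply: eq_integral => z _.
pose W := step_pdf_row F h e c B (row_mx q (row_mx a (z *m E))).
have mW : measurable_fun setT (fun x : 'rV[R]_(m + m) => g x * (W x)%:E).
  apply: emeasurable_funM => //; apply/measurable_EFinP.
  pose s := row_mx q (row_mx a (z *m E)).
  have [cW _] := cpf_growth (@cpf_step_pdf R m F h e c B smF polyF 0).
  apply: continuous_measurable_rV.
  refine (@cont_comp _ _ _ (fun x : 'rV[R]_(m + m) => (s, x)) _ _ cW).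
  by apply: cont_pair; [exact: cont_cst|exact: cont_id].
rewrite (ge0_integral_lebesgue_row_mx mW); last first.
  by move=> x; rewrite mule_ge0// lee_fin step_pdf_ge0.
have E1 x y : g (row_mx x y) * (W (row_mx x y))%:E = J (y, z) x.
  by rewrite /W step_pdf_rowE.
under [RHS]eq_integral do under eq_integral do rewrite E1.
have mJz : measurable_fun setT (fun v : 'rV[R]_m * 'rV[R]_m => J (v.1, z) v.2).
  apply: (measurableT_comp mJ (g := fun v : 'rV[R]_m * 'rV[R]_m => ((v.1, z), v.2))).
  by apply: measurable_fun_pair => //; exact: measurable_fun_pair.
exact: (fubini_tonelli (fun v : 'rV[R]_m * 'rV[R]_m => J (v.1, z) v.2)).
Qed.

End transition.

(** * Density after two steps *)

Lemma row_mx_norm (R : realType) m n (x : 'rV[R]_m) (y : 'rV[R]_n) :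
  `|row_mx x y| <= `|x| + `|y|.
Proof.
apply: norm_rV_le => [|i]; first exact: addr_ge0.
rewrite mxE; case: split_ordP => j _; apply: le_trans (ler_coord_norm _ j) _.
  by rewrite lerDl.
by rewrite lerDr.
Qed.

Section two_step_density.
Local Open Scope ereal_scope.
Variables (R : realType) (m d : nat) (F : 'rV[R]_m -> R) (h e c k : R).
Variables (B : 'M[R]_m) (E : 'M[R]_(d, m)) (phi : 'rV[R]_d -> 'rV[R]_m).
Hypotheses (smF : smooth F)
  (polyF : forall a, exists C p, forall y, (`|pderiv a F y| <= C * (1 + `|y|) ^+ p)%R).
Hypotheses (k0 : (0 < k)%R) (c0 : (0 < c)%R).
Hypothesis Gsec : forall q, secant k (stepG F h q) (stepA F h q).
Hypothesis mphi : measurable_fun setT phi.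
Hypothesis noiseE : forall g : 'rV[R]_m -> \bar R,
  measurable_fun setT g -> (forall x, 0 <= g x) ->
  \int[gauss_rV R d]_z g (phi z) = \int[gauss_rV R d]_z \int[lebesgue_rV R m]_x
    (g x * (noise_pdf c B (z *m E) x)%:E).
Variable Y : 'rV[R]_m -> 'rV[R]_m -> 'rV[R]_m.
Hypotheses (GY : forall q, cancel (Y q) (stepG F h q))
  (YG : forall q, cancel (stepG F h q) (Y q)).
Variables (disp : measure_display) (Omega : measurableType disp).
Variables (Pr : probability Omega R) (C1 C2 : set (set Omega)).
Variables (q a xi1 xi2 : Omega -> 'rV[R]_m).
Hypotheses (sC1 : sigma_algebra setT C1) (mC1 : C1 `<=` measurable).
Hypotheses (sC2 : sigma_algebra setT C2) (mC2 : C2 `<=` measurable).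
Hypotheses (aq : adapted C1 q) (aa : adapted C1 a) (C12 : C1 `<=` C2).
Hypotheses (law1 : indep_law Pr C1 xi1 phi) (law2 : indep_law Pr C2 xi2 phi).
Hypothesis axi : adapted C2 xi1.
Hypotheses (momq : moments Pr (fun w => `|q w|%R)) (moma : moments Pr (fun w => `|a w|%R)).
Local Notation gam := (gauss_rV R d).
Local Notation lam := (lebesgue_rV R m).

Let Q' w := Y (q w) (a w + xi1 w)%R.
Let P' w := (e *: stepH F h (q w) (Q' w) + xi2 w)%R.

Let param (u : Omega * ('rV[R]_d * 'rV[R]_d)) :=
  row_mx (q u.1) (row_mx (a u.1 + u.2.1 *m E) (u.2.2 *m E))%R.

Let P3 : probability _ R := Pr \x (gam \x gam).

Let mq : measurable_fun setT q := adapted_measurable mC1 aq.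
Let ma : measurable_fun setT a := adapted_measurable mC1 aa.

Let m21 : measurable_fun setT (fun u : Omega * ('rV[R]_d * 'rV[R]_d) => u.2.1).
Proof. exact: measurableT_comp measurable_fst measurable_snd. Qed.

Let m22 : measurable_fun setT (fun u : Omega * ('rV[R]_d * 'rV[R]_d) => u.2.2).
Proof. exact: measurableT_comp measurable_snd measurable_snd. Qed.

Let mparam : measurable_fun setT param.
Proof.
apply: measurable_row_mx; first exact: measurableT_comp mq measurable_fst.
apply: measurable_row_mx; last exact: measurable_mulmxrV.
by apply: measurable_addrV; [exact: measurableT_comp ma measurable_fst|exact: measurable_mulmxrV].
Qed.

Let mom_gauss : moments gam (fun z : 'rV[R]_d => `|z|%R).
Proof. by apply: moments_norm_rV => // i; exact: moments_gauss. Qed.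

Let mom_param : moments P3 (fun u => `|param u|%R).
Proof.
have mom1 X : moments Pr X -> moments P3 (fun u => X u.1).
  by move=> mX; exact: (moments_fst (gam \x gam) mX).
have [M M0 ME] := norm_mulmx_le E.
have mom2 : moments P3 (fun u => `|u.2.1|%R).
  exact: (moments_snd Pr (moments_fst gam mom_gauss)).
have mom3 : moments P3 (fun u => `|u.2.2|%R).
  exact: (moments_snd Pr (moments_snd gam mom_gauss)).
refine (@moments_le _ _ R P3 (fun u => `|param u|%R) (fun u => `|q u.1| + (`|a u.1| +
  (M * `|u.2.1| + M * `|u.2.2|)))%R _ _ _).
- by apply: measurable_norm_rV.
- move=> u; rewrite normr_id (le_trans (row_mx_norm _ _))//.
  rewrite [leRHS]ger0_norm ?addr_ge0 ?mulr_ge0//.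
  rewrite lerD2l (le_trans (row_mx_norm _ _))// addrA lerD//.
  by rewrite (le_trans (ler_normD _ _))// lerD2l.
- have mM : moments P3 (fun=> M) by exact: moments_cst.
  exact: (momentsD (mom1 _ momq) (momentsD (mom1 _ moma)
    (momentsD (momentsM mM mom2) (momentsM mM mom3)))).
Qed.

Let dens z := expect P3 param (step_pdf_row F h e c B) z.

Let gW : growth (step_pdf_row F h e c B) := cpf_growth (@cpf_step_pdf R m F h e c B smF polyF 0).

Let W0 w z : (0 <= step_pdf_row F h e c B w z)%R.
Proof. exact: (step_pdf_ge0 e B k0 c0 Gsec). Qed.

Let densE z : (dens z)%:E = \int[P3]_u (step_pdf_row F h e c B (param u) z)%:E.
Proof.
rewrite /dens /expect /Rintegral fineK//.
exact: integrable_fin_num (growth_integrable mparam mom_param z gW).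
Qed.

Let aQ' : adapted C2 Q'.
Proof.
apply/(adaptedP _ sC2).
have aq2 := (adaptedP _ sC2).1 (adapted_mono C12 aq).
have aa2 := (adaptedP _ sC2).1 (adapted_mono C12 aa).
have ax2 := (adaptedP _ sC2).1 axi.
by apply: (measurable_step_inverse smF k0 Gsec GY) => //; exact: measurable_addrV.
Qed.

(** Integrate out [xi2] given the events of [C2], then [xi1] given those of
    [C1]; what remains is the expectation of the transition density over [q],
    [a] and the frozen Gaussian coordinates. *)
Lemma two_step_integral (g : 'rV[R]_(m + m) -> \bar R) :
  measurable_fun setT g -> (forall x, 0 <= g x) ->
  \int[Pr]_w g (row_mx (P' w) (Q' w)) =
  \int[lebesgue_rV R (m + m)]_z (g z * (dens z)%:E).
Proof.
move=> mg g0.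
have mY dT (T : measurableType dT) (f f' : T -> 'rV[R]_m) :
    measurable_fun setT f -> measurable_fun setT f' ->
    measurable_fun setT (fun t => Y (f t) (f' t)).
  exact: (measurable_step_inverse smF k0 Gsec GY).
have mmean dT (T : measurableType dT) (f f' : T -> 'rV[R]_m) :
    measurable_fun setT f -> measurable_fun setT f' ->
    measurable_fun setT (fun t => step_mean F h e phi g (f t) (f' t)).
  exact: (measurable_step_mean h e smF mphi mg g0).
have mean0 := step_mean_ge0 F h e phi g0.
have aqQ : adapted C2 (fun w => (q w, Q' w)).
  by apply: adapted_pair => //; exact: adapted_mono C12 aq.
have mh2 : measurable_fun setT (fun z : ('rV[R]_m * 'rV[R]_m) * 'rV[R]_m =>
    g (row_mx (e *: stepH F h z.1.1 z.1.2 + z.2)%R z.1.2)).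
  have n1 : measurable_fun setT (fun z : ('rV[R]_m * 'rV[R]_m) * 'rV[R]_m => z.1.2).
    exact: measurableT_comp measurable_snd measurable_fst.
  apply: (measurableT_comp mg); apply: measurable_row_mx => //.
  apply: measurable_addrV => //; apply: measurable_scalerV => //.
  by apply: (measurable_stepH h smF) => //; exact: measurableT_comp measurable_fst measurable_fst.
transitivity (\int[Pr]_w step_mean F h e phi g (q w) (Q' w)).
  exact: (indep_law_integral law2 (adapted_measurable mC2 aqQ) aqQ mh2 (fun x => g0 _)).
have aqa : adapted C1 (fun w => (q w, a w)) by exact: adapted_pair.
have mh1 : measurable_fun setT (fun z : ('rV[R]_m * 'rV[R]_m) * 'rV[R]_m =>
    step_mean F h e phi g z.1.1 (Y z.1.1 (z.1.2 + z.2)%R)).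
  have n1 : measurable_fun setT (fun z : ('rV[R]_m * 'rV[R]_m) * 'rV[R]_m => z.1.2).
    exact: measurableT_comp measurable_snd measurable_fst.
  have n2 : measurable_fun setT (fun z : ('rV[R]_m * 'rV[R]_m) * 'rV[R]_m => z.1.1).
    exact: measurableT_comp measurable_fst measurable_fst.
  by apply: mmean => //; apply: mY => //; exact: measurable_addrV.
transitivity (\int[Pr]_w \int[gam]_z
    step_mean F h e phi g (q w) (Y (q w) (a w + phi z)%R)).
  exact: (indep_law_integral law1 (adapted_measurable mC1 aqa) aqa mh1 (fun x => mean0 _ _)).
pose L (w : 'rV[R]_(m + (m + m))) : \bar R := \int[lebesgue_rV R (m + m)]_x
  (g x * (step_pdf_row F h e c B w x)%:E).
have mW : measurable_fun setT (fun z : 'rV[R]_(m + (m + m)) * 'rV[R]_(m + m) =>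
    g z.2 * (step_pdf_row F h e c B z.1 z.2)%:E).
  apply: emeasurable_funM; first exact: measurableT_comp mg measurable_snd.
  by apply/measurable_EFinP; apply: continuous_measurable_pairR; exact: gW.1.
have W00 w x : 0 <= g x * (step_pdf_row F h e c B w x)%:E by rewrite mule_ge0// lee_fin.
have mL : measurable_fun setT L.
  exact: (measurable_fun_fubini_tonelli_F (m2 := lebesgue_rV R (m + m))
    (fun z : 'rV[R]_(m + (m + m)) * 'rV[R]_(m + m) =>
    g z.2 * (step_pdf_row F h e c B z.1 z.2)%:E)).
have L0 w : 0 <= L w by apply: integral_ge0 => x _.
transitivity (\int[Pr]_w \int[gam]_z1 \int[gam]_z2 L (param (w, (z1, z2)))).
  apply: eq_integral => w _.
  have mk : measurable_fun setT (fun x : 'rV[R]_m =>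
      step_mean F h e phi g (q w) (Y (q w) (a w + x)%R)).
    by apply: mmean => //; apply: mY => //; exact: measurable_addrV.
  rewrite (noiseE mk (fun x => mean0 _ _)); apply: eq_integral => z1 _.
  transitivity (\int[lam]_p (step_mean F h e phi g (q w) (Y (q w) p) *
      (noise_pdf c B (a w + z1 *m E)%R p)%:E)); last first.
    exact: (transition_integral e smF polyF k0 c0 Gsec mphi noiseE GY YG mg g0 (q w)
      (a w + z1 *m E)%R).
  have mT : measurable_fun setT (fun x : 'rV[R]_m =>
      step_mean F h e phi g (q w) (Y (q w) x) *
      (noise_pdf c B (a w + z1 *m E)%R x)%:E).
    apply: emeasurable_funM.
      by apply: mmean => //; apply: mY.
    apply/measurable_EFinP; apply: measurable_funM => //.
    apply: (measurableT_comp (f := @gauss_pdf R m)).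
      by apply: continuous_measurable_rV; exact: continuous_gauss_pdf.
    by apply: measurable_mulmxrV; exact: measurable_addrV.
  have T0 x : 0 <= step_mean F h e phi g (q w) (Y (q w) x) *
      (noise_pdf c B (a w + z1 *m E)%R x)%:E.
    by rewrite mule_ge0 ?mean0// lee_fin mulr_ge0 ?gauss_pdf_ge0// ltW.
  have shift := ge0_integral_lebesgue_rVD (a w) mT T0.
  etransitivity; last exact: shift.
  apply: eq_integral => x _; rewrite (addrC x).
  have -> // : noise_pdf c B (a w + z1 *m E)%R (a w + x)%R = noise_pdf c B (z1 *m E) x.
  rewrite /noise_pdf; congr (_ * gauss_pdf (_ *m B))%R.
  by rewrite opprD addrACA subrr add0r.
have mLp : measurable_fun setT (fun u => L (param u)) by exact: measurableT_comp mL mparam.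
transitivity (\int[P3]_u L (param u)).
  rewrite fubini_tonelli1//; apply: eq_integral => w _.
  have mLw : measurable_fun setT (fun z => L (param (w, z))).
    exact: measurableT_comp mLp (measurable_pair1 w).
  by rewrite /fubini_F fubini_tonelli1.
have mT : measurable_fun setT
    (fun v : (Omega * ('rV[R]_d * 'rV[R]_d)) * 'rV[R]_(m + m) =>
    g v.2 * (step_pdf_row F h e c B (param v.1) v.2)%:E).
  apply: (measurableT_comp mW
    (g := fun v : (Omega * ('rV[R]_d * 'rV[R]_d)) * 'rV[R]_(m + m) => (param v.1, v.2))).
  by apply: measurable_fun_pair => //; exact: measurableT_comp mparam measurable_fst.
rewrite (fubini_tonelli (fun v : (Omega * ('rV[R]_d * 'rV[R]_d)) * 'rV[R]_(m + m) =>
    g v.2 * (step_pdf_row F h e c B (param v.1) v.2)%:E))//.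
apply: eq_integral => z _; rewrite densE.
have mz : measurable_fun setT (fun u => (step_pdf_row F h e c B (param u) z)%:E).
  by apply/measurable_EFinP; exact: measurable_growth.
have z0 u : 0 <= (step_pdf_row F h e c B (param u) z)%:E by rewrite lee_fin.
transitivity (\int[P3]_u (g z * (step_pdf_row F h e c B (param u) z)%:E)) => //.
by rewrite ge0_integralZl.
Qed.

Lemma two_step_smooth_density :
  has_smooth_density Pr (fun w => row_mx (P' w) (Q' w)).
Proof.
exists dens; split.
- by apply: expect_smooth => // j; exact: cpf_step_pdf.
- by move=> z; rewrite -lee_fin densE; apply: integral_ge0 => u _; rewrite lee_fin.
move=> A mA.
have mX : measurable_fun setT (fun w => row_mx (P' w) (Q' w)).
  have mQ' := adapted_measurable mC2 aQ'; have [mxi2 _ _] := law2.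
  apply: measurable_row_mx => //; apply: measurable_addrV => //.
  by apply: measurable_scalerV => //; exact: (measurable_stepH h smF).
have mXA : measurable ((fun w => row_mx (P' w) (Q' w)) @^-1` A).
  by rewrite -[X in measurable X]setTI; exact: mX.
have mI : measurable_fun setT (fun x : 'rV[R]_(m + m) => (\1_A x : R)%:E).
  by apply/measurable_EFinP; exact: measurable_indic.
have I0 x : 0 <= (\1_A x : R)%:E by rewrite lee_fin.
transitivity (\int[Pr]_w (\1_A (row_mx (P' w) (Q' w)))%:E).
  transitivity (\int[Pr]_w (\1_((fun w => row_mx (P' w) (Q' w)) @^-1` A) w)%:E) => //.
  by rewrite integral_indic// setIT.
rewrite (two_step_integral mI I0) [RHS]integral_mkcond.
apply: eq_integral => z _; rewrite patchE indicE.
by case: ifPn => _; rewrite ?mul1e ?mul0e.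
Qed.

End two_step_density.

(** * The scheme driven by a given noise *)

Section vector_moments.
Variables (R : realType) (disp : measure_display) (Omega : measurableType disp).
Variables (Pr : probability Omega R) (m : nat).
Implicit Types X Z : Omega -> 'rV[R]_m.

Definition vmoments X := forall i, moments Pr (fun w => X w ord0 i).

Lemma vmoments_measurable X : vmoments X -> measurable_fun setT X.
Proof. by move=> vX; apply: measurable_fun_rV => i; have [] := vX i. Qed.

Lemma vmoments_norm X : vmoments X -> moments Pr (fun w => `|X w|).
Proof. by move=> vX; apply: moments_norm_rV => //; exact: vmoments_measurable. Qed.

Lemma vmoments_le X (b : Omega -> R) : measurable_fun setT X ->
  (forall w, `|X w| <= `|b w|) -> moments Pr b -> vmoments X.
Proof.
move=> mX Xb mb i; apply: (moments_le _ _ mb).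
  exact: (measurableT_comp (measurable_rV_coord i) mX).
by move=> w; exact: le_trans (ler_coord_norm (X w) i) (Xb w).
Qed.

Lemma vmomentsD X Z : vmoments X -> vmoments Z -> vmoments (fun w => X w + Z w).
Proof.
move=> vX vZ i; under eq_fun do rewrite mxE.
by apply: momentsD; [exact: vX|exact: vZ].
Qed.

Lemma vmomentsZ c X : vmoments X -> vmoments (fun w => c *: X w).
Proof.
move=> vX i; under eq_fun do rewrite mxE.
by apply: momentsM; [exact: moments_cst|exact: vX].
Qed.

Lemma vmomentsB X Z : vmoments X -> vmoments Z -> vmoments (fun w => X w - Z w).
Proof.
move=> vX vZ; under eq_fun do rewrite -scaleN1r.
by apply: vmomentsD => //; exact: vmomentsZ.
Qed.

Lemma vmoments_cst x : vmoments (fun=> x).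
Proof. by move=> i; exact: moments_cst. Qed.

Lemma vmoments_noise d (C : set (set Omega)) X (s : R) (M : 'M[R]_(d, m)) :
  sigma_algebra setT C -> C `<=` measurable ->
  indep_law Pr C X (fun z => (s *: z) *m M) -> vmoments X.
Proof.
move=> sC Cm iX i; have [mX mphi _] := iX.
have mi : measurable_fun setT (fun x : 'rV[R]_m => x ord0 i) by exact: measurable_rV_coord.
split; first exact: measurableT_comp mi mX.
move=> p.
have CT : C setT by have [C0 CC _] := sC; have := CC _ C0; rewrite setD0.
have mg : measurable_fun setT (fun x : 'rV[R]_m => (`|x ord0 i| ^+ p)%:E).
  exact: measurable_normX.
have g0 (x : 'rV[R]_m) : (0 <= (`|x ord0 i| ^+ p)%:E)%E by rewrite lee_fin exprn_ge0.
have := indep_law_event sC Cm CT iX mg g0.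
have -> : (\int[Pr]_w ((\1_setT w : R)%:E * (`|X w ord0 i| ^+ p)%:E) =
    \int[Pr]_w (`|X w ord0 i| ^+ p)%:E)%E.
  by apply: eq_integral => w _; rewrite indicT mul1e.
move=> ->; rewrite probability_setT mul1e.
have : moments (gauss_rV R d) (fun z => ((s *: z) *m M) ord0 i).
  under eq_fun do rewrite mxE; apply: moments_sum => j.
  under eq_fun do rewrite mxE; apply: momentsM; last exact: moments_cst.
  by apply: momentsM; [exact: moments_cst|exact: moments_gauss].
by move=> [_]; apply.
Qed.

End vector_moments.

Section scheme.
Variables (R : realType) (m : nat) (F : 'rV[R]_m -> R) (h e k : R).
Hypotheses (smF : smooth F)
  (polyF : forall a, exists C p, forall y, `|pderiv a F y| <= C * (1 + `|y|) ^+ p).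
Hypotheses (h0 : 0 < h) (k0 : 0 < k).
Hypothesis Gsec : forall q, secant k (stepG F h q) (stepA F h q).
Variable Y : 'rV[R]_m -> 'rV[R]_m -> 'rV[R]_m.
Hypotheses (GY : forall q, cancel (Y q) (stepG F h q))
  (YG : forall q, cancel (stepG F h q) (Y q)).

(** Eliminate the momentum after the step between the two implicit equations. *)
Lemma avf_step (p q pb qb : 'rV[R]_m) :
  pb = p - h *: avg_grad F q qb -> qb = q + (h / 2) *: (pb + p) ->
  qb = Y q p /\ pb = stepH F h q (Y q p).
Proof.
move=> pbE qbE; have hn : h != 0 by rewrite gt_eqF.
have G : stepG F h q qb = p.
  apply/rowP => i; have qi := congr1 (fun x : 'rV[R]_m => x ord0 i) qbE.
  have pi_ := congr1 (fun x : 'rV[R]_m => x ord0 i) pbE.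
  move: qi pi_; rewrite /stepG !mxE; move: (avg _ _ _ _ _) => a.
  move: (pb ord0 i) (p ord0 i) (q ord0 i) (qb ord0 i) => x1 x2 x3 x4 -> ->.
  by field.
have qbY : qb = Y q p by rewrite -G YG.
split; first exact: qbY.
rewrite -qbY; apply/rowP => i; have qi := congr1 (fun x : 'rV[R]_m => x ord0 i) qbE.
have pi_ := congr1 (fun x : 'rV[R]_m => x ord0 i) pbE.
move: qi pi_; rewrite /stepH !mxE; move: (avg _ _ _ _ _) => a.
move: (pb ord0 i) (p ord0 i) (q ord0 i) (qb ord0 i) => x1 x2 x3 x4 -> ->.
by field.
Qed.

Variables (disp : measure_display) (Omega : measurableType disp).
Variable Pr : probability Omega R.

Lemma vmoments_avg_grad (q y : Omega -> 'rV[R]_m) : vmoments Pr q -> vmoments Pr y ->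
  vmoments Pr (fun w => avg_grad F (q w) (y w)).
Proof.
move=> vq vy i; under eq_fun do rewrite mxE.
have [C [p CF]] := polyF [:: i].
apply: (@moments_le _ _ _ Pr _ (fun w => C * (1 + `|q w| + `|y w|) ^+ p)).
- apply: (measurableT_comp (f := fun z : 'rV[R]_m * 'rV[R]_m => avg F [:: i] 0 z.1 z.2)
    (g := fun w => (q w, y w))).
    by apply: continuous_measurable_pairR; exact: cont_avg.
  by apply: measurable_fun_pair; exact: vmoments_measurable.
- by move=> w; apply: le_trans (avg_growth smF 0 CF _ _) (ler_norm _).
- apply: momentsM; first exact: moments_cst.
  apply: momentsX; apply: momentsD; last exact: vmoments_norm.
  by apply: momentsD; [exact: moments_cst|exact: vmoments_norm].
Qed.

Lemma vmoments_stepH (q y : Omega -> 'rV[R]_m) : vmoments Pr q -> vmoments Pr y ->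
  vmoments Pr (fun w => stepH F h (q w) (y w)).
Proof.
move=> vq vy; apply: vmomentsB; apply: vmomentsZ; first exact: vmomentsB.
exact: vmoments_avg_grad.
Qed.

(** Compare the solution with [q], whose residue is [p - stepG q q], by
    expansivity. *)
Lemma step_inverse_norm q p : `|Y q p| <= `|q| + (m.+1)%:R / k * `|p - stepG F h q q|.
Proof.
have := expansive_norm q (Y q p) (secant_expansive k0 (Gsec q)); rewrite GY.
set u := p - _ => H.
have {}H : k ^+ 2 * `|Y q p - q| ^+ 2 <= ((m.+1)%:R * `|u|) ^+ 2.
  apply: le_trans H _; apply: le_trans (vdot_le_sqr_norm u) _.
  rewrite exprMn ler_wpM2r ?sqr_ge0//.
  by rewrite -natrX ler_nat expnS expn1 mulSn (leq_trans (leqnSn m))// leq_addr.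
have H2 : `|Y q p - q| <= (m.+1)%:R / k * `|u|.
  rewrite mulrAC ler_pdivlMr// mulrC -ler_sqr ?nnegrE ?mulr_ge0 ?(ltW k0)//.
  by rewrite exprMn.
rewrite -{1}[Y q p](subrK q) addrC (le_trans (ler_normD _ _))// lerD2l.
by [].
Qed.

Lemma vmoments_step_inverse (q p : Omega -> 'rV[R]_m) :
  vmoments Pr q -> vmoments Pr p -> vmoments Pr (fun w => Y (q w) (p w)).
Proof.
move=> vq vp.
apply: (@vmoments_le _ _ _ _ _ _ (fun w => `|q w| +
  (m.+1)%:R / k * `|p w - stepG F h (q w) (q w)|)).
- by apply: (measurable_step_inverse smF k0 Gsec GY); exact: vmoments_measurable.
- by move=> w; apply: le_trans (step_inverse_norm _ _) (ler_norm _).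
- apply: momentsD; first exact: vmoments_norm.
  apply: momentsM; first exact: moments_cst.
  apply: vmoments_norm; apply: vmomentsB => //.
  by apply: vmomentsD; apply: vmomentsZ; [exact: vmomentsB|exact: vmoments_avg_grad].
Qed.

Variables (xi : nat -> Omega -> 'rV[R]_m) (p0 q0 : 'rV[R]_m).

(** Momentum first, position second. With the versions of the noise from
    [exponential_noise], this is a version of the numerical solution that is
    adapted without exceptional null sets. *)
Fixpoint scheme n (w : Omega) : 'rV[R]_m * 'rV[R]_m :=
  if n is n'.+1 then
    let y := Y (scheme n' w).2 (scheme n' w).1 in
    (e *: stepH F h (scheme n' w).2 y + xi n' w, y)
  else (p0, q0).

Lemma scheme_vmoments n : (forall j, (j < n)%N -> vmoments Pr (xi j)) ->
  vmoments Pr (fun w => (scheme n w).1) /\ vmoments Pr (fun w => (scheme n w).2).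
Proof.
elim: n => [_|n IH vxi]; first by split; exact: vmoments_cst.
have [vp vq] : vmoments Pr (fun w => (scheme n w).1) /\
    vmoments Pr (fun w => (scheme n w).2).
  by apply: IH => j jn; apply: vxi; exact: ltnW.
have vy := vmoments_step_inverse vq vp.
split=> //=; apply: vmomentsD; last exact: vxi.
by apply: vmomentsZ; exact: vmoments_stepH.
Qed.

Lemma scheme_adapted (Ft : nat -> set (set Omega)) n :
  (forall j, sigma_algebra setT (Ft j)) ->
  (forall j, Ft j `<=` Ft j.+1) ->
  (forall j, (j < n)%N -> adapted (Ft j.+1) (xi j)) ->
  adapted (Ft n) (fun w => (scheme n w).1) /\ adapted (Ft n) (fun w => (scheme n w).2).
Proof.
move=> sF F1; elim: n => [_|n IH axi]; first by split; exact: adapted_cst.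
have [ap aq] : adapted (Ft n) (fun w => (scheme n w).1) /\
    adapted (Ft n) (fun w => (scheme n w).2).
  by apply: IH => j jn; apply: axi; exact: ltnW.
have mp := (adaptedP _ (sF n.+1)).1 (adapted_mono (@F1 n) ap).
have mq := (adaptedP _ (sF n.+1)).1 (adapted_mono (@F1 n) aq).
have my := measurable_step_inverse smF k0 Gsec GY mq mp.
split; last exact/(adaptedP _ (sF n.+1)).
apply/(adaptedP _ (sF n.+1)) => /=.
apply: measurable_addrV; last by apply/(adaptedP _ (sF n.+1)); exact: axi.
by apply: measurable_scalerV => //; exact: (measurable_stepH h smF).
Qed.

End scheme.

(** * Density of the numerical solution *)

Lemma has_smooth_density_ae (R : realType) disp (Omega : measurableType disp)
    (Pr : probability Omega R) n (X Z : Omega -> 'rV[R]_n) :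
  measurable_fun setT X -> measurable_fun setT Z -> {ae Pr, forall w, X w = Z w} ->
  has_smooth_density Pr Z -> has_smooth_density Pr X.
Proof.
move=> mX mZ XZ [p [smp p0 pE]]; exists p; split => // A mA; rewrite -pE//.
have mpre (V : Omega -> 'rV[R]_n) : measurable_fun setT V -> measurable (V @^-1` A).
  by move=> mV; rewrite -[X in measurable X]setTI; exact: mV.
have ind (V : Omega -> 'rV[R]_n) : measurable_fun setT V ->
    (pushforward Pr V A = \int[Pr]_w (\1_(V @^-1` A) w)%:E)%E.
  by move=> mV; rewrite integral_indic ?setIT//; exact: mpre.
rewrite !ind//; apply: ae_eq_integral => //.
- by apply/measurable_EFinP; apply: measurable_indic; exact: mpre.
- by apply/measurable_EFinP; apply: measurable_indic; exact: mpre.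
- apply: filterS XZ => w XZw _; congr EFin; rewrite !indicE; congr (_%:R).
  by congr nat_of_bool; apply/idP/idP; rewrite !inE /preimage /= XZw.
Qed.

Lemma ker_prim_increment (R : realType) (v a b : R) :
  ker_prim v b b - ker_prim v b a = (1 - expR (- v * (b - a)) ^+ 2) / (2 * v).
Proof. by rewrite /ker_prim /ker subrr mulr0 expR0 expr1n -mulrBl. Qed.

Lemma row_free_noise_mx (R : realType) m d (sigma : 'I_d -> 'rV[R]_m) (f : 'I_m -> 'I_d) :
  row_free (\matrix_(i < m) sigma (f i)) ->
  row_free (\matrix_(i < m) row (f i) (noise_mx sigma)).
Proof.
congr (is_true (row_free _)); apply/matrixP => i j; rewrite !mxE.
by [].
Qed.

Theorem corollary6p4 (R : realType) (m d : nat) (hm : (1 <= m)%N)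
  (hd : (1 <= d)%N) (T v : R) (hT : 0 < T) (hv : 0 < v)
  (sigma : 'I_d -> 'rV[R]_m)
  (disp : measure_display) (Omega : measurableType disp)
  (Pr : probability Omega R) (hPr : measure_is_complete Pr)
  (Ft : R -> set (set Omega)) (hFt : filtration Ft)
  (W : 'I_d -> R -> Omega -> R) (hW : wiener_process Pr Ft W)
  (p0 q0 : 'rV[R]_m)
  (F : 'rV[R]_m -> R) (C0 K : R) (hF : potential_assumption F C0 K)
  (hFinf : Cp_infty F)
  (l : 'I_m -> nat) (hl : forall i, (1 <= l i)%N)
  (C1 C2 C3 eps : R) (hC1 : 0 < C1) (hC2 : 0 < C2) (hC3 : 0 < C3)
  (heps : 0 < eps)
  (hbounds : polynomial_bounds F l C1 C2 C3 eps)
  (hgrowth : derivative_growth F l)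
  (hsigma : exists f : 'I_m -> 'I_d,
    injective f /\ row_free (\matrix_(i < m) sigma (f i))) :
  exists h0 : R, 0 < h0 /\
    forall (N : nat) (h : R), (0 < N)%N -> h = T / N%:R -> h < h0 ->
      (0 < K -> h < 2 / Num.sqrt K) ->
      forall P Q : nat -> Omega -> 'rV[R]_m,
        splitting_avf Pr F v sigma W p0 q0 h N P Q ->
        has_smooth_density Pr (fun w => row_mx (P N w) (Q N w)).
Proof.
(* [h < T] leaves at least two steps, as the argument requires. *)
exists T; split => // N h N0 hE hltT hK P Q [mPQ [Pb [Qb [J [hJ sch]]]]].
have smF : smooth F by have [] := hFinf.
have polyF := Cp_infty_growth hFinf.
have [_ _ _ K0 lamK] := hF.
have Hcoer y : coercive_mx (- K) (hessian F y).
  exact: lambda_min_coercive hm (hessian_sym smF y) (lamK y).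
have h0 : 0 < h by rewrite hE divr_gt0// ltr0n.
have N1 : (1 < N)%N.
  move: hltT; rewrite hE ltr_pdivrMr ?ltr0n// -{1}[T]mulr1 ltr_pM2l//.
  by rewrite -[1]/(1%:R) ltr_nat.
pose k := h^-1 - h * K / 4.
have k0 : 0 < k.
  rewrite subr_gt0; move: K0; rewrite le_eqVlt => /orP[/eqP <-|Kpos].
    by rewrite mulr0 mul0r invr_gt0.
  have sK : 0 < Num.sqrt K by rewrite sqrtr_gt0.
  have := hK Kpos; rewrite ltr_pdivlMr// => hs.
  have : (h * Num.sqrt K) ^+ 2 < 2 ^+ 2.
    by rewrite ltrXn2r// ?nnegrE ?mulr_ge0// ltW.
  rewrite exprMn sqr_sqrtr ?(ltW Kpos)// => h2.
  have -> : h * K / 4 = h ^+ 2 * K / 2 ^+ 2 * h^-1 by field; rewrite gt_eqF.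
  by rewrite -[ltRHS]mul1r ltr_pM2r ?invr_gt0// ltr_pdivrMr ?mul1r// exprn_gt0.
have Gsec q := stepG_secant smF h0 Hcoer q.
have [Y [GY YG]] := secant_inverse k0 Gsec.
pose e := expR (- v * h).
have t0 n : 0 <= n%:R * h by rewrite mulr_ge0// ltW.
have tlt n : n%:R * h < n.+1%:R * h by rewrite ltr_pM2r// ltr_nat.
pose s := Num.sqrt ((1 - expR (- v * h) ^+ 2) / (2 * v)).
have sE n : noise_std v (n%:R * h) (n.+1%:R * h) = s.
  rewrite /noise_std ker_prim_increment -mulrBl -natr1.
  by rewrite (_ : n%:R + 1 - n%:R = 1) ?mul1r//; ring.
have s0 : 0 < s.
  rewrite sqrtr_gt0 divr_gt0 ?mulr_gt0// subr_gt0 exprn_ilt1// ?expR_ge0//.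
  by rewrite -expR0 ltr_expR mulNr oppr_lt0 mulr_gt0.
have /choice[xi xiP] : forall n, exists xi : Omega -> 'rV[R]_m, (n < N)%N ->
    [/\ adapted (Ft (n.+1%:R * h)) xi,
        indep_law Pr (Ft (n%:R * h)) xi (fun z => (s *: z) *m noise_mx sigma) &
        {ae Pr, forall w, \sum_k J n k w = xi w}].
  move=> n; have [nN|Nn] := ltnP n N; last by exists (fun=> 0).
  have [xi xiP] := exponential_noise hFt hW hv (t0 n) (tlt n) (fun k i => hJ n k i nN).
  by exists xi => _; move: xiP; rewrite sE.
have [f [finj free]] := hsigma.
have [c [B [E [c0 noiseE]]]] :=
  ge0_integral_gauss_image s0 finj (row_free_noise_mx free).
pose X n w := scheme F h e Y xi p0 q0 n w.
pose G (n : nat) := Ft (n%:R * h).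
have sG n : sigma_algebra setT (G n) by exact: filtration_sigma hFt _ (t0 n).
have mG n : G n `<=` measurable by exact: filtration_measurable hFt _ (t0 n).
have G1 n : G n `<=` G n.+1.
  by apply: filtration_mono hFt _ _ (t0 n) _; exact/ltW/tlt.
have aX n : (n <= N)%N -> adapted (G n) (fun w => (X n w).1) /\
    adapted (G n) (fun w => (X n w).2).
  move=> nN; apply: (scheme_adapted e smF k0 Gsec GY) => // j jn.
  by have [] := xiP j (leq_trans jn nN).
have vX n : (n <= N)%N -> vmoments Pr (fun w => (X n w).1) /\
    vmoments Pr (fun w => (X n w).2).
  move=> nN; apply: (scheme_vmoments e smF polyF k0 Gsec GY) => // j jn.
  have [_ lawj _] := xiP j (leq_trans jn nN).
  exact: vmoments_noise (sG j) (@mG j) lawj.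
(* The given solution only agrees almost surely with the adapted version [X],
   which has the same law. *)
have XE : {ae Pr, forall w n, (n <= N)%N -> P n w = (X n w).1 /\ Q n w = (X n w).2}.
  have xiE : {ae Pr, forall w n, (n < N)%N -> \sum_k J n k w = xi n w}.
    apply: ae_foralln => n; have [nN|Nn] := ltnP n N.
      by have [_ _] := xiP n nN; apply: filterS.
    by apply: aeW.
  apply: filterS2 sch xiE => w [P0 Q0 step] xiw; elim=> [_|n IH nN]; first by split.
  have [Pn Qn] := IH (ltnW nN); have [PbE QbE PE QE] := step n nN.
  have gradE : \row_i (\int[lebesgue_measure]_(tau in `[0, 1])
      gradient F (Q n w + tau *: (Qb n.+1 w - Q n w)) ord0 i) =
      avg_grad F (Q n w) (Qb n.+1 w).
    apply/rowP => i; rewrite !mxE; apply: eq_Rintegral => t _.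
    by rewrite mxE expr0 mul1r.
  rewrite gradE in PbE.
  have [QbY PbH] := avf_step h0 YG PbE QbE.
  by rewrite PE QE xiw// QbY PbH Pn Qn.
have [n NE] : exists n, N = n.+2 by case: (N) N1 => [//|[//|n]] _; exists n.
have n1N : (n.+1 < N)%N by rewrite NE.
have nN : (n < N)%N by rewrite ltnW.
have [mPN mQN] := mPQ N (leqnn N).
have [ap aq] := aX n (ltnW nN); have [vp vq] := vX n (ltnW nN).
have [aP aQ] := aX N (leqnn N).
have aq1 : adapted (G n) (fun w => (X n.+1 w).2).
  apply/(adaptedP _ (sG n)); apply: (measurable_step_inverse smF k0 Gsec GY);
    exact/(adaptedP _ (sG n)).
have [_ vq1] := vX n.+1 (ltnW n1N).
have aa1 : adapted (G n) (fun w => e *: stepH F h (X n w).2 (X n.+1 w).2).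
  apply/(adaptedP _ (sG n)); apply: measurable_scalerV => //.
  by apply: (measurable_stepH h smF); exact/(adaptedP _ (sG n)).
have va1 : vmoments Pr (fun w => e *: stepH F h (X n w).2 (X n.+1 w).2).
  by apply: vmomentsZ; exact: vmoments_stepH.
apply: (@has_smooth_density_ae _ _ _ _ _ _ (fun w => row_mx (X N w).1 (X N w).2)).
- exact: measurable_row_mx.
- by apply: measurable_row_mx; exact: adapted_measurable (@mG N) _.
- by apply: filterS XE => w /(_ N (leqnn N))[-> ->].
have [axi law1 _] := xiP n nN; have [_ law2 _] := xiP n.+1 n1N.
have mphi : measurable_fun setT (fun z : 'rV[R]_d => (s *: z) *m noise_mx sigma).
  by have [] := law1.
have := two_step_smooth_density e smF polyF k0 c0 Gsec mphi noiseE GY YG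
  (sG n) (@mG n) (sG n.+1) (@mG n.+1) aq1 aa1 (@G1 n) law1 law2 axi
  (vmoments_norm vq1) (vmoments_norm va1).
by rewrite NE.
Qed.
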